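(* Let $0<s<2$ and let $b$ be a collision kernel with Debye-Yukawa singularity of parameter $s$ (as specified in the context). Let $\alpha>0$, let $\psi_0\in\mathcal{K}^{\alpha}$, and let $\psi\in C([0,+\infty),\mathcal{K}^{\alpha})$ be the unique solution of the Cauchy problem $$\partial_t\psi(t,\xi)=\int_{\mathbb{S}^2}b\left(\frac{\xi\cdot\sigma}{|\xi|}\right)\big(\psi(t,\xi^+)\psi(t,\xi^-)-\psi(t,\xi)\psi(t,0)\big)\,d\sigma,\qquad \psi(0,\xi)=\psi_0(\xi),$$ where $\xi^{\pm}=\frac{\xi}{2}\pm\frac{|\xi|}{2}\sigma$. For any $T>0$, if there exists a constant $D_T>0$ such that $$\inf_{t\in[0,T]}\big(1-|\psi(t,\xi)|\big)\ge D_T\min(1,|\xi|^2)\qquad\text{for all }\xi\in\mathbb{R}^3,$$ then for every $t\in(0,T]$ the inverse Fourier transform of $\psi(t,\cdot)$ belongs to $H^{\infty}(\mathbb{R}^3)$.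
   Context: Collision kernel: $b:[-1,1)\to[0,\infty)$ is a nonnegative measurable function of $\cos\theta$, supported in $\{\cos\theta\ge 0\}$, i.e. $0\le\theta\le\pi/2$. It has Debye-Yukawa singularity of parameter $s>0$ if $b(\cos\theta)\sim\theta^{-2}\left(\log\big(\theta/2\big)^{-1}\right)^{\frac2s-1}$ as $\theta\to0^+$, where $\sim$ means that for some $\theta_0\in(0,\pi/2)$ the quotient of the two sides lies between two positive constants for $0<\theta\le\theta_0$; moreover $\theta\mapsto b(\cos\theta)\sin\theta$ is integrable on $[\theta_0,\pi/2]$. In the integral over $\mathbb{S}^2$, $\cos\theta=\frac{\xi\cdot\sigma}{|\xi|}$ and $d\sigma$ is the surface measure; for $\xi=0$ the right-hand side of the equation is understood to be $0$. Characteristic functions: $\mathcal{K}$ is the set of functions $\psi:\mathbb{R}^3\to\mathbb{C}$ for which there is a Borel probability measure $\Psi$ on $\mathbb{R}^3$ with $\psi(\xi)=\int_{\mathbb{R}^3}e^{-iv\cdot\xi}\,d\Psi(v)$. For $\alpha\ge0$, $\mathcal{K}^{\alpha}=\{\varphi\in\mathcal{K}:\|\varphi-1\|_{\alpha}<+\infty\}$, where $\|\varphi-\psi\|_{\alpha}=\sup_{\xi\in\mathbb{R}^3\setminus\{0\}}\frac{|\varphi(\xi)-\psi(\xi)|}{|\xi|^{\alpha}}$; $\mathcal{K}^{\alpha}$ is a metric space with distance $\|\varphi-\psi\|_{\alpha}$, and $C([0,+\infty),\mathcal{K}^{\alpha})$ denotes the continuous maps into this metric space. Solution: a (classical) solution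 is a $\psi\in C([0,+\infty),\mathcal{K}^{\alpha})$ such that for each $\xi$ the map $t\mapsto\psi(t,\xi)$ is continuously differentiable on $[0,+\infty)$ and the equation and the initial condition hold pointwise. For this kernel and every $\psi_0\in\mathcal{K}^{\alpha}$, such a solution exists and is unique. $H^{\infty}(\mathbb{R}^3)=\bigcap_{k\ge0}H^k(\mathbb{R}^3)$ is the intersection of all $L^2$-based Sobolev spaces. *)

(* Defs.v *)
From mathcomp Require Import all_boot all_order all_algebra.
From mathcomp Require Import all_classical all_reals all_analysis.
From mathcomp Require Export complex.

Set Implicit Arguments.
Unset Strict Implicit.
Unset Printing Implicit Defensive.

Import Order.TTheory GRing.Theory Num.Theory.
Import numFieldNormedType.Exports.

Local Open Scope classical_set_scope.
Local Open Scope ring_scope.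
Local Open Scope complex_scope.

(* R^3 is the iterated product R * R * R: the library gives it its normed and
   topological structure and, through measurableTypeR, the product
   sigma-algebra, which is the Borel one.  The library norm on a product is the
   sup norm, hence the explicit Euclidean norm enorm. *)
Notation vec3 R := (R * R * R)%type.
Notation mvec3 R :=
  (measurableTypeR R * measurableTypeR R * measurableTypeR R)%type.

Section vectors.
Context {R : realType}.
Implicit Types x y : vec3 R.

Definition dot x y : R := x.1.1 * y.1.1 + x.1.2 * y.1.2 + x.2 * y.2.

Definition enorm x : R := Num.sqrt (dot x x).

Definition lebesgue3 : {measure set (mvec3 R) -> \bar R} :=
  ((lebesgue_measure \x lebesgue_measure) \x lebesgue_measure)%E.

End vectors.

Section complex_valued.
Context {R : realType}.

Definition cabs : R[i] -> R := @ComplexField.Normc.normc R.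

Definition cis (x : R) : R[i] := cos x +i* sin x.

(* Componentwise, hence meaningful when both parts are integrable. *)
Definition cintegral d (T : measurableType d) (mu : {measure set T -> \bar R})
    (D : set T) (f : T -> R[i]) : R[i] :=
  Rintegral mu D (fun x => complex.Re (f x)) +i*
  Rintegral mu D (fun x => complex.Im (f x)).

(* f has derivative l at t relatively to D: limit of the difference quotient at
   u -> t, u in D, u <> t (one-sided at an end point of D). *)
Definition derivative_within (D : set R) (f : R -> R) (t l : R) : Prop :=
  (f u - f t) / (u - t) @[u --> within D t^'] --> l.

Definition cderivative_within (D : set R) (f : R -> R[i]) (t : R) (l : R[i])
    : Prop :=
  derivative_within D (fun u => complex.Re (f u)) t (complex.Re l) /\
  derivative_within D (fun u => complex.Im (f u)) t (complex.Im l).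

Definition cC1_on (D : set R) (f : R -> R[i]) : Prop :=
  exists f' : R -> R[i],
    [/\ forall t, D t -> cderivative_within D f t (f' t),
        {within D, continuous (fun t => complex.Re (f' t))} &
        {within D, continuous (fun t => complex.Im (f' t))}].

End complex_valued.

Section sphere.
Context {R : realType}.

Definition spherical (a : R * R) : vec3 R :=
  (sin a.1 * cos a.2, sin a.1 * sin a.2, cos a.1).

(* The surface integral over S^2, with the area element sin theta dtheta dphi of
   the parametrization (theta, phi) in [0, pi] x [0, 2 pi]. *)
Definition sphere_integral (f : vec3 R -> R[i]) : R[i] :=
  cintegral (lebesgue_measure \x lebesgue_measure)%E
    (`[0, pi] `*` `[0, 2 * pi])
    (fun a : measurableTypeR R * measurableTypeR R =>
       f (spherical a) * (sin a.1)%:C).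

End sphere.

Section kernel.
Context {R : realType}.

(* b is meant on [-1, 1) only; the value of the total function b
   at 1 is irrelevant, the point sigma = xi / |xi| being negligible. *)
Definition collision_kernel (b : R -> R) : Prop :=
  [/\ measurable_fun (`[-1, 1[ : set R) b,
      forall x : R, x \in `[-1, 1[ -> 0 <= b x &
      forall x : R, x \in `[-1, 0[ -> b x = 0].

Definition debye_yukawa (s : R) (b : R -> R) : Prop :=
  exists theta0 : R, [/\ 0 < theta0 < pi / 2,
    exists c1 c2 : R, 0 < c1 /\ 0 < c2 /\
      forall theta : R, 0 < theta <= theta0 ->
        c1 <= b (cos theta) /
              (theta ^- 2 * (ln ((theta / 2)^-1)) `^ (2 / s - 1)) <= c2 &
    lebesgue_measure.-integrable `[theta0, pi / 2]
      (fun theta => (b (cos theta) * sin theta)%:E)].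

End kernel.

Section characteristic_functions.
Context {R : realType}.
Implicit Types phi psi : vec3 R -> R[i].

Definition charfun (P : probability (mvec3 R) R) (xi : vec3 R) : R[i] :=
  cintegral P setT (fun v : mvec3 R => cis (- dot v xi)).

Definition charK phi : Prop :=
  exists P : probability (mvec3 R) R, forall xi, phi xi = charfun P xi.

Definition dist_alpha (alpha : R) phi psi : \bar R :=
  ereal_sup [set (cabs (phi xi - psi xi) / enorm xi `^ alpha)%:E
            | xi in [set xi : vec3 R | xi != 0]].

Definition charKalpha (alpha : R) phi : Prop :=
  charK phi /\ (dist_alpha alpha phi (fun=> 1%R) < +oo)%E.

(* psi : R -> vec3 R -> R[i] restricted to t >= 0 is in C([0, +oo), K^alpha);
   its values at negative times are irrelevant. *)
Definition continuous_in_Kalpha (alpha : R) (psi : R -> vec3 R -> R[i])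
    : Prop :=
  (forall t : R, 0 <= t -> charKalpha alpha (psi t)) /\
  (forall t : R, 0 <= t ->
    dist_alpha alpha (psi u) (psi t) @[u --> within `[0, +oo[ (nbhs t)] --> 0%E).

End characteristic_functions.

Section equation.
Context {R : realType}.

Definition xi_plus (xi sigma : vec3 R) : vec3 R :=
  2^-1 *: xi + (enorm xi / 2) *: sigma.
Definition xi_minus (xi sigma : vec3 R) : vec3 R :=
  2^-1 *: xi - (enorm xi / 2) *: sigma.

Definition collision (b : R -> R) (phi : vec3 R -> R[i]) (xi : vec3 R) : R[i] :=
  if xi == 0 then 0 else
  sphere_integral (fun sigma =>
    (b (dot xi sigma / enorm xi))%:C *
    (phi (xi_plus xi sigma) * phi (xi_minus xi sigma) - phi xi * phi 0)).

Definition solution (alpha : R) (b : R -> R) (psi0 : vec3 R -> R[i])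
    (psi : R -> vec3 R -> R[i]) : Prop :=
  [/\ continuous_in_Kalpha alpha psi,
      forall xi, cC1_on `[0, +oo[ (fun t => psi t xi),
      forall (t : R) (xi : vec3 R), 0 <= t ->
        cderivative_within `[0, +oo[ (fun u => psi u xi) t
          (collision b (psi t) xi) &
      forall xi, psi 0 xi = psi0 xi].

End equation.

Section sobolev.
Context {R : realType}.
Implicit Types phi g : vec3 R -> R[i].

Definition basis3 (i : 'I_3) : vec3 R :=
  ((i == 0 :> nat)%:R, (i == 1 :> nat)%:R, (i == 2 :> nat)%:R).

Definition partial (i : 'I_3) (f : vec3 R -> R) : vec3 R -> R :=
  fun x => 'D_(basis3 i) f x.

Definition partials (s : seq 'I_3) (f : vec3 R -> R) : vec3 R -> R :=
  foldr partial f s.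

Definition schwartz_real (f : vec3 R -> R) : Prop :=
  (forall (s : seq 'I_3) (x : vec3 R), differentiable (partials s f) x) /\
  (forall (s : seq 'I_3) (N : nat), exists C : R, forall x,
     (1 + enorm x) ^+ N * `|partials s f x| <= C).

Definition schwartz phi : Prop :=
  schwartz_real (fun x => complex.Re (phi x)) /\
  schwartz_real (fun x => complex.Im (phi x)).

Definition fourier phi (xi : vec3 R) : R[i] :=
  cintegral lebesgue3 setT (fun v : mvec3 R => cis (- dot v xi) * phi v).

Definition inv_fourier phi (v : vec3 R) : R[i] :=
  ((2 * pi) ^- 3)%:C *
  cintegral lebesgue3 setT (fun xi : mvec3 R => cis (dot v xi) * phi xi).

(* A tempered distribution is given by its action on Schwartz functions; only
   its values there matter. *)
Definition tdistribution := (vec3 R -> R[i]) -> R[i].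

Definition regular_distr g : tdistribution :=
  fun phi => cintegral lebesgue3 setT (fun x : mvec3 R => g x * phi x).

Definition fourier_distr (u : tdistribution) : tdistribution :=
  fun phi => u (fourier phi).

Definition inv_fourier_distr (u : tdistribution) : tdistribution :=
  fun phi => u (inv_fourier phi).

(* H^k(R^3), k real: the Fourier transform of u is (the regular distribution of)
   a measurable g with (1 + |xi|^2)^(k/2) g in L^2.  Linearity and continuity of
   u on Schwartz functions are not separate clauses: they follow, the Fourier
   transform being an automorphism of the Schwartz space. *)
Definition sobolev (k : R) (u : tdistribution) : Prop :=
  exists g : vec3 R -> R[i],
    [/\ measurable_fun setT (fun xi : mvec3 R => complex.Re (g xi)),
        measurable_fun setT (fun xi : mvec3 R => complex.Im (g xi)),
        (\int[lebesgue3]_(xi in [set: mvec3 R])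
           ((1 + enorm xi ^+ 2) `^ k * cabs (g xi) ^+ 2)%:E < +oo)%E &
        forall phi, schwartz phi ->
          fourier_distr u phi = regular_distr g phi].

Definition sobolev_infty (u : tdistribution) : Prop :=
  forall k : R, 0 <= k -> sobolev k u.

End sobolev.

(* Main.v *)
From HB Require Import structures.
Require Import Defs.
From mathcomp Require Import all_boot all_order all_algebra.
From mathcomp Require Import all_classical all_reals all_analysis.
From mathcomp Require Import measurable_realfun ring lra.

(** At high frequency the collision integral dissipates the modulus of the
solution, and the singularity of the kernel makes the dissipation rate grow
faster than any multiple of a logarithm; this is enough to produce arbitrary
polynomial decay in positive time.

Write r = |xi| and y = (1 - cos theta) / 2, so that |xi^-|^2 = r^2 y and
|xi^+|^2 = r^2 (1 - y).  Coercivity bounds 1 - |psi(t, xi^-)| below by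
D min(1, r^2 y), so the loss rate at frequency xi is at least D I(r), where I(r)
is the integral of b min(1, r^2 y) over the sphere.  Near theta = 0 the kernel is
comparable with theta^-2 (log (2 / theta))^(2/s - 1), and s < 2 makes the
exponent 2/s - 1 positive; hence I(r) / log r tends to infinity
([kernel_angle_growth]).

Fix lam > 0 and let W(t, xi) = |psi(t, xi)|^2 r^(2 lam t).  On the compact set
[0, T] x (1 <= |xi| <= rho) the function W has a maximum.  Since |xi^+| <= |xi|,
comparing W at xi^+ and at xi gives |psi(t, xi^+)| <= |psi(t, xi)| (1 + A y) with
A depending on lam T only.  Inserted in the equation this yields, at the maximum,
  d/dt W <= 2 W (A B - D I(r) + lam log r),   B = integral of b y,
where the factor y cancels the singularity of b.  For r large the right-hand side
is negative, which is impossible at a maximum with t > 0.  So W is bounded on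
[0, T] x (|xi| >= 1), uniformly in rho ([weighted_modulus_bound]), and letting
lam be arbitrary, psi(t, .) decays faster than every power of |xi| for every
t > 0 ([polynomial_decay]).

Three tools support this.  The integrand of the collision integral is
integrable because a characteristic function satisfies
|phi(a) - phi(b)|^2 <= 2 |phi(a - b) - 1|, whence
|phi(xi^+) phi(xi^-) - phi(xi)| = O(y^(alpha/4)) ([charK_product_le]).  Surface
integrals of functions of the angle between xi and sigma are reduced to integrals
over [0, pi] by rotation invariance ([ge0_sphere_law]).  Finally, that psi(t, .)
is the Fourier transform of its inverse Fourier transform in the sense of
distributions is Fourier inversion on Schwartz functions
([inv_fourier_fourier]). *)

Import Order.TTheory GRing.Theory Num.Theory.
Import numFieldNormedType.Exports.

Local Open Scope classical_set_scope.
Local Open Scope ring_scope.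

Set Implicit Arguments.
Unset Strict Implicit.
Unset Printing Implicit Defensive.

(** * Measurability, product measures and domination *)

Lemma invSn_cvg (R : realType) : (n.+1%:R^-1 : R) @[n --> \oo] --> (0 : R).
Proof. exact: (@cvg_harmonic R). Qed.

Section caratheodory.
Context {R : realType} {d : measure_display} {Y : measurableType d}.

(** A Caratheodory function is the pointwise limit of the functions obtained by
rounding its continuous variable down to a multiple of 1 / (n + 1). *)
Lemma caratheodory_measurable (f : Y * R -> R) :
  (forall y, continuous (fun x => f (y, x))) ->
  (forall x, measurable_fun setT (fun y => f (y, x))) ->
  measurable_fun setT (f : Y * measurableTypeR R -> R).
Proof.
move=> fc fm.
pose r n (x : R) : R := (Num.floor (x * n.+1%:R))%:~R / n.+1%:R.
have mr n (k : int) : measurable [set x : R | Num.floor (x * n.+1%:R) = k].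
  rewrite (_ : [set x : R | _] = `[k%:~R / n.+1%:R, (k + 1)%:~R / n.+1%:R[%classic).
    exact: measurable_itv.
  apply/seteqP; split => x /=.
    move=> <-; rewrite in_itv /= ler_pdivrMr ?ltr0n // ltr_pdivlMr ?ltr0n //.
    exact: floor_itv.
  rewrite in_itv /= ler_pdivrMr ?ltr0n // ltr_pdivlMr ?ltr0n // => h.
  exact/floor_def.
pose fn n (a : Y * R) := f (a.1, r n a.2).
apply: (@measurable_fun_cvg _ _ _ _ fn) => [n|[y x] _].
  move=> _ A mA; rewrite setTI.
  rewrite (_ : _ @^-1` _ = \bigcup_(k in [set: int])
     ([set y | A (f (y, k%:~R / n.+1%:R))] `*` [set x : R | Num.floor (x * n.+1%:R) = k])).
    apply: countable_bigcupT_measurable => // k.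
    apply: measurableX => //.
    by have := fm (k%:~R / n.+1%:R) measurableT A mA; rewrite setTI.
  apply/seteqP; split => [[y x] /= h|[y x] /= [k _ [/= h1 h2]]].
    by exists (Num.floor (x * n.+1%:R)).
  by rewrite /fn /= /r h2.
rewrite /fn /=.
apply: (cvg_comp (fun n => r n x) (fun x => f (y, x)) _ (fc y x)).
apply/cvgrPdist_le => e e0.
have /cvgrPdist_le /(_ e e0) := @invSn_cvg R.
apply: filterS => n; rewrite sub0r normrN ger0_norm ?invr_ge0// => h.
apply: le_trans h.
have /andP[h1 h2] := floor_itv (x * n.+1%:R).
have n0 : 0 < n.+1%:R :> R by rewrite ltr0n.
rewrite /r -[X in X - _](mulfK (lt0r_neq0 n0)) -mulrBl normrM (@ger0_norm _ (n.+1%:R^-1)) ?invr_ge0//.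
rewrite -[leRHS]mul1r ler_wpM2r ?invr_ge0//.
by rewrite ger0_norm ?subr_ge0 // lerBlDl -intrD1 ltW.
Qed.

End caratheodory.

Section vec3_measurability.
Context {R : realType}.

(** The product sigma-algebra makes the Borel measurability of continuous functions
a Caratheodory argument, one variable at a time. *)
Lemma continuous2_measurable (f : R * R -> R) : continuous f ->
  measurable_fun setT (f : measurableTypeR R * measurableTypeR R -> R).
Proof.
move=> cf; apply: caratheodory_measurable => [y x|x].
  apply: continuous_comp; last exact: cf.
  exact: cvg_pair (cvg_cst _) cvg_id.
apply: continuous_measurable_fun => y; apply: continuous_comp; last exact: cf.
exact: cvg_pair cvg_id (cvg_cst _).
Qed.

Lemma continuous3_measurable (f : vec3 R -> R) : continuous f ->
  measurable_fun setT (f : mvec3 R -> R).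
Proof.
move=> cf; apply: caratheodory_measurable => [y x|x].
  apply: continuous_comp; last exact: cf.
  exact: cvg_pair (cvg_cst _) cvg_id.
apply: continuous2_measurable => y; apply: continuous_comp; last exact: cf.
exact: cvg_pair cvg_id (cvg_cst _).
Qed.

End vec3_measurability.

(** The product of two sigma-finite measures, under a name that carries the
sigma-finite structure, so that products can be iterated and Fubini applied to
each of them; it is convertible to [m1 \x m2]. *)
Definition prodm d1 d2 (T1 : measurableType d1) (T2 : measurableType d2)
    (R : realType) (m1 : {sigma_finite_measure set T1 -> \bar R})
    (m2 : {sigma_finite_measure set T2 -> \bar R}) : set (T1 * T2) -> \bar R :=
  (m1 \x m2)%E.

Section prodm_sigma_finite.
Context d1 d2 (T1 : measurableType d1) (T2 : measurableType d2) (R : realType).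
Variables (m1 : {sigma_finite_measure set T1 -> \bar R})
          (m2 : {sigma_finite_measure set T2 -> \bar R}).

HB.instance Definition _ := Measure.on (prodm m1 m2).

HB.instance Definition _ := Measure_isSigmaFinite.Build _ _ _ (prodm m1 m2)
  (isSigmaFinite.sigma_finiteT
     (lebesgue_integral_fubini.measure_function_Measure_isSigmaFinite__to__measure_function_isSigmaFinite m1 m2)).

Lemma integral_tensor (f : T1 -> R) (g : T2 -> R) :
  measurable_fun setT f -> measurable_fun setT g ->
  (forall x, 0 <= f x) -> (forall y, 0 <= g y) ->
  (\int[prodm m1 m2]_z (f z.1 * g z.2)%:E =
   \int[m1]_x (f x)%:E * \int[m2]_y (g y)%:E)%E.
Proof.
move=> mf mg f0 g0.
rewrite [LHS](fubini_tonelli1 (fun z : T1 * T2 => (f z.1 * g z.2)%:E)); first last.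
- by move=> z; rewrite lee_fin mulr_ge0.
- apply/measurable_EFinP/measurable_funM.
  + by apply: (measurableT_comp mf); exact: measurable_fst.
  + by apply: (measurableT_comp mg); exact: measurable_snd.
rewrite /fubini_F /=.
under eq_integral => x _.
  under eq_integral do rewrite EFinM.
  rewrite ge0_integralZl//.
  - over.
  - exact/measurable_EFinP.
  - by move=> y _; rewrite lee_fin.
  - by rewrite lee_fin.
rewrite ge0_integralZr//.
- exact/measurable_EFinP.
- by move=> y _; rewrite lee_fin.
- by apply: integral_ge0 => y _; rewrite lee_fin.
Qed.

End prodm_sigma_finite.

Section cauchy_weight.
Context {R : realType}.
Local Notation mu := (@lebesgue_measure R).

Definition weight1 (x : R) : R := (1 + x ^+ 2)^-1.

Definition weight2 (p : R * R) : R := weight1 p.1 * weight1 p.2.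

(** An integrable function on R^3 that is a tensor product: domination by a
multiple of it passes to slices and leaves a multiple of the one-dimensional
weight, which is what slice-by-slice integration requires. *)
Definition weight (v : vec3 R) : R := weight2 v.1 * weight1 v.2.

Lemma weight1_gt0 x : 0 < weight1 x.
Proof. by rewrite invr_gt0 ltr_pwDl// sqr_ge0. Qed.

Lemma weight1_le1 x : weight1 x <= 1.
Proof. by rewrite invf_le1 ?lerDl ?sqr_ge0// ltr_pwDl// sqr_ge0. Qed.

Lemma weight1N x : weight1 (- x) = weight1 x.
Proof. by rewrite /weight1 sqrrN. Qed.

Lemma continuous_weight1 : continuous weight1.
Proof. exact: continuous_oneDsqrV. Qed.

Lemma measurable_weight1 : measurable_fun setT weight1.
Proof. exact: continuous_measurable_fun continuous_weight1. Qed.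

Lemma weight2_gt0 p : 0 < weight2 p.
Proof. by rewrite mulr_gt0 ?weight1_gt0. Qed.

Lemma weight_gt0 v : 0 < weight v.
Proof. by rewrite mulr_gt0 ?weight1_gt0 ?weight2_gt0. Qed.

Lemma integral_weight1 : (\int[mu]_x (weight1 x)%:E = pi%:E)%E.
Proof.
rewrite ge0_symfun_integralT.
- rewrite -set_itvcy (_ : (fun x => (weight1 x)%:E) = (fun x => (oneDsqr x)^-1%:E)) //.
  rewrite integral0y_oneDsqr -EFinM; congr EFin.
  by rewrite mulrCA mulfV // mulr1.
- by move=> x; exact/ltW/weight1_gt0.
- exact: continuous_weight1.
- by move=> x /=; rewrite weight1N.
Qed.

Lemma measurable_weight2 :
  measurable_fun setT (weight2 : measurableTypeR R * measurableTypeR R -> R).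
Proof.
apply: measurable_funM.
- by apply: (measurableT_comp measurable_weight1); exact: measurable_fst.
- by apply: (measurableT_comp measurable_weight1); exact: measurable_snd.
Qed.

Lemma measurable_weight : measurable_fun setT (weight : mvec3 R -> R).
Proof.
apply: measurable_funM.
- by apply: (measurableT_comp measurable_weight2); exact: measurable_fst.
- by apply: (measurableT_comp measurable_weight1); exact: measurable_snd.
Qed.

Lemma integral_weight2 : (\int[prodm mu mu]_p (weight2 p)%:E = (pi ^+ 2)%:E)%E.
Proof.
rewrite [LHS]integral_tensor; first by rewrite !integral_weight1.
- exact: measurable_weight1.
- exact: measurable_weight1.
- by move=> x; exact/ltW/weight1_gt0.
- by move=> x; exact/ltW/weight1_gt0.
Qed.

Lemma integral_weight :
  (\int[prodm (prodm mu mu) mu]_p (weight p)%:E = (pi ^+ 3)%:E)%E.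
Proof.
rewrite [LHS]integral_tensor.
- rewrite integral_weight2 integral_weight1 -EFinM; congr EFin.
  by rewrite -exprSr.
- exact: measurable_weight2.
- exact: measurable_weight1.
- by move=> x; exact/ltW/weight2_gt0.
- by move=> x; exact/ltW/weight1_gt0.
Qed.

Lemma integrable_le_weight d (T : measurableType d)
    (m : {measure set T -> \bar R}) (w f : T -> R) (C : R) :
  measurable_fun setT w -> (forall x, 0 <= w x) ->
  (\int[m]_x (w x)%:E < +oo)%E ->
  measurable_fun setT f -> (forall x, `|f x| <= C * w x) ->
  m.-integrable setT (EFin \o f).
Proof.
move=> mw w0 iw mf fw.
have intw : m.-integrable setT (EFin \o w).
  apply/integrableP; split; first exact/measurable_EFinP.
  by under eq_integral do rewrite /= ger0_norm//.
have := integrableZl measurableT C intw.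
apply: le_integrable => //; first exact/measurable_EFinP.
by move=> x _ /=; rewrite lee_fin (le_trans (fw x))// ler_norm.
Qed.

Lemma dominated_integrable1 (f : R -> R) (C : R) : measurable_fun setT f ->
  (forall x, `|f x| <= C * weight1 x) -> mu.-integrable setT (EFin \o f).
Proof.
apply: (@integrable_le_weight _ _ mu weight1 f C).
- exact: measurable_weight1.
- by move=> x; exact/ltW/weight1_gt0.
- by rewrite integral_weight1 ltry.
Qed.

Lemma dominated_integrable2 (f : R * R -> R) (C : R) :
  measurable_fun setT (f : measurableTypeR R * measurableTypeR R -> R) ->
  (forall x, `|f x| <= C * weight2 x) ->
  (prodm mu mu).-integrable setT (EFin \o f).
Proof.
apply: (@integrable_le_weight _ _ (prodm mu mu) weight2 f C).
- exact: measurable_weight2.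
- by move=> x; exact/ltW/weight2_gt0.
- by rewrite integral_weight2 ltry.
Qed.

Lemma dominated_integrable3 (f : vec3 R -> R) (C : R) :
  measurable_fun setT (f : mvec3 R -> R) ->
  (forall x, `|f x| <= C * weight x) ->
  (prodm (prodm mu mu) mu).-integrable setT (EFin \o f).
Proof.
apply: (@integrable_le_weight _ _ (prodm (prodm mu mu) mu) weight f C).
- exact: measurable_weight.
- by move=> x; exact/ltW/weight_gt0.
- by rewrite integral_weight ltry.
Qed.

End cauchy_weight.

Lemma dominated_cvg_EFin d (T : measurableType d) (R : realType)
    (m : {measure set T -> \bar R}) (D : set T) (f_ : nat -> T -> R)
    (f g : T -> R) : measurable D ->
  (forall n, measurable_fun D (f_ n)) ->
  (forall x, D x -> f_ n x @[n --> \oo] --> f x) ->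
  m.-integrable D (EFin \o g) ->
  (forall n x, D x -> `|f_ n x| <= g x) ->
  (\int[m]_(x in D) (f_ n x)%:E @[n --> \oo] --> \int[m]_(x in D) (f x)%:E)%E.
Proof.
move=> mD mf ff ig fg.
apply: (@dominated_cvg _ _ _ _ _ mD (fun n x => (f_ n x)%:E) (fun x => (f x)%:E)
  (fun x => (g x)%:E)) => //.
- by move=> n; exact/measurable_EFinP.
by move=> x Dx; apply: cvg_EFin (ff x Dx); exact: nearW.
Qed.

Section slices.
Context {R : realType}.
Local Notation mu := (@lebesgue_measure R).
Local Notation mu2 := (prodm mu mu).
Local Notation mu3 := (prodm (prodm mu mu) mu).

(** The class of functions to which Fubini and the slicing lemmas apply. *)
Definition dominated3 (f : vec3 R -> R) : Prop :=
  measurable_fun setT (f : mvec3 R -> R) /\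
  exists C : R, forall v, `|f v| <= C * weight v.

Lemma dominated3_integrable f : dominated3 f -> mu3.-integrable setT (EFin \o f).
Proof. by move=> [mf [C fC]]; exact: dominated_integrable3 fC. Qed.

Lemma measurable_slice2 (f : vec3 R -> R) (z : R) :
  measurable_fun setT (f : mvec3 R -> R) ->
  measurable_fun setT
    ((fun p => f (p, z)) : measurableTypeR R * measurableTypeR R -> R).
Proof. by move=> mf; exact: (measurableT_comp mf). Qed.

Lemma integral_slice2 (f g : R * R -> R) (C : R) :
  measurable_fun setT (f : measurableTypeR R * measurableTypeR R -> R) ->
  measurable_fun setT (g : measurableTypeR R * measurableTypeR R -> R) ->
  (forall p, `|f p| <= C * weight2 p) -> (forall p, `|g p| <= C * weight2 p) ->
  (forall x, \int[mu]_y (f (x, y))%:E = \int[mu]_y (g (x, y))%:E)%E \/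
  (forall y, \int[mu]_x (f (x, y))%:E = \int[mu]_x (g (x, y))%:E)%E ->
  (\int[mu2]_p (f p)%:E = \int[mu2]_p (g p)%:E)%E.
Proof.
move=> mf mg fC gC.
have iF := dominated_integrable2 mf fC.
have iG := dominated_integrable2 mg gC.
move=> [] fg.
- have := integral12_prod_meas1 iF; rewrite /fubini_F => <-.
  have := integral12_prod_meas1 iG; rewrite /fubini_F => <-.
  by apply: eq_integral => x _; exact: fg.
- have := integral21_prod_meas1 iF; rewrite /fubini_G => <-.
  have := integral21_prod_meas1 iG; rewrite /fubini_G => <-.
  by apply: eq_integral => x _; exact: fg.
Qed.

(** Two dominated functions have the same integral as soon as their integrals
agree along every line parallel to one coordinate axis.  This is how
one-dimensional integrations by parts and substitutions act on R^3. *)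
Lemma integral_slice3 (f g : vec3 R -> R) : dominated3 f -> dominated3 g ->
  [\/ forall y z, (\int[mu]_x (f (x, y, z))%:E = \int[mu]_x (g (x, y, z))%:E)%E,
      forall x z, (\int[mu]_y (f (x, y, z))%:E = \int[mu]_y (g (x, y, z))%:E)%E |
      forall x y, (\int[mu]_z (f (x, y, z))%:E = \int[mu]_z (g (x, y, z))%:E)%E] ->
  (\int[mu3]_v (f v)%:E = \int[mu3]_v (g v)%:E)%E.
Proof.
move=> df dg h; have [mf [Cf fC]] := df; have [mg [Cg gC]] := dg.
have slice w : (forall z, (\int[mu2]_p (f (p, z))%:E = \int[mu2]_p (g (p, z))%:E)%E) -> w ->
   (\int[mu3]_v (f v)%:E = \int[mu3]_v (g v)%:E)%E.
  move=> fg _.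
  have := integral21_prod_meas1 (dominated3_integrable df); rewrite /fubini_G => <-.
  have := integral21_prod_meas1 (dominated3_integrable dg); rewrite /fubini_G => <-.
  by apply: eq_integral => x _; exact: fg.
have dom z (k : vec3 R -> R) Ck : Ck <= `|Cf| + `|Cg| -> (forall v, `|k v| <= Ck * weight v) ->
   forall p : R * R, `|k (p, z)| <= ((`|Cf| + `|Cg|) * weight1 z) * weight2 p.
  move=> CC kC p; apply: le_trans (kC _) _; rewrite /weight /=.
  rewrite -mulrA [weight1 z * _]mulrC ler_wpM2r// ltW// mulr_gt0 ?weight1_gt0 ?weight2_gt0 //.
have Cf' : Cf <= `|Cf| + `|Cg| by rewrite ler_wpDr// ler_norm.
have Cg' : Cg <= `|Cf| + `|Cg| by rewrite ler_wpDl// ler_norm.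
case: h => fg.
- apply: (slice True) => // z.
  apply: (integral_slice2 _ _ (dom z f _ Cf' fC) (dom z g _ Cg' gC)).
  + exact: measurable_slice2.
  + exact: measurable_slice2.
  + by right => y; exact: fg.
- apply: (slice True) => // z.
  apply: (integral_slice2 _ _ (dom z f _ Cf' fC) (dom z g _ Cg' gC)).
  + exact: measurable_slice2.
  + exact: measurable_slice2.
  + by left => y; exact: fg.
- have := integral12_prod_meas1 (dominated3_integrable df); rewrite /fubini_F => <-.
  have := integral12_prod_meas1 (dominated3_integrable dg); rewrite /fubini_F => <-.
  by apply: eq_integral => -[x y] _; exact: fg.
Qed.

Lemma FTC_segment (F f : R -> R) (a b : R) : a < b ->
  (forall x : R, a <= x <= b -> is_derive x (1 : R) F (f x)) ->
  (forall x : R, a <= x <= b -> {for x, continuous f}) ->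
  (\int[mu]_(x in `[a, b]) (f x)%:E = (F b - F a)%:E)%E.
Proof.
move=> ab dF cf; rewrite EFinB.
have cF x : a <= x <= b -> {for x, continuous F}.
  by move=> h; apply/differentiable_continuous/derivable1_diffP; case: (dF x h).
have oc x : x \in `]a, b[ -> a <= x <= b.
  by rewrite in_itv /= => /andP[/ltW -> /ltW ->].
have la := ltW ab; apply: continuous_FTC2 => //.
- by apply: continuous_in_subspaceT => x; rewrite inE /= in_itv /=; exact: cf.
- split => [x /oc h||].
  + by case: (dF x h).
  + by apply: cvg_at_right_filter; apply: cF; rewrite lexx.
  + by apply: cvg_at_left_filter; apply: cF; rewrite lexx andbT.
- by move=> x /oc h; rewrite derive1E; case: (dF x h).
Qed.

(** The integral over [-n, n] is a boundary term, which tends to 0 because g is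
bounded by the weight. *)
Lemma integral_derive_eq0 (g g' : R -> R) (C : R) :
  (forall x : R, is_derive x (1 : R) g (g' x)) -> continuous g' ->
  (forall x, `|g x| <= C * weight1 x) -> (forall x, `|g' x| <= C * weight1 x) ->
  (\int[mu]_x (g' x)%:E = 0)%E.
Proof.
move=> dg cg' gC g'C.
have mg' : measurable_fun setT g' by exact: continuous_measurable_fun.
pose I n : set R := `[(- n.+1%:R), n.+1%:R]%classic.
pose fn n x : R := (g' \_ (I n)) x.
have cvgI : (\int[mu]_x (fn n x)%:E @[n --> \oo] --> \int[mu]_x (g' x)%:E)%E.
  apply: (@dominated_cvg_EFin _ _ _ mu setT fn g' (fun x => C * weight1 x)) => //.
  - move=> n; apply/measurable_restrict => //; first exact: measurable_itv.
    by rewrite setTI; exact: measurable_funTS.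
  - move=> x _; apply: cvg_near_cst.
    exists `|Num.ceil `|x| |%N => // n /= hn.
    rewrite /fn patchE ifT// inE /I /= in_itv /= -ler_norml.
    apply: le_trans (ceil_ge _) _.
    rewrite (le_trans (ler_norm _))// -intr_norm -natr_absz ler_nat.
    by rewrite (leq_trans hn).
  - have := @dominated_integrable1 R (fun x => C * weight1 x) `|C|; apply.
    + by apply: measurable_funM => //; exact: measurable_weight1.
    + by move=> x; rewrite normrM (@ger0_norm _ (weight1 x)) // ltW // weight1_gt0.
  - move=> n x _; rewrite /fn patchE; case: ifPn => _; rewrite ?g'C//.
    by rewrite normr0 (le_trans _ (gC x)).
have eqI n : (\int[mu]_x (fn n x)%:E = (g n.+1%:R - g (- n.+1%:R))%:E)%E.
  have nn : - n.+1%:R < n.+1%:R :> R by rewrite (@lt_trans _ _ 0)// oppr_lt0.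
  rewrite -(FTC_segment nn (fun x _ => dg x) (fun x _ => cg' x)).
  rewrite [RHS]integral_mkcond; apply: eq_integral => x _.
  by rewrite /fn !patchE; case: ifP.
have gcv : g n.+1%:R - g (- n.+1%:R) @[n --> \oo] --> (0 : R).
  apply: norm_cvg0.
  have Ccv : (2 * C) * n.+1%:R^-1 @[n --> \oo] --> (0 : R).
    by rewrite -[X in _ --> X](mulr0 (2 * C)); apply: cvgMr; exact: invSn_cvg.
  apply: (squeeze_cvgr _ (cvg_cst 0) Ccv).
  apply: nearW => n; rewrite normr_ge0 /=.
  have C0 : 0 <= C.
    by have := le_trans (normr_ge0 _) (gC 0); rewrite /weight1 expr0n addr0 invr1 mulr1.
  apply: le_trans (ler_normB _ _) _.
  apply: (@le_trans _ _ (C * weight1 n.+1%:R + C * weight1 n.+1%:R)).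
    by apply: lerD; rewrite ?gC// -(weight1N n.+1%:R) gC.
  rewrite (_ : _ + _ = (2 * C) * weight1 n.+1%:R); last by ring.
  apply: ler_wpM2l; first by rewrite mulr_ge0.
  rewrite lef_pV2 ?posrE// ?ltr_pwDl ?sqr_ge0//.
  have : 1 <= n.+1%:R :> R by rewrite ler1n.
  by nra.
suff e0 : (\int[mu]_x (fn n x)%:E @[n --> \oo] --> 0)%E.
  exact: (cvg_unique (@ereal_hausdorff R) cvgI e0).
under eq_cvg do rewrite eqI.
by apply: cvg_EFin gcv; exact: nearW.
Qed.

End slices.

(** * Decay of Fourier transforms of Schwartz functions *)

Lemma eq_integral_sub0 d (T : measurableType d) (R : realType)
    (m : {measure set T -> \bar R}) (D : set T) (f g : T -> R) : measurable D ->
  m.-integrable D (EFin \o f) -> m.-integrable D (EFin \o g) ->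
  (\int[m]_(x in D) (f x - g x)%:E = 0)%E ->
  (\int[m]_(x in D) (f x)%:E = \int[m]_(x in D) (g x)%:E)%E.
Proof.
move=> mD fi gi; have := integralB_EFin mD fi gi.
have : (\int[m]_(x in D) (f x)%:E)%E \is a fin_num by exact: integrable_fin_num fi.
have : (\int[m]_(x in D) (g x)%:E)%E \is a fin_num by exact: integrable_fin_num gi.
move: (\int[m]_(x in D) (f x)%:E)%E (\int[m]_(x in D) (g x)%:E)%E.
case=> [a| |] [b| |]//= _ _.
under [X in X = _ -> _]eq_integral do rewrite -EFinB.
move=> -> [] /eqP; rewrite subr_eq0 => /eqP ->//.
Qed.

Section fourier_decay.
Context {R : realType}.
Local Notation mu := (@lebesgue_measure R).
Local Notation mu3 := (prodm (prodm mu mu) mu).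
Implicit Types (f : vec3 R -> R) (v xi : vec3 R).

Lemma is_derive_affine (a c x : R) :
  is_derive x (1 : R) (fun t => a * t + c) a.
Proof.
apply: is_derive_eq (is_deriveD (is_deriveM (is_derive_cst a x (1 : R))
  (is_derive_id x (1 : R))) (is_derive_cst c x (1 : R))) _.
by rewrite /GRing.scale /= mulr1 mulr0 !addr0.
Qed.

Lemma is_derive_cos_affine (a c x : R) :
  is_derive x (1 : R) (fun t => cos (a * t + c)) (- (a * sin (a * x + c))).
Proof.
have h := is_derive_affine a c x.
have := @is_derive1_comp R cos (fun t => a * t + c) x _ _ (is_derive_cos _) h.
by move/is_derive_eq; apply; rewrite mulNr mulrC.
Qed.

Lemma is_derive_sin_affine (a c x : R) :
  is_derive x (1 : R) (fun t => sin (a * t + c)) (a * cos (a * x + c)).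
Proof.
have h := is_derive_affine a c x.
have := @is_derive1_comp R sin (fun t => a * t + c) x _ _ (is_derive_sin _) h.
by move/is_derive_eq; apply; rewrite mulrC.
Qed.

Lemma continuous_cos_affine (a c : R) : continuous (fun t => cos (a * t + c)).
Proof.
by move=> x; apply/differentiable_continuous/derivable1_diffP; case: (is_derive_cos_affine a c x).
Qed.

Lemma normr_cosM (a c : R) : `|cos a * c| <= `|c|.
Proof. by rewrite normrM ler_piMl ?normr_ge0 ?cos_max. Qed.

(** Two integrations by parts at once: the difference of the integrands is the
derivative of cos (a x + c) F' + a sin (a x + c) F, which vanishes at infinity. *)
Lemma integral_cosM_derive2 (F F1 F2 : R -> R) (a c C : R) :
  (forall x : R, is_derive x (1 : R) F (F1 x)) ->
  (forall x : R, is_derive x (1 : R) F1 (F2 x)) -> continuous F2 ->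
  (forall x, `|F x| <= C * weight1 x) ->
  (forall x, `|F1 x| <= C * weight1 x) -> (forall x, `|F2 x| <= C * weight1 x) ->
  (\int[mu]_x (cos (a * x + c) * F2 x)%:E =
   \int[mu]_x (- a ^+ 2 * (cos (a * x + c) * F x))%:E)%E.
Proof.
move=> dF dF1 cF2 FC F1C F2C.
have cF : continuous F.
  by move=> x; apply/differentiable_continuous/derivable1_diffP; case: (dF x).
have mcos : measurable_fun setT (fun x => cos (a * x + c)).
  by apply: continuous_measurable_fun; exact: continuous_cos_affine.
have mF : measurable_fun setT F by exact: continuous_measurable_fun.
have mF2 : measurable_fun setT F2 by exact: continuous_measurable_fun.
have iF2 : mu.-integrable setT (EFin \o (fun x => cos (a * x + c) * F2 x)).
  apply: (@dominated_integrable1 _ _ C); first exact: measurable_funM.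
  by move=> x; exact: le_trans (normr_cosM _ _) (F2C x).
have iF : mu.-integrable setT (EFin \o (fun x => - a ^+ 2 * (cos (a * x + c) * F x))).
  apply: (@dominated_integrable1 _ _ (a ^+ 2 * C)).
    by apply: measurable_funM => //; exact: measurable_funM.
  move=> x; rewrite normrM normrN (@ger0_norm _ (a ^+ 2)) ?sqr_ge0// -mulrA.
  by rewrite ler_wpM2l ?sqr_ge0//; exact: le_trans (normr_cosM _ _) (FC x).
apply: eq_integral_sub0 => //.
apply: (@integral_derive_eq0 _ (fun x => cos (a * x + c) * F1 x + a * (sin (a * x + c) * F x)) _
   ((1 + `|a| + a ^+ 2) * C)).
- move=> x.
  have h1 := is_deriveM (is_derive_cos_affine a c x) (dF1 x).
  have h2 := is_deriveM (is_derive_sin_affine a c x) (dF x).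
  have h3 := is_deriveZ a h2.
  apply: is_derive_eq (is_deriveD h1 h3) _.
  rewrite /GRing.scale /=; ring.
- move=> x; apply: cvgB; last apply: cvgM; first apply: cvgM.
  + exact: continuous_cos_affine.
  + exact: cF2.
  + exact: cvg_cst.
  + by apply: cvgM; [exact: continuous_cos_affine|exact: cF].
- move=> x.
  have C0 : 0 <= C * weight1 x by exact: le_trans (normr_ge0 _) (FC x).
  apply: le_trans (ler_normD _ _) _.
  rewrite -mulrA 2!mulrDl mul1r.
  rewrite -[leLHS]addr0 lerD ?(mulr_ge0 (sqr_ge0 a) C0)//.
  rewrite lerD//; first exact: le_trans (normr_cosM _ _) (F1C x).
  rewrite normrM ler_wpM2l// normrM (le_trans _ (FC x))//.
  by rewrite ler_piMl ?sin_max.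
- move=> x.
  have C0 : 0 <= C * weight1 x by exact: le_trans (normr_ge0 _) (FC x).
  rewrite mulNr opprK.
  apply: le_trans (ler_normD _ _) _.
  rewrite [leRHS](_ : _ = C * weight1 x + a ^+ 2 * (C * weight1 x) +
    `|a| * (C * weight1 x)); last by ring.
  rewrite -[leLHS]addr0 lerD ?(mulr_ge0 (normr_ge0 a) C0)//.
  rewrite lerD//; first exact: le_trans (normr_cosM _ _) (F2C x).
  rewrite normrM (@ger0_norm _ (a ^+ 2)) ?sqr_ge0// ler_wpM2l ?sqr_ge0//.
  exact: le_trans (normr_cosM _ _) (FC x).
Qed.

(** Coordinates written as scalar products with the vectors along which
[partial] differentiates. *)
Definition coord (i : 'I_3) v : R := dot v (basis3 i).

Lemma coordE0 (h : (0 < 3)%N) v : coord (Ordinal h) v = v.1.1.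
Proof. by rewrite /coord /dot /= mulr1 !mulr0 !addr0. Qed.

Lemma coordE1 (h : (1 < 3)%N) v : coord (Ordinal h) v = v.1.2.
Proof. by rewrite /coord /dot /= mulr1 !mulr0 add0r !addr0. Qed.

Lemma coordE2 (h : (2 < 3)%N) v : coord (Ordinal h) v = v.2.
Proof. by rewrite /coord /dot /= mulr1 !mulr0 !add0r. Qed.

Lemma is_derive_partial0 (h : (0 < 3)%N) f (x y z : R) :
  differentiable f ((x, y, z) : vec3 R) ->
  is_derive x (1 : R) (fun t => f (t, y, z)) (partial (Ordinal h) f (x, y, z)).
Proof.
move=> df.
have [df1 df2] : is_derive (x, y, z) (basis3 (Ordinal h)) f (partial (Ordinal h) f (x, y, z)).
  by apply: DeriveDef => //; exact: diff_derivable.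
have E : (fun h0 : R => h0^-1 *: (f (h0 *: basis3 (Ordinal h) + (x, y, z)) - f (x, y, z))) =
         (fun h0 => h0^-1 *: (f (h0 *: (1 : R) + x, y, z) - f (x, y, z))).
  apply/funext => t.
  rewrite (_ : t *: _ + _ = ((t * 1 + x, t * 0 + y, t * 0 + z) : vec3 R)) //.
  by rewrite !mulr0 !add0r.
by apply: DeriveDef; [move: df1; rewrite /derivable E|rewrite -df2 /derive E].
Qed.

Lemma is_derive_partial1 (h : (1 < 3)%N) f (x y z : R) :
  differentiable f ((x, y, z) : vec3 R) ->
  is_derive y (1 : R) (fun t => f (x, t, z)) (partial (Ordinal h) f (x, y, z)).
Proof.
move=> df.
have [df1 df2] : is_derive (x, y, z) (basis3 (Ordinal h)) f (partial (Ordinal h) f (x, y, z)).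
  by apply: DeriveDef => //; exact: diff_derivable.
have E : (fun h0 : R => h0^-1 *: (f (h0 *: basis3 (Ordinal h) + (x, y, z)) - f (x, y, z))) =
         (fun h0 => h0^-1 *: (f (x, h0 *: (1 : R) + y, z) - f (x, y, z))).
  apply/funext => t.
  rewrite (_ : t *: _ + _ = ((t * 0 + x, t * 1 + y, t * 0 + z) : vec3 R)) //.
  by rewrite !mulr0 !add0r.
by apply: DeriveDef; [move: df1; rewrite /derivable E|rewrite -df2 /derive E].
Qed.

Lemma is_derive_partial2 (h : (2 < 3)%N) f (x y z : R) :
  differentiable f ((x, y, z) : vec3 R) ->
  is_derive z (1 : R) (fun t => f (x, y, t)) (partial (Ordinal h) f (x, y, z)).
Proof.
move=> df.
have [df1 df2] : is_derive (x, y, z) (basis3 (Ordinal h)) f (partial (Ordinal h) f (x, y, z)).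
  by apply: DeriveDef => //; exact: diff_derivable.
have E : (fun h0 : R => h0^-1 *: (f (h0 *: basis3 (Ordinal h) + (x, y, z)) - f (x, y, z))) =
         (fun h0 => h0^-1 *: (f (x, y, h0 *: (1 : R) + z) - f (x, y, z))).
  apply/funext => t.
  rewrite (_ : t *: _ + _ = ((t * 0 + x, t * 0 + y, t * 1 + z) : vec3 R)) //.
  by rewrite !mulr0 !add0r.
by apply: DeriveDef; [move: df1; rewrite /derivable E|rewrite -df2 /derive E].
Qed.

Lemma dot_ge0 v : 0 <= dot v v.
Proof. by rewrite /dot -!expr2 !addr_ge0 ?sqr_ge0. Qed.

Lemma sqr_enorm v : enorm v ^+ 2 = dot v v.
Proof. by rewrite /enorm sqr_sqrtr ?dot_ge0. Qed.

Lemma enorm_ge0 v : 0 <= enorm v.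
Proof. exact: sqrtr_ge0. Qed.

(** Comparison of the tensor weight with powers of the Euclidean norm: each of
the three factors of its inverse is at most 1 + |v|^2. *)
Lemma weight_inv_le v : (weight v)^-1 <= (1 + enorm v ^+ 2) ^+ 3.
Proof.
rewrite /weight /weight2 /weight1 !invfM !invrK sqr_enorm /dot -!expr2.
set a := v.1.1 ^+ 2; set b := v.1.2 ^+ 2; set c := v.2 ^+ 2.
have [a0 b0 c0] : [/\ 0 <= a, 0 <= b & 0 <= c] by rewrite !sqr_ge0.
by rewrite exprS expr2 mulrA !ler_pM ?mulr_ge0 ?addr_ge0//; lra.
Qed.

Lemma schwartz_partial i f : schwartz_real f -> schwartz_real (partial i f).
Proof.
move=> [h1 h2]; have E s : partials s (partial i f) = partials (rcons s i) f.
  by rewrite /partials foldr_rcons.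
by split => [s x|s N]; rewrite E; [exact: h1|exact: h2].
Qed.

Lemma schwartz_differentiable f v : schwartz_real f -> differentiable f v.
Proof. by move=> [h _]; exact: (h [::] v). Qed.

Lemma schwartz_continuous f : schwartz_real f -> continuous f.
Proof. by move=> hf v; apply: differentiable_continuous; exact: schwartz_differentiable. Qed.

Lemma schwartz_le_weight f : schwartz_real f ->
  exists C, forall v, `|f v| <= C * weight v.
Proof.
(* (1 + |v|)^6 is at least (1 + |v|^2)^3, which bounds the inverse of the weight *)
move=> [_ /(_ [::] 6%N)[C hC]]; exists C => v.
have := hC v; rewrite /= => {}hC.
have e0 := enorm_ge0 v.
have p0 : 0 < (1 + enorm v) ^+ 6 by rewrite exprn_gt0 // ltr_pwDl.
have W0 := weight_gt0 v.
rewrite -ler_pdivrMr// (le_trans _ hC)// mulrC ler_wpM2r ?normr_ge0//.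
apply: le_trans (weight_inv_le v) _.
rewrite (_ : 6%N = (2 * 3)%N)// exprM ler_pXn2r ?nnegrE ?sqr_ge0 ?addr_ge0 ?sqr_ge0//.
by rewrite sqrrD expr1n mul1r -addrA lerD2l ler_wpDl// mulrn_wge0.
Qed.

Lemma schwartz_dominated3 f : schwartz_real f -> dominated3 f.
Proof.
move=> hf; split; last exact: schwartz_le_weight.
by apply: continuous3_measurable; exact: schwartz_continuous.
Qed.

Lemma measurable_dot xi (c : R) :
  measurable_fun setT ((fun v => dot v xi + c) : mvec3 R -> R).
Proof.
have m1 : measurable_fun setT ((fun v => v.1.1) : mvec3 R -> R).
  by apply: measurableT_comp; [exact: measurable_fst|exact: measurable_fst].
have m2 : measurable_fun setT ((fun v => v.1.2) : mvec3 R -> R).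
  by apply: measurableT_comp; [exact: measurable_snd|exact: measurable_fst].
have m3 : measurable_fun setT ((fun v => v.2) : mvec3 R -> R).
  exact: measurable_snd.
apply: measurable_funD => //.
by apply: measurable_funD; [apply: measurable_funD|]; apply: measurable_funM.
Qed.

Lemma measurable_cos_dot xi (c : R) :
  measurable_fun setT ((fun v => cos (dot v xi + c)) : mvec3 R -> R).
Proof.
apply: (@measurableT_comp _ _ _ _ _ _ (@cos R)); last exact: measurable_dot.
by apply: continuous_measurable_fun; exact: continuous_cos.
Qed.

Lemma dominated3_cosM f xi c : dominated3 f ->
  dominated3 (fun v => cos (dot v xi + c) * f v).
Proof.
move=> [mf [C fC]]; split.
  by apply: measurable_funM => //; exact: measurable_cos_dot.
by exists C => v; exact: le_trans (normr_cosM _ _) (fC v).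
Qed.

Lemma dominated3Z f (k : R) : dominated3 f -> dominated3 (fun v => k * f v).
Proof.
move=> [mf [C fC]]; split; first exact: measurable_funM.
by exists (`|k| * C) => v; rewrite normrM -mulrA ler_wpM2l.
Qed.

Lemma continuous_slice0 f (y z : R) : continuous f ->
  continuous (fun t : R => f (t, y, z)).
Proof.
move=> cf x; apply: continuous_comp; last exact: cf.
exact: cvg_pair (cvg_pair cvg_id (cvg_cst _)) (cvg_cst _).
Qed.

Lemma continuous_slice1 f (x z : R) : continuous f ->
  continuous (fun t : R => f (x, t, z)).
Proof.
move=> cf y; apply: continuous_comp; last exact: cf.
exact: cvg_pair (cvg_pair (cvg_cst _) cvg_id) (cvg_cst _).
Qed.

Lemma continuous_slice2 f (x y : R) : continuous f ->
  continuous (fun t : R => f (x, y, t)).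
Proof.
move=> cf z; apply: continuous_comp; last exact: cf.
exact: cvg_pair (cvg_cst _) cvg_id.
Qed.

Lemma integral_cos_partial2 i f xi c : schwartz_real f ->
  (\int[mu3]_v (cos (dot v xi + c) * partial i (partial i f) v)%:E =
   \int[mu3]_v (- coord i xi ^+ 2 * (cos (dot v xi + c) * f v))%:E)%E.
Proof.
move=> hf.
have hf1 := schwartz_partial i hf; have hf2 := schwartz_partial i hf1.
have cf2 := schwartz_continuous hf2.
have [C0 fC0] := schwartz_le_weight hf.
have [C1 fC1] := schwartz_le_weight hf1.
have [C2 fC2] := schwartz_le_weight hf2.
pose C := `|C0| + `|C1| + `|C2|.
have up k (w : R) : 0 < w -> k \in [:: C0; C1; C2] -> k * w <= C * w.
  move=> w0 kC; rewrite ler_pM2r//.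
  move: kC; rewrite !inE => /or3P[] /eqP ->;
   rewrite (le_trans (ler_norm _))// /C; have := normr_ge0 C0; have := normr_ge0 C1; have := normr_ge0 C2; lra.
have f0C v : `|f v| <= C * weight v by rewrite (le_trans (fC0 v))// up ?weight_gt0 ?inE ?eqxx.
have f1C v : `|partial i f v| <= C * weight v.
  by rewrite (le_trans (fC1 v))// up ?weight_gt0 ?inE ?eqxx ?orbT.
have f2C v : `|partial i (partial i f) v| <= C * weight v.
  by rewrite (le_trans (fC2 v))// up ?weight_gt0 ?inE ?eqxx ?orbT.
apply: integral_slice3.
- by apply: dominated3_cosM; exact: schwartz_dominated3.
- by apply: dominated3Z; apply: dominated3_cosM; exact: schwartz_dominated3.
case: i hf1 hf2 cf2 fC1 fC2 f1C f2C => -[|[|[|//]]] hi hf1 hf2 cf2 fC1 fC2 f1C f2C.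
- constructor 1 => y z; rewrite coordE0.
  have E t : dot (t, y, z) xi + c = xi.1.1 * t + (y * xi.1.2 + z * xi.2 + c).
    by rewrite /dot /=; ring.
  under eq_integral do rewrite E.
  under [RHS]eq_integral do rewrite E.
  have W t : C * weight (t, y, z) = C * (weight1 y * weight1 z) * weight1 t.
    by rewrite /weight /weight2 /=; ring.
  apply: (@integral_cosM_derive2 (fun t => f (t, y, z)) (fun t => partial (Ordinal hi) f (t, y, z))
     (fun t => partial (Ordinal hi) (partial (Ordinal hi) f) (t, y, z)) _ _ (C * (weight1 y * weight1 z))).
  + by move=> x; apply: is_derive_partial0; exact: schwartz_differentiable.
  + by move=> x; apply: is_derive_partial0; exact: schwartz_differentiable.
  + exact: continuous_slice0.
  + by move=> x; rewrite -W.
  + by move=> x; rewrite -W.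
  + by move=> x; rewrite -W.
- constructor 2 => x z; rewrite coordE1.
  have E t : dot (x, t, z) xi + c = xi.1.2 * t + (x * xi.1.1 + z * xi.2 + c).
    by rewrite /dot /=; ring.
  under eq_integral do rewrite E.
  under [RHS]eq_integral do rewrite E.
  have W t : C * weight (x, t, z) = C * (weight1 x * weight1 z) * weight1 t.
    by rewrite /weight /weight2 /=; ring.
  apply: (@integral_cosM_derive2 (fun t => f (x, t, z)) (fun t => partial (Ordinal hi) f (x, t, z))
     (fun t => partial (Ordinal hi) (partial (Ordinal hi) f) (x, t, z)) _ _ (C * (weight1 x * weight1 z))).
  + by move=> y; apply: is_derive_partial1; exact: schwartz_differentiable.
  + by move=> y; apply: is_derive_partial1; exact: schwartz_differentiable.
  + exact: continuous_slice1.
  + by move=> y; rewrite -W.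
  + by move=> y; rewrite -W.
  + by move=> y; rewrite -W.
- constructor 3 => x y; rewrite coordE2.
  have E t : dot (x, y, t) xi + c = xi.2 * t + (x * xi.1.1 + y * xi.1.2 + c).
    by rewrite /dot /=; ring.
  under eq_integral do rewrite E.
  under [RHS]eq_integral do rewrite E.
  have W t : C * weight (x, y, t) = C * (weight1 x * weight1 y) * weight1 t.
    by rewrite /weight /weight2 /=; ring.
  apply: (@integral_cosM_derive2 (fun t => f (x, y, t)) (fun t => partial (Ordinal hi) f (x, y, t))
     (fun t => partial (Ordinal hi) (partial (Ordinal hi) f) (x, y, t)) _ _ (C * (weight1 x * weight1 y))).
  + by move=> z; apply: is_derive_partial2; exact: schwartz_differentiable.
  + by move=> z; apply: is_derive_partial2; exact: schwartz_differentiable.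
  + exact: continuous_slice2.
  + by move=> z; rewrite -W.
  + by move=> z; rewrite -W.
  + by move=> z; rewrite -W.
Qed.

(** The phase c lets one real function stand for both parts of the Fourier
transform: c = 0 gives the cosine transform, c = - pi / 2 the sine transform. *)
Definition cos_transform f xi (c : R) : R :=
  \int[mu3]_v (cos (dot v xi + c) * f v).

Lemma cos_transform_partial2 i f xi c : schwartz_real f ->
  cos_transform (partial i (partial i f)) xi c = - coord i xi ^+ 2 * cos_transform f xi c.
Proof.
move=> hf; rewrite {1}/cos_transform /Rintegral integral_cos_partial2//.
rewrite -[LHS]/(Rintegral mu3 setT (fun v => - coord i xi ^+ 2 * (cos (dot v xi + c) * f v))).
rewrite RintegralZl//.
by apply: dominated3_integrable; apply: dominated3_cosM; exact: schwartz_dominated3.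
Qed.

Lemma cos_transform_bounded f : dominated3 f ->
  exists C, forall xi c, `|cos_transform f xi c| <= C.
Proof.
move=> df; have [mf [C fC]] := df; exists (fine (\int[mu3]_v (C * weight v)%:E)) => xi c.
have iw : mu3.-integrable setT (EFin \o (fun v => C * weight v)).
  apply: dominated3_integrable; apply: dominated3Z; split; first exact: measurable_weight.
  by exists 1 => v; rewrite mul1r ger0_norm// ltW// weight_gt0.
have ic := dominated3_integrable (dominated3_cosM xi c df).
apply: le_trans (le_normr_Rintegral measurableT ic) _.
apply: le_Rintegral => //.
  exact: integrable_norm ic.
by move=> v _; exact: le_trans (normr_cosM _ _) (fC v).
Qed.

(** Multiplying the transform of g by 1 + xi_i^2 amounts to transforming
g minus its second derivative in x_i, so bounds for all Schwartz functions
propagate one coordinate at a time until the full weight is reached. *)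
Lemma cos_transform_decay f : schwartz_real f ->
  exists C, forall xi c, `|cos_transform f xi c| <= C * weight xi.
Proof.
pose P (w : vec3 R -> R) := forall g, schwartz_real g ->
  exists C, forall xi c, w xi * `|cos_transform g xi c| <= C.
have step i w : (forall xi, 0 <= w xi) -> P w -> P (fun xi => (1 + coord i xi ^+ 2) * w xi).
  move=> w0 Pw g hg; have [C1 h1] := Pw g hg.
  have [C2 h2] := Pw _ (schwartz_partial i (schwartz_partial i hg)).
  exists (C1 + C2) => xi c; rewrite -mulrA mulrDl mul1r lerD//.
  have := h2 xi c; rewrite cos_transform_partial2// normrM normrN (@ger0_norm _ (coord i xi ^+ 2)) ?sqr_ge0//.
  by rewrite mulrCA.
have P1 : P (fun=> 1).
  move=> g hg; have [C hC] := cos_transform_bounded (schwartz_dominated3 hg).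
  by exists C => xi c; rewrite mul1r.
move=> hf.
have h0 i xi : 0 <= 1 + coord i xi ^+ 2 by rewrite addr_ge0 ?sqr_ge0.
have P2 := step (Ordinal (isT : (0 < 3)%N)) _ (fun=> ler01) P1.
have P3 := step (Ordinal (isT : (1 < 3)%N)) _ (fun=> mulr_ge0 (h0 _ _) ler01) P2.
have P4 := step (Ordinal (isT : (2 < 3)%N)) _ (fun=> mulr_ge0 (h0 _ _) (mulr_ge0 (h0 _ _) ler01)) P3.
have [C hC] := P4 f hf; exists C => xi c.
rewrite -ler_pdivrMr ?weight_gt0// mulrC.
apply: le_trans (hC xi c); rewrite le_eqVlt; apply/orP; left; apply/eqP; congr (_ * _).
rewrite coordE0 coordE1 coordE2 /weight /weight2 /weight1 !invfM !invrK; ring.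
Qed.

End fourier_decay.

(** * The Poisson kernel *)

Section poisson1.
Context {R : realType}.
Local Notation mu := (@lebesgue_measure R).
Variable e : R.
Hypothesis e0 : 0 < e.

(** An integrable factor tending to 1 as e tends to 0, whose Fourier transform
[poisson] is elementary; it regularises the inversion integral. *)
Definition expabs (t : R) : R := expR (- (e * `|t|)).
Definition poisson (z : R) : R := 2 * e / (e ^+ 2 + z ^+ 2).

Lemma expabs_gt0 t : 0 < expabs t. Proof. exact: expR_gt0. Qed.

Lemma expabs_le1 t : expabs t <= 1.
Proof. by rewrite expR_le1 oppr_le0 mulr_ge0// ltW. Qed.

Lemma continuous_expabs : continuous expabs.
Proof.
move=> t; apply: (@continuous_comp _ _ _ (fun t : R => - (e * `|t|)) expR); last exact: continuous_expR.
by apply: cvgN; apply: cvgM; [exact: cvg_cst|exact: norm_continuous].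
Qed.

Lemma expabs_le_weight : exists C, forall t, expabs t <= C * weight1 t.
Proof.
(* from 1 + (e t)^2 / 2 <= exp (e |t|) *)
exists (1 + 2 / e ^+ 2) => t; rewrite /expabs expRN /weight1.
have e20 : 0 < e ^+ 2 by rewrite exprn_gt0.
have t20 : 0 < 1 + t ^+ 2 by rewrite ltr_pwDl// sqr_ge0.
rewrite -ler_pdivrMr ?invr_gt0// invrK mulrC ler_pdivrMr ?expR_gt0//.
have := expR_ge1Dxn 1 (mulr_ge0 (ltW e0) (normr_ge0 t)).
rewrite (_ : (2`!)%:R = 2 :> R)// exprMn real_normK ?num_real// => h.
apply: (@le_trans _ _ ((1 + 2 / e ^+ 2) * (1 + e ^+ 2 * t ^+ 2 / 2))); last first.
  by rewrite ler_wpM2l// addr_ge0// divr_ge0// ltW.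
have -> : (1 + 2 / e ^+ 2) * (1 + e ^+ 2 * t ^+ 2 / 2) =
  1 + t ^+ 2 + (2 / e ^+ 2 + e ^+ 2 * t ^+ 2 / 2).
  by field; rewrite gt_eqF.
rewrite lerDl; apply: addr_ge0; apply: divr_ge0 => //; first exact: ltW.
by apply: mulr_ge0; [exact: ltW|exact: sqr_ge0].
Qed.

Let F (z t : R) : R := - e^-1 * expR (- e * t) +
  (e ^+ 2 + z ^+ 2)^-1 * (expR (- e * t) * (z * sin (z * t) - e * cos (z * t))).

Let ez0 z : 0 < e ^+ 2 + z ^+ 2.
Proof. by rewrite ltr_pwDl ?exprn_gt0 ?sqr_ge0. Qed.

Let is_derive_exp (x : R) :
  is_derive x (1 : R) (fun t => expR (- e * t)) (- e * expR (- e * x)).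
Proof.
have h := is_derive_affine (- e) 0 x.
have := @is_derive1_comp R expR (fun t => - e * t + 0) x _ _ (is_derive_expR _) h.
rewrite addr0 mulrC; move/is_derive_eq => /(_ _ erefl).
by rewrite /comp; under eq_fun do rewrite addr0.
Qed.

Let is_deriveF z (x : R) :
  is_derive x (1 : R) (F z) (expR (- e * x) * (1 + cos (z * x))).
Proof.
have hs : is_derive x (1 : R) (fun t => sin (z * t)) (z * cos (z * x)).
  by have := is_derive_sin_affine z 0 x; rewrite addr0; under eq_fun do rewrite addr0.
have hc : is_derive x (1 : R) (fun t => cos (z * t)) (- (z * sin (z * x))).
  by have := is_derive_cos_affine z 0 x; rewrite addr0; under eq_fun do rewrite addr0.
have h1 := is_deriveZ (- e^-1) (is_derive_exp x).
have h2 := is_deriveB (is_deriveZ z hs) (is_deriveZ e hc).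
have h3 := is_deriveZ (e ^+ 2 + z ^+ 2)^-1 (is_deriveM (is_derive_exp x) h2).
apply: is_derive_eq (is_deriveD h1 h3) _.
rewrite !fctE /GRing.scale /=.
rewrite -[z *: sin _]/(z * sin _) -[e *: cos _]/(e * cos _).
have h := ez0 z; field; rewrite !gt_eqF//.
Qed.

Let cvgF z : F z t @[t --> +oo%R] --> (0 : R).
Proof.
have cexp : expR (- e * t) @[t --> +oo%R] --> (0 : R).
  under eq_cvg do rewrite mulNr.
  apply: (@cvg_comp _ _ _ (fun t => e * t) (fun t => expR (- t)) _ (pinfty_nbhs R)).
    exact: gt0_cvgMry.
  exact: cvgr_expR.
pose M := e^-1 + (`|z| + e) / (e ^+ 2 + z ^+ 2).
apply: norm_cvg0.
have cM : expR (- e * t) * M @[t --> +oo%R] --> (0 : R).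
  by rewrite -[X in _ --> X](mul0r M); apply: cvgM cexp (cvg_cst _).
apply: (squeeze_cvgr _ (cvg_cst 0) cM).
apply: nearW => t; rewrite normr_ge0 /=.
apply: le_trans (ler_normD _ _) _.
rewrite !normrM normrN (ger0_norm (expR_ge0 _)) mulrDr [`|e^-1| * _]mulrC.
rewrite (@ger0_norm _ e^-1) ?invr_ge0 ?(ltW e0)// lerD2l mulrCA ler_wpM2l ?expR_ge0//.
rewrite (@ger0_norm _ (_^-1)) ?invr_ge0 ?(ltW (ez0 z))// mulrC ler_wpM2r ?invr_ge0 ?(ltW (ez0 z))//.
apply: le_trans (ler_normB _ _) _.
rewrite !normrM (gtr0_norm e0) lerD//.
  by rewrite ler_piMr ?sin_max.
by rewrite ler_piMr ?cos_max// ltW.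
Qed.

(** Adding 1 to the cosine makes the integrand nonnegative, so that the improper
integral over a half-line is the limit of an explicit primitive. *)
Lemma integral_expabs_1Dcos z :
  (\int[mu]_t (expabs t * (1 + cos (z * t)))%:E = (2 / e + poisson z)%:E)%E.
Proof.
have ccos : continuous (fun t : R => 1 + cos (z * t)).
  move=> t; apply: cvgD; first exact: cvg_cst.
  apply: (@continuous_comp _ _ _ (fun t : R => z * t) cos); last exact: continuous_cos.
  by apply: cvgM; [exact: cvg_cst|exact: cvg_id].
rewrite ge0_symfun_integralT; first last.
- by move=> t /=; rewrite /expabs normrN mulrN cosN.
- move=> t; apply: cvgM; [exact: continuous_expabs|exact: ccos].
- by move=> t; rewrite mulr_ge0 ?(ltW (expabs_gt0 _)).
rewrite -set_itvcy.
under eq_integral => t.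
  rewrite inE /= in_itv /= andbT => t0.
  rewrite /expabs ger0_norm// -mulNr.
  over.
rewrite (@ge0_continuous_FTC2y _ _ (F z) 0 0) => [|t t0| |//|t t0| |t t0].
- rewrite -EFinB -EFinM; congr EFin.
  rewrite /F /poisson !mulr0 expR0 sin0 cos0.
  by have := ez0 z => h; field; rewrite !gt_eqF.
- by rewrite mulr_ge0 ?expR_ge0.
- apply: continuous_subspaceT => t; apply: cvgM; last exact: ccos.
  apply: (@continuous_comp _ _ _ (fun t : R => - e * t) expR); last exact: continuous_expR.
  by apply: cvgM; [exact: cvg_cst|exact: cvg_id].
- by case: (is_deriveF z t).
- apply: cvg_at_right_filter.
  by apply/differentiable_continuous/derivable1_diffP; case: (is_deriveF z 0).
- by rewrite derive1E; case: (is_deriveF z t).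
Qed.

Lemma integrable_expabsM (g : R -> R) (C : R) : measurable_fun setT g ->
  (forall t, `|g t| <= C) ->
  mu.-integrable setT (EFin \o (fun t => expabs t * g t)).
Proof.
move=> mg gC; have [K hK] := expabs_le_weight.
have C0 : 0 <= C by exact: le_trans (normr_ge0 _) (gC 0).
apply: (@dominated_integrable1 _ _ (K * C)).
  apply: measurable_funM => //.
  by apply: continuous_measurable_fun; exact: continuous_expabs.
move=> t; rewrite normrM (gtr0_norm (expabs_gt0 _)) mulrAC.
by rewrite ler_pM// ltW// expabs_gt0.
Qed.

Let measurable_cosa z c : measurable_fun setT (fun t : R => cos (z * t + c)).
Proof. by apply: continuous_measurable_fun; exact: continuous_cos_affine. Qed.

Let Rint_expabs : \int[mu]_t expabs t = 2 / e.
Proof.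
have := integral_expabs_1Dcos 0.
under eq_integral do rewrite mul0r cos0.
move=> h.
have : \int[mu]_t (expabs t * (1 + 1)) = 4 / e.
  rewrite /Rintegral h /= /poisson expr0n addr0.
  by field; rewrite gt_eqF.
rewrite RintegralZr// => [hh|].
  by apply: (@mulIf _ (1 + 1 : R)); [rewrite gt_eqF|rewrite hh; field; rewrite gt_eqF].
have := @integrable_expabsM (fun=> 1) 1 (measurable_cst _) _.
by under eq_fun do rewrite mulr1; apply => t; rewrite normr1.
Qed.

Let Rint_expabs_cos z : \int[mu]_t (expabs t * cos (z * t)) = poisson z.
Proof.
have ic : mu.-integrable setT (EFin \o (fun t => expabs t * cos (z * t))).
  apply: (@integrable_expabsM _ 1); last by move=> t; exact: cos_max.
  by have := measurable_cosa z 0; under eq_fun do rewrite addr0.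
have i1 : mu.-integrable setT (EFin \o expabs).
  have := @integrable_expabsM (fun=> 1) 1 (measurable_cst _) _.
  by under eq_fun do rewrite mulr1; apply => t; rewrite normr1.
have := integral_expabs_1Dcos z.
under eq_integral do rewrite mulrDr mulr1.
move=> h; have : \int[mu]_t (expabs t + expabs t * cos (z * t)) = 2 / e + poisson z.
  by rewrite /Rintegral h.
by rewrite RintegralD// Rint_expabs => /addrI.
Qed.

Let Rint_expabs_sin z : \int[mu]_t (expabs t * sin (z * t)) = 0.
Proof.
have ms : measurable_fun setT (fun t : R => expabs t * sin (z * t)).
  apply: measurable_funM.
    by apply: continuous_measurable_fun; exact: continuous_expabs.
  apply: continuous_measurable_fun => x.
  apply: (@continuous_comp _ _ _ (fun t : R => z * t) sin); last exact: continuous_sin.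
  by apply: cvgM; [exact: cvg_cst|exact: cvg_id].
have is_ : mu.-integrable setT (EFin \o (fun t => expabs t * sin (z * t))).
  apply: (@integrable_expabsM _ 1); last by move=> t; exact: sin_max.
  apply: continuous_measurable_fun => x.
  apply: (@continuous_comp _ _ _ (fun t : R => z * t) sin); last exact: continuous_sin.
  by apply: cvgM; [exact: cvg_cst|exact: cvg_id].
have mN : measurable_fun setT (-%R : measurableTypeR R -> measurableTypeR R).
  exact: oppr_measurable.
have E : (\int[mu]_t (expabs t * sin (z * t))%:E =
    \int[mu]_t (- (expabs t * sin (z * t)))%:E)%E.
  rewrite [LHS](_ : _ = \int[pushforward mu (-%R : measurableTypeR R -> measurableTypeR R)]_t
      (expabs t * sin (z * t))%:E)%E; last first.
    by apply: eq_measure_integral => A mA _; rewrite /= lebesgue_measureN.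
  rewrite (integral_pushforward mN)//.
  - apply: eq_integral => t _ /=.
    by rewrite /expabs normrN mulrN sinN mulrN.
  - exact/measurable_EFinP.
  - rewrite preimage_setT; have := integrableN is_.
    by apply: eq_integrable => // t _ /=; rewrite /expabs normrN mulrN sinN mulrN.
have : \int[mu]_t (expabs t * sin (z * t)) = - \int[mu]_t (expabs t * sin (z * t)).
  rewrite {1}/Rintegral E -mulN1r -RintegralZl//.
  by rewrite /Rintegral; congr fine; apply: eq_integral => t _; rewrite mulN1r.
by move/eqP; rewrite -addr_eq0 -mulr2n mulrn_eq0 /= => /eqP.
Qed.

Lemma Rintegral_expabs_cos z c :
  \int[mu]_t (expabs t * cos (z * t + c)) = cos c * poisson z.
Proof.
have ic : mu.-integrable setT (EFin \o (fun t => expabs t * cos (z * t))).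
  apply: (@integrable_expabsM _ 1); last by move=> t; exact: cos_max.
  by have := measurable_cosa z 0; under eq_fun do rewrite addr0.
have is_ : mu.-integrable setT (EFin \o (fun t => expabs t * sin (z * t))).
  apply: (@integrable_expabsM _ 1); last by move=> t; exact: sin_max.
  apply: continuous_measurable_fun => x.
  apply: (@continuous_comp _ _ _ (fun t : R => z * t) sin); last exact: continuous_sin.
  by apply: cvgM; [exact: cvg_cst|exact: cvg_id].
transitivity (\int[mu]_t (cos c * (expabs t * cos (z * t)) - sin c * (expabs t * sin (z * t)))).
  by apply: eq_Rintegral => t _; rewrite cosD; ring.
rewrite RintegralB//; last 2 first.
- exact: (integrableZl measurableT _ ic).
- exact: (integrableZl measurableT _ is_).
by rewrite !RintegralZl// Rint_expabs_cos Rint_expabs_sin mulr0 subr0.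
Qed.

Lemma integral_expabs_cos (a z c : R) :
  (\int[mu]_t (a * (expabs t * cos (z * t + c)))%:E = (a * (cos c * poisson z))%:E)%E.
Proof.
have ic : mu.-integrable setT (EFin \o (fun t => expabs t * cos (z * t + c))).
  by apply: (@integrable_expabsM _ 1); [exact: measurable_cosa|move=> t; exact: cos_max].
under eq_integral do rewrite EFinM.
rewrite integralZl// EFinM -Rintegral_expabs_cos /Rintegral fineK//.
exact: integrable_fin_num.
Qed.

End poisson1.

Section poisson3.
Context {R : realType}.
Local Notation mu := (@lebesgue_measure R).
Local Notation mu2 := (prodm mu mu).
Local Notation mu3 := (prodm (prodm mu mu) mu).
Variable e : R.
Hypothesis e0 : 0 < e.

Definition expabs3 (v : vec3 R) : R := expabs e v.1.1 * expabs e v.1.2 * expabs e v.2.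
Definition poisson3 (v : vec3 R) : R := poisson e v.1.1 * poisson e v.1.2 * poisson e v.2.

Let measurable_expabs : measurable_fun setT (expabs e).
Proof. by apply: continuous_measurable_fun; exact: continuous_expabs. Qed.

Lemma measurable_expabs3 : measurable_fun setT (expabs3 : mvec3 R -> R).
Proof.
apply: measurable_funM; first apply: measurable_funM.
- apply: (measurableT_comp measurable_expabs).
  by apply: measurableT_comp; [exact: measurable_fst|exact: measurable_fst].
- apply: (measurableT_comp measurable_expabs).
  by apply: measurableT_comp; [exact: measurable_snd|exact: measurable_fst].
- by apply: (measurableT_comp measurable_expabs); exact: measurable_snd.
Qed.

Lemma expabs3_ge0 v : 0 <= expabs3 v.
Proof. by rewrite !mulr_ge0// ltW// expabs_gt0. Qed.

Lemma expabs3_le1 v : expabs3 v <= 1.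
Proof.
have h t : 0 <= expabs e t <= 1 by rewrite expabs_le1// ltW// expabs_gt0.
have /andP[h1 h2] := h v.1.1; have /andP[h3 h4] := h v.1.2; have /andP[h5 h6] := h v.2.
by rewrite /expabs3 mulr_ile1 ?mulr_ge0 // mulr_ile1.
Qed.

Lemma dominated3_expabs3 : dominated3 expabs3.
Proof.
split; first exact: measurable_expabs3.
have [C hC] := expabs_le_weight e0.
exists (C ^+ 3) => v; rewrite ger0_norm ?expabs3_ge0//.
have -> : C ^+ 3 * weight v = (C * weight1 v.1.1) * (C * weight1 v.1.2) * (C * weight1 v.2).
  by rewrite /weight /weight2; ring.
by rewrite !ler_pM ?mulr_ge0// ltW// expabs_gt0.
Qed.

Lemma integral_expabs3_cos (z : vec3 R) (a c : R) :
  (\int[mu3]_v (a * (expabs3 v * cos (dot v z + c)))%:E = (a * (cos c * poisson3 z))%:E)%E.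
Proof.
have dom : dominated3 (fun v => a * (expabs3 v * cos (dot v z + c))).
  apply: dominated3Z.
  have := dominated3_cosM z c dominated3_expabs3.
  by under eq_fun do rewrite mulrC.
have := integral12_prod_meas1 (dominated3_integrable dom); rewrite /fubini_F => <-.
have dom2 : mu2.-integrable setT (EFin \o (fun p : R * R => a * (expabs e p.1 * expabs e p.2) *
     (cos (p.1 * z.1.1 + p.2 * z.1.2 + c) * poisson e z.2))).
  have [C hC] := expabs_le_weight e0.
  apply: (@dominated_integrable2 _ _ (`|a| * C ^+ 2 * `|poisson e z.2|)).
    apply: measurable_funM; apply: measurable_funM => //.
    + apply: measurable_funM.
        by apply: (measurableT_comp measurable_expabs); exact: measurable_fst.
      by apply: (measurableT_comp measurable_expabs); exact: measurable_snd.
    + have m2 : measurable_fun setT ((fun p : R * R => p.1 * z.1.1 + p.2 * z.1.2 + c) :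
          measurableTypeR R * measurableTypeR R -> R).
        apply: measurable_funD => //; apply: measurable_funD; by apply: measurable_funM.
      have mc : measurable_fun setT (@cos R).
        by apply: continuous_measurable_fun; exact: continuous_cos.
      exact: (measurableT_comp mc m2).
  move=> p; move: (poisson e z.2) => k.
  rewrite !normrM (gtr0_norm (expabs_gt0 _ _)) (gtr0_norm (expabs_gt0 _ _)).
  rewrite [leRHS](_ : _ = (`|a| * ((C * weight1 p.1) * (C * weight1 p.2))) * `|k|); last first.
    by rewrite /weight2; ring.
  rewrite mulrA ler_wpM2r//.
  rewrite -[leRHS]mulr1 ler_pM ?mulr_ge0 ?(ltW (expabs_gt0 _ _)) ?cos_max//.
  by rewrite ler_wpM2l// ler_pM// ltW// expabs_gt0.
transitivity (\int[mu2]_p (a * (expabs e p.1 * expabs e p.2) *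
     (cos (p.1 * z.1.1 + p.2 * z.1.2 + c) * poisson e z.2))%:E)%E.
  apply: eq_integral => -[x y] _ /=.
  rewrite -integral_expabs_cos//; apply: eq_integral => t _; congr EFin.
  rewrite /expabs3 /dot /= (_ : z.2 * t + _ = x * z.1.1 + y * z.1.2 + t * z.2 + c); ring.
have := integral12_prod_meas1 dom2; rewrite /fubini_F => <-.
transitivity (\int[mu]_x ((a * (poisson e z.1.2 * poisson e z.2)) *
    (expabs e x * cos (z.1.1 * x + c)))%:E)%E.
  apply: eq_integral => x _ /=.
  transitivity ((a * (expabs e x * poisson e z.2)) *
     (cos (x * z.1.1 + c) * poisson e z.1.2))%:E.
    rewrite -integral_expabs_cos//; apply: eq_integral => t _; congr EFin.
    by rewrite (_ : z.1.2 * t + _ = x * z.1.1 + t * z.1.2 + c); ring.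
  by congr EFin; rewrite [x * _]mulrC; ring.
rewrite integral_expabs_cos//; congr EFin.
by rewrite /poisson3; ring.
Qed.

End poisson3.

(** * Fourier inversion on Schwartz functions *)

Section scaling.
Context {R : realType}.
Local Notation mu := (@lebesgue_measure R).
Local Notation mu3 := (prodm (prodm mu mu) mu).
Variable e : R.
Hypothesis e0 : 0 < e.

Lemma poisson_gt0 z : 0 < poisson e z.
Proof. by rewrite divr_gt0 ?mulr_gt0 // ltr_pwDl ?exprn_gt0 ?sqr_ge0. Qed.

Lemma continuous_poisson x : continuous (fun t => poisson e (t - x)).
Proof.
move=> t; apply: cvgM; first exact: cvg_cst.
apply: cvgV; first by rewrite gt_eqF // ltr_pwDl ?exprn_gt0 ?sqr_ge0.
apply: cvgD; first exact: cvg_cst.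
apply: (@continuous_comp _ _ _ (fun t : R => t - x) (fun t => t ^+ 2)); last exact: exprn_continuous.
by apply: cvgB; [exact: cvg_id|exact: cvg_cst].
Qed.

Lemma poisson_le_weight x : exists C, forall t, poisson e (t - x) <= C * weight1 t.
Proof.
(* from 1 + t^2 <= 1 + 2 x^2 + 2 (t - x)^2 *)
exists (2 * e * ((1 + 2 * x ^+ 2) / e ^+ 2 + 2)) => t.
rewrite /poisson -!mulrA !ler_wpM2l// ?(ltW e0)//.
have h : 0 < e ^+ 2 + (t - x) ^+ 2 by rewrite ltr_pwDl ?exprn_gt0 ?sqr_ge0.
have h' : 0 < 1 + t ^+ 2 by rewrite ltr_pwDl ?sqr_ge0.
have e2 : 0 < e ^+ 2 by rewrite exprn_gt0.
rewrite ler_pdivlMr// mulrC ler_pdivrMr//.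
rewrite [leRHS](_ : _ = (1 + 2 * x ^+ 2) + 2 * (t - x) ^+ 2 + (2 * e ^+ 2 + (1 + 2 * x ^+ 2) / e ^+ 2 * (t - x) ^+ 2)); last first.
  by field; rewrite gt_eqF.
have p1 : 0 <= (1 + 2 * x ^+ 2) / e ^+ 2 * (t - x) ^+ 2.
  by rewrite mulr_ge0 ?sqr_ge0// divr_ge0 ?(ltW e2)// addr_ge0// mulr_ge0// sqr_ge0.
have p2 := sqr_ge0 (t - 2 * x); nra.
Qed.

(** The substitution t = e u + x turns the Poisson kernel centred at x into the
fixed density 2 / (1 + u^2). *)
Lemma ge0_integral_poisson (h : R -> R) x : continuous h -> (forall t, 0 <= h t) ->
  (\int[mu]_t (h t * poisson e (t - x))%:E =
   \int[mu]_t (h (e * t + x) * (2 * weight1 t))%:E)%E.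
Proof.
move=> ch h0; pose F t := e * t + x.
have dF t : is_derive t (1 : R) F e := is_derive_affine e x t.
have F' : (F^`())%classic = cst e.
  by apply/funext => t; rewrite derive1E; case: (dF t).
rewrite (@increasing_ge0_integration_by_substitutionT _ F); first last.
- by move=> t; rewrite mulr_ge0// ltW// poisson_gt0.
- by move=> t; apply: cvgM; [exact: ch|exact: continuous_poisson].
- apply/cvgryPge => A; near=> t.
  have : (A - x) / e <= t by near: t; apply: nbhs_pinfty_ge; exact: num_real.
  by rewrite ler_pdivrMr// lerBlDr mulrC.
- apply/cvgrNyPle => A; near=> t.
  have : t <= (A - x) / e by near: t; apply: nbhs_ninfty_le; exact: num_real.
  by rewrite ler_pdivlMr// lerBrDr mulrC.
- by move=> t; case: (dF t).
- by rewrite F'; exact: is_cvg_cst.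
- by rewrite F'; exact: is_cvg_cst.
- by rewrite F' => t; exact: cvg_cst.
- by move=> s t st; rewrite /F ltrD2r ltr_pM2l.
apply: eq_integral => t _; congr EFin.
transitivity (h (F t) * poisson e (F t - x) * e); first by rewrite F'.
rewrite /F addrK -mulrA; congr (_ * _).
rewrite /poisson /weight1 exprMn.
have h1 : 0 < 1 + t ^+ 2 by rewrite ltr_pwDl ?sqr_ge0.
have e2 : 0 < e ^+ 2 by rewrite exprn_gt0.
rewrite (_ : e ^+ 2 + e ^+ 2 * t ^+ 2 = e ^+ 2 * (1 + t ^+ 2)); last by ring.
by field; rewrite !gt_eqF.
Unshelve. all: by end_near. Qed.

Lemma integral_poisson (h : R -> R) (x M : R) : continuous h -> (forall t, `|h t| <= M) ->
  (\int[mu]_t (h t * poisson e (t - x))%:E =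
   \int[mu]_t (h (e * t + x) * (2 * weight1 t))%:E)%E.
Proof.
move=> ch hM; have M0 : 0 <= M by exact: le_trans (normr_ge0 _) (hM 0).
(* h + M and M are nonnegative, and h is their difference *)
have hM0 t : 0 <= h t + M by have := hM t; rewrite ler_norml => /andP[]; lra.
have caff : continuous (fun t => e * t + x).
  move=> t; apply: cvgD; last exact: cvg_cst.
  by apply: cvgM; [exact: cvg_cst|exact: cvg_id].
have mp : measurable_fun setT (fun t : R => poisson e (t - x)).
  by apply: continuous_measurable_fun; exact: continuous_poisson.
have mh : measurable_fun setT h by exact: continuous_measurable_fun.
have mhe : measurable_fun setT (fun t : R => h (e * t + x)).
  by apply: continuous_measurable_fun => t; apply: continuous_comp; [exact: caff|exact: ch].
have [C hC] := poisson_le_weight x.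
have i1 (g : R -> R) K : measurable_fun setT g -> (forall t, `|g t| <= K) ->
    mu.-integrable setT (EFin \o (fun t => g t * poisson e (t - x))).
  move=> mg gK; apply: (@dominated_integrable1 _ _ (K * C)); first exact: measurable_funM.
  move=> t; rewrite normrM (gtr0_norm (poisson_gt0 _)) -mulrA ler_pM//.
  exact/ltW/poisson_gt0.
have i2 (g : R -> R) K : measurable_fun setT g -> (forall t, `|g t| <= K) ->
    mu.-integrable setT (EFin \o (fun t => g t * (2 * weight1 t))).
  move=> mg gK; apply: (@dominated_integrable1 _ _ (K * 2)).
    by apply: measurable_funM => //; apply: measurable_funM => //; exact: measurable_weight1.
  move=> t; have w0 := ltW (@weight1_gt0 R t).
  by rewrite normrM -mulrA ler_pM// ger0_norm// mulr_ge0.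
have E1 := i1 (fun t => h t + M) (M + M) (measurable_funD mh (measurable_cst M)).
have E2 := i1 (fun=> M) `|M| (measurable_cst M) (fun=> lexx _).
have E3 := i2 (fun t => h (e * t + x) + M) (M + M) (measurable_funD mhe (measurable_cst M)).
have E4 := i2 (fun=> M) `|M| (measurable_cst M) (fun=> lexx _).
have MM : `|M| <= M by rewrite ger0_norm.
have {}E1 := E1 (fun t => le_trans (ler_normD _ _) (lerD (hM t) MM)).
have {}E3 := E3 (fun t => le_trans (ler_normD _ _) (lerD (hM _) MM)).
have hs := ge0_integral_poisson x (h := fun t => h t + M) _ hM0.
have Ms := ge0_integral_poisson x (h := fun=> M) (fun=> cvg_cst _) (fun=> M0).
have {}hs := hs (fun t => cvgD (ch t) (cvg_cst _)).
have T (g k : R -> R) : mu.-integrable setT (EFin \o (fun t => (g t + M) * k t)) ->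
  mu.-integrable setT (EFin \o (fun t => M * k t)) ->
  (\int[mu]_t (g t * k t)%:E = \int[mu]_t ((g t + M) * k t)%:E - \int[mu]_t (M * k t)%:E)%E.
  move=> ig iM; rewrite -integralB//=.
  by apply: eq_integral => t _; rewrite -EFinB; congr EFin; ring.
by rewrite (T _ _ E1 E2) (T _ _ E3 E4) hs Ms.
Qed.

Lemma dominated3_kernel (F : vec3 R -> R) (a1 a2 a3 : R -> R) (M C : R) :
  continuous F -> (forall v, `|F v| <= M) ->
  continuous a1 -> continuous a2 -> continuous a3 ->
  (forall t, 0 <= a1 t <= C * weight1 t) -> (forall t, 0 <= a2 t <= C * weight1 t) ->
  (forall t, 0 <= a3 t <= C * weight1 t) ->
  dominated3 (fun v => F v * (a1 v.1.1 * a2 v.1.2 * a3 v.2)).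
Proof.
move=> cF FM c1 c2 c3 h1 h2 h3; split.
  apply: measurable_funM; first exact: continuous3_measurable.
  have m1 := continuous_measurable_fun c1; have m2 := continuous_measurable_fun c2.
  have m3 := continuous_measurable_fun c3.
  apply: measurable_funM; first apply: measurable_funM.
  - apply: (measurableT_comp m1).
    by apply: measurableT_comp; [exact: measurable_fst|exact: measurable_fst].
  - apply: (measurableT_comp m2).
    by apply: measurableT_comp; [exact: measurable_snd|exact: measurable_fst].
  - by apply: (measurableT_comp m3); exact: measurable_snd.
exists (M * C ^+ 3) => v.
have /andP[p1 q1] := h1 v.1.1; have /andP[p2 q2] := h2 v.1.2; have /andP[p3 q3] := h3 v.2.
rewrite normrM (@ger0_norm _ (_ * _ * _)) ?mulr_ge0//.
rewrite [leRHS](_ : _ = M * ((C * weight1 v.1.1) * (C * weight1 v.1.2) * (C * weight1 v.2))).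
  by rewrite !ler_pM ?mulr_ge0.
by rewrite /weight /weight2; ring.
Qed.

(** The substitution v = e w + x, performed one coordinate at a time. *)
Lemma integral_poisson3 (f : vec3 R -> R) (x : vec3 R) (M : R) :
  continuous f -> (forall v, `|f v| <= M) ->
  (\int[mu3]_v (f v * poisson3 e (v - x))%:E =
   \int[mu3]_v (f (e *: v + x) * (8 * weight v))%:E)%E.
Proof.
move=> cf fM.
have [C1 hC1] := poisson_le_weight x.1.1; have [C2 hC2] := poisson_le_weight x.1.2.
have [C3 hC3] := poisson_le_weight x.2.
pose C := `|C1| + `|C2| + `|C3| + 2.
have w0 t : 0 < weight1 t := @weight1_gt0 R t.
have n1 := normr_ge0 C1; have n2 := normr_ge0 C2; have n3 := normr_ge0 C3.
have up k y : k <= `|C1| \/ k <= `|C2| \/ k <= `|C3| -> k * weight1 y <= C * weight1 y.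
  by move=> h; rewrite ler_pM2r// /C; case: h => [|[]]; lra.
have k1 t : 0 <= poisson e (t - x.1.1) <= C * weight1 t.
  rewrite ltW ?poisson_gt0//= (le_trans (hC1 t))// up//; left; exact: ler_norm.
have k2 t : 0 <= poisson e (t - x.1.2) <= C * weight1 t.
  rewrite ltW ?poisson_gt0//= (le_trans (hC2 t))// up//; right; left; exact: ler_norm.
have k3 t : 0 <= poisson e (t - x.2) <= C * weight1 t.
  rewrite ltW ?poisson_gt0//= (le_trans (hC3 t))// up//; right; right; exact: ler_norm.
have kw t : 0 <= 2 * weight1 t <= C * weight1 t.
  by rewrite mulr_ge0 ?(ltW (w0 t))//= ler_pM2r// /C; lra.
have c1 : continuous (fun t => poisson e (t - x.1.1)) by exact: continuous_poisson.
have c2 : continuous (fun t => poisson e (t - x.1.2)) by exact: continuous_poisson.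
have c3 : continuous (fun t => poisson e (t - x.2)) by exact: continuous_poisson.
have cw : continuous (fun t : R => 2 * weight1 t).
  by move=> t; apply: cvgM; [exact: cvg_cst|exact: continuous_weight1].
have cfst : continuous (fun v : vec3 R => v.1.1).
  by move=> v; apply: continuous_comp; exact: cvg_fst.
have csnd : continuous (fun v : vec3 R => v.1.2).
  by move=> v; apply: continuous_comp; [exact: cvg_fst|exact: cvg_snd].
have cthd : continuous (fun v : vec3 R => v.2).
  by move=> v; exact: cvg_snd.
have cd1 : continuous (fun v : vec3 R => e * v.1.1 + x.1.1).
  move=> v; apply: cvgD; last exact: cvg_cst.
  by apply: cvgM; [exact: cvg_cst|exact: cfst].
have cd2 : continuous (fun v : vec3 R => e * v.1.2 + x.1.2).
  move=> v; apply: cvgD; last exact: cvg_cst.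
  by apply: cvgM; [exact: cvg_cst|exact: csnd].
have cd3 : continuous (fun v : vec3 R => e * v.2 + x.2).
  move=> v; apply: cvgD; last exact: cvg_cst.
  by apply: cvgM; [exact: cvg_cst|exact: cthd].
have cf1 : continuous (fun v : vec3 R => f (e * v.1.1 + x.1.1, v.1.2, v.2)).
  move=> v; apply: continuous_comp; last exact: cf.
  exact: cvg_pair (cvg_pair (cd1 v) (csnd v)) (cthd v).
have cf2 : continuous (fun v : vec3 R => f (e * v.1.1 + x.1.1, e * v.1.2 + x.1.2, v.2)).
  move=> v; apply: continuous_comp; last exact: cf.
  exact: cvg_pair (cvg_pair (cd1 v) (cd2 v)) (cthd v).
have cf3 : continuous (fun v : vec3 R => f (e * v.1.1 + x.1.1, e * v.1.2 + x.1.2, e * v.2 + x.2)).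
  move=> v; apply: continuous_comp; last exact: cf.
  exact: cvg_pair (cvg_pair (cd1 v) (cd2 v)) (cd3 v).
have d0 := dominated3_kernel cf fM c1 c2 c3 k1 k2 k3.
have d1 := dominated3_kernel cf1 (fun v => fM _) cw c2 c3 kw k2 k3.
have d2 := dominated3_kernel cf2 (fun v => fM _) cw cw c3 kw kw k3.
have d3 := dominated3_kernel cf3 (fun v => fM _) cw cw cw kw kw kw.
transitivity (\int[mu3]_v (f v * (poisson e (v.1.1 - x.1.1) *
   poisson e (v.1.2 - x.1.2) * poisson e (v.2 - x.2)))%:E)%E.
  by apply: eq_integral.
have slice1D (h : R -> R) (k y : R) (g1 g2 : R -> R) : continuous h -> (forall t, `|h t| <= M) ->
   (forall t, g1 t = h t * k * poisson e (t - y)) ->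
   (forall t, g2 t = h (e * t + y) * k * (2 * weight1 t)) ->
   (\int[mu]_t (g1 t)%:E = \int[mu]_t (g2 t)%:E)%E.
  move=> ch hM h1 h2.
  under eq_integral do rewrite h1.
  under [RHS]eq_integral do rewrite h2.
  apply: (@integral_poisson (fun t => h t * k) y (M * `|k|)).
    by move=> t; apply: cvgM; [exact: ch|exact: cvg_cst].
  by move=> t; rewrite normrM ler_wpM2r.
rewrite (integral_slice3 d0 d1); last first.
  constructor 1 => y z /=.
  apply: (slice1D (fun t => f (t, y, z)) (poisson e (y - x.1.2) * poisson e (z - x.2)) x.1.1) => [|t|t|t].
  - exact: continuous_slice0.
  - exact: fM.
  - by ring.
  - by ring.
rewrite (integral_slice3 d1 d2); last first.
  constructor 2 => y z /=.
  apply: (slice1D (fun t => f (e * y + x.1.1, t, z)) (2 * weight1 y * poisson e (z - x.2)) x.1.2) => [|t|t|t].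
  - exact: continuous_slice1.
  - exact: fM.
  - by ring.
  - by ring.
rewrite (integral_slice3 d2 d3); last first.
  constructor 3 => y z /=.
  apply: (slice1D (fun t => f (e * y + x.1.1, e * z + x.1.2, t)) (2 * weight1 y * (2 * weight1 z)) x.2) => [|t|t|t].
  - exact: continuous_slice2.
  - exact: fM.
  - by ring.
  - by ring.
apply: eq_integral => v _; congr EFin.
rewrite (_ : e *: v + x = (e * v.1.1 + x.1.1, e * v.1.2 + x.1.2, e * v.2 + x.2)); last first.
  by case: v => [[? ?] ?]; case: x {hC1 hC2 hC3 k1 k2 k3 c1 c2 c3 cd1 cd2 cd3 cf1 cf2 cf3 d0 d1 d2 d3} => [[? ?] ?].
by rewrite /weight /weight2; ring.
Qed.

End scaling.

Section inversion.
Context {R : realType}.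
Local Notation mu := (@lebesgue_measure R).
Local Notation mu3 := (prodm (prodm mu mu) mu).

(** After the substitution v = e w + x the dependence on e is only in the argument
of f, so continuity at x and dominated convergence give the limit; the constant is
the mass of 8 times the weight. *)
Lemma cvg_poisson3 (f : vec3 R -> R) (x : vec3 R) (M : R) :
  continuous f -> (forall v, `|f v| <= M) ->
  (\int[mu3]_v (f v * poisson3 n.+1%:R^-1 (v - x))%:E @[n --> \oo] -->
   ((2 * pi) ^+ 3 * f x)%:E)%E.
Proof.
move=> cf fM.
have en0 n : 0 < n.+1%:R^-1 :> R by rewrite invr_gt0 ltr0n.
have mf (a : R) : measurable_fun setT ((fun v => f (a *: v + x)) : mvec3 R -> R).
  apply: continuous3_measurable => v; apply: continuous_comp; last exact: cf.
  by apply: cvgD; [exact: scaler_continuous|exact: cvg_cst].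
have E : ((2 * pi) ^+ 3 * f x)%:E = (\int[mu3]_v (f x * (8 * weight v))%:E)%E.
  transitivity (\int[mu3]_v ((8 * f x)%:E * (weight v)%:E))%E; last first.
    by apply: eq_integral => v _; rewrite -EFinM; congr EFin; ring.
  rewrite integralZl//.
    by rewrite integral_weight -EFinM; congr EFin; ring.
  apply: (@dominated_integrable3 _ _ 1); first exact: measurable_weight.
  by move=> v; rewrite mul1r gtr0_norm// weight_gt0.
rewrite E.
under eq_cvg do rewrite (integral_poisson3 (en0 _) x cf fM).
apply: (@dominated_cvg_EFin _ _ _ mu3 setT (fun n v => f (n.+1%:R^-1 *: v + x) * (8 * weight v))
  (fun v => f x * (8 * weight v)) (fun v => M * (8 * weight v))) => //.
- move=> n; apply: measurable_funM => //.
  by apply: measurable_funM => //; exact: measurable_weight.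
- move=> v _; apply: cvgM; last exact: cvg_cst.
  apply: (cvg_comp (fun n => n.+1%:R^-1 *: v + x) f _ (cf x)).
  have h : n.+1%:R^-1 *: v + x @[n --> \oo] --> (0 : R) *: v + x.
    apply: cvgD; last exact: cvg_cst.
    by apply: cvgZr_tmp; exact: invSn_cvg.
  by move: h; rewrite scale0r add0r.
- apply: (@dominated_integrable3 _ _ (M * 8)).
    by apply: measurable_funM => //; apply: measurable_funM => //; exact: measurable_weight.
  move=> v; have w0 := ltW (weight_gt0 v).
  have M0 : 0 <= M by exact: le_trans (normr_ge0 _) (fM x).
  rewrite ger0_norm; first by rewrite mulrA.
  by apply: mulr_ge0 => //; apply: mulr_ge0.
- move=> n v _; rewrite normrM ler_pM// ger0_norm// mulr_ge0// ltW// weight_gt0//.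
Qed.

Variables (f : vec3 R -> R) (x : vec3 R) (c : R).
Hypothesis hf : schwartz_real f.

Let G xi : R := cos_transform f xi (c - dot x xi).
Let en (n : nat) : R := n.+1%:R^-1.
Let en0 n : 0 < en n. Proof. by rewrite invr_gt0 ltr0n. Qed.

Let bounded_f : exists M, forall v, `|f v| <= M.
Proof.
have [C hC] := schwartz_le_weight hf; exists `|C| => v.
apply: le_trans (hC v) _.
have h := @weight_gt0 R v.
rewrite (le_trans (ler_wpM2r (ltW h) (ler_norm C)))// ler_piMr//.
by rewrite /weight /weight2 mulr_ile1 ?mulr_ge0 ?(ltW (weight1_gt0 _)) ?weight1_le1// mulr_ile1 ?(ltW (weight1_gt0 _)) ?weight1_le1.
Qed.

Let integrable_weight : mu3.-integrable setT (EFin \o (@weight R)).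
Proof.
apply: (@dominated_integrable3 _ _ 1); first exact: measurable_weight.
by move=> v; rewrite mul1r gtr0_norm// weight_gt0.
Qed.

Let F n (p : mvec3 R * mvec3 R) : R :=
  expabs3 (en n) p.1 * (cos (dot p.2 p.1 + (c - dot x p.1)) * f p.2).

Let integrable_F n : (prodm mu3 mu3).-integrable setT (EFin \o F n).
Proof.
have [mf [Cf fC]] := schwartz_dominated3 hf.
have [mx [Ce eC]] := dominated3_expabs3 (en0 n).
have mdot : measurable_fun setT (fun p : mvec3 R * mvec3 R => dot p.2 p.1 + (c - dot x p.1)).
  have m1 : measurable_fun setT (fun p : mvec3 R * mvec3 R => p.1) by exact: measurable_fst.
  have m2 : measurable_fun setT (fun p : mvec3 R * mvec3 R => p.2) by exact: measurable_snd.
  have m11 := measurableT_comp measurable_fst m1.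
  have m22 := measurableT_comp measurable_fst m2.
  have a1 := measurableT_comp measurable_fst m11.
  have a2 := measurableT_comp measurable_snd m11.
  have a3 := measurableT_comp measurable_snd m1.
  have b1 := measurableT_comp measurable_fst m22.
  have b2 := measurableT_comp measurable_snd m22.
  have b3 := measurableT_comp measurable_snd m2.
  rewrite /dot; apply: measurable_funD.
    apply: measurable_funD; first apply: measurable_funD.
    + exact: (measurable_funM b1 a1).
    + exact: (measurable_funM b2 a2).
    + exact: (measurable_funM b3 a3).
  apply: measurable_funB => //.
  apply: measurable_funD; first apply: measurable_funD.
  + exact: (measurable_funM (measurable_cst _) a1).
  + exact: (measurable_funM (measurable_cst _) a2).
  + exact: (measurable_funM (measurable_cst _) a3).
have mF : measurable_fun setT (F n).
  apply: measurable_funM.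
    by apply: (measurableT_comp mx); exact: measurable_fst.
  apply: measurable_funM.
    have mc : measurable_fun setT (@cos R).
      by apply: continuous_measurable_fun; exact: continuous_cos.
    exact: (measurableT_comp mc mdot).
  by apply: (measurableT_comp mf); exact: measurable_snd.
apply: (@integrable_le_weight _ _ _ (prodm mu3 mu3)
   (fun p : mvec3 R * mvec3 R => weight p.1 * weight p.2) (F n) (Ce * Cf)).
- apply: measurable_funM.
    by apply: (measurableT_comp measurable_weight); exact: measurable_fst.
  by apply: (measurableT_comp measurable_weight); exact: measurable_snd.
- by move=> p; rewrite mulr_ge0// ltW// weight_gt0.
- rewrite integral_tensor ?integral_weight ?ltry//.
  + exact: measurable_weight.
  + exact: measurable_weight.
  + by move=> v; exact/ltW/weight_gt0.
  + by move=> v; exact/ltW/weight_gt0.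
- exact: mF.
- move=> p; rewrite /F normrM [leRHS](_ : _ = (Ce * weight p.1) * (Cf * weight p.2)); last by ring.
  by rewrite ler_pM// (le_trans (normr_cosM _ _)).
Qed.

Let integral_F n xi :
  (\int[mu3]_v (F n (xi, v))%:E = (expabs3 (en n) xi * G xi)%:E)%E.
Proof.
rewrite /F /=.
have ic := dominated3_integrable (dominated3_cosM xi (c - dot x xi) (schwartz_dominated3 hf)).
under eq_integral do rewrite EFinM.
rewrite integralZl// (EFinM (expabs3 (en n) xi) (G xi)); congr mule.
by rewrite /G /cos_transform /Rintegral fineK//; exact: integrable_fin_num ic.
Qed.

Let swapped n : (\int[mu3]_xi (expabs3 (en n) xi * G xi)%:E =
  \int[mu3]_v ((cos c * f v) * poisson3 (en n) (v - x))%:E)%E.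
Proof.
have := Fubini (integrable_F n).
rewrite [X in X = _ -> _](_ : _ = \int[mu3]_xi (expabs3 (en n) xi * G xi)%:E)%E; last first.
  by apply: eq_integral => xi _; exact: integral_F.
move=> ->; apply: eq_integral => v _.
transitivity (\int[mu3]_xi (f v * (expabs3 (en n) xi * cos (dot xi (v - x) + c)))%:E)%E.
  apply: eq_integral => xi _; rewrite /F /=; congr EFin.
  rewrite (_ : dot xi (v - x) + c = dot v xi + (c - dot x xi)); first by ring.
  by rewrite /dot /=; ring.
by rewrite integral_expabs3_cos//; congr EFin; ring.
Qed.

Let cvg_expabs3 xi : expabs3 (en n) xi @[n --> \oo] --> (1 : R).
Proof.
have h (t : R) : expabs (en n) t @[n --> \oo] --> (1 : R).
  rewrite -(@expR0 R) -[0](@oppr0 R) -(mul0r `|t|).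
  apply: (cvg_comp (fun n => - (en n * `|t|)) expR _ (@continuous_expR R _)).
  by apply: cvgN; apply: cvgM; [exact: invSn_cvg|exact: cvg_cst].
by rewrite -[1](mulr1 1) -{1}[1](mulr1 1); apply: cvgM; [apply: cvgM|]; exact: h.
Qed.

Let measurable_expabs3G n : measurable_fun setT ((fun xi => expabs3 (en n) xi * G xi) : mvec3 R -> R).
Proof.
have := measurable_fubini_F (integrable_F n).
move/(eq_measurable_fun _ _) => h; apply/measurable_EFinP; apply: h => xi _.
exact: integral_F.
Qed.

(** Inversion in real form.  The factor [expabs3] makes the double integral
absolutely convergent; exchanging the integrals produces a Poisson kernel centred
at x, and e = 1 / (n + 1) is sent to 0 on both sides. *)
Lemma integral_cos_transform :
  mu3.-integrable setT (EFin \o G) /\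
  \int[mu3]_xi G xi = cos c * ((2 * pi) ^+ 3 * f x).
Proof.
have [C hC] := cos_transform_decay hf.
have cvgG xi : expabs3 (en n) xi * G xi @[n --> \oo] --> G xi.
  by rewrite -[X in _ --> X]mul1r; apply: cvgM; [exact: cvg_expabs3|exact: cvg_cst].
have mG : measurable_fun setT (G : mvec3 R -> R).
  by apply: (measurable_fun_cvg measurable_expabs3G) => xi _; exact: cvgG.
have iG : mu3.-integrable setT (EFin \o G).
  by apply: (@dominated_integrable3 _ _ C) => // xi; exact: hC.
split => //.
have h1 : (\int[mu3]_xi (expabs3 (en n) xi * G xi)%:E @[n --> \oo] --> \int[mu3]_xi (G xi)%:E)%E.
  apply: (@dominated_cvg_EFin _ _ _ mu3 setT (fun n xi => expabs3 (en n) xi * G xi) G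
    (fun xi => C * weight xi)) => //.
  - by apply: (integrableZl measurableT C integrable_weight).
  - move=> n xi _; rewrite normrM (le_trans _ (hC xi (c - dot x xi)))//.
    by rewrite ler_piMl// ger0_norm ?expabs3_le1// expabs3_ge0.
have h2 : (\int[mu3]_xi (expabs3 (en n) xi * G xi)%:E @[n --> \oo] -->
   (cos c * ((2 * pi) ^+ 3 * f x))%:E)%E.
  rewrite (_ : cos c * ((2 * pi) ^+ 3 * f x) = (2 * pi) ^+ 3 * (cos c * f x)); last by ring.
  under eq_cvg do rewrite swapped.
  have [M fM] := bounded_f.
  apply: (@cvg_poisson3 (fun v => cos c * f v) x M).
    by move=> v; apply: cvgM; [exact: cvg_cst|exact: schwartz_continuous].
  by move=> v; exact: le_trans (normr_cosM _ _) (fM v).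
by rewrite /Rintegral (cvg_unique (@ereal_hausdorff R) h1 h2).
Qed.

End inversion.

Section complex_inversion.
Context {R : realType}.
Local Notation mu := (@lebesgue_measure R).
Local Notation mu3 := (prodm (prodm mu mu) mu).
Local Open Scope complex_scope.

(** A phase d is absorbed by the addition formula, a shift by pi / 2 of the
phase replacing the sine. *)
Lemma cos_transformB (f : vec3 R -> R) xi (c d : R) : dominated3 f ->
  cos_transform f xi (c - d) =
  cos d * cos_transform f xi c + sin d * cos_transform f xi (c - pi / 2).
Proof.
move=> df; have i1 := dominated3_integrable (dominated3_cosM xi c df).
have i2 := dominated3_integrable (dominated3_cosM xi (c - pi / 2) df).
rewrite /cos_transform -!RintegralZl// -RintegralD//; last 2 first.
- exact: (integrableZl measurableT _ i1).
- exact: (integrableZl measurableT _ i2).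
apply: eq_Rintegral => v _.
by rewrite [dot v xi + (c - d)]addrA [dot v xi + (c - pi / 2)]addrA cosBpihalf cosB; ring.
Qed.

Lemma cos_transformBpi (f : vec3 R -> R) xi (c : R) :
  dominated3 f -> cos_transform f xi (c - pi) = - cos_transform f xi c.
Proof.
by move=> df; rewrite cos_transformB// cospi sinpi mul0r addr0 mulN1r.
Qed.

Lemma cos_transformDl (f g : vec3 R -> R) xi (c d : R) :
  dominated3 f -> dominated3 g ->
  \int[lebesgue3]_v (cos (dot v xi + c) * f v + cos (dot v xi + d) * g v) =
  cos_transform f xi c + cos_transform g xi d.
Proof.
move=> df dg; have i1 := dominated3_integrable (dominated3_cosM xi c df).
have i2 := dominated3_integrable (dominated3_cosM xi d dg).
exact: (RintegralD measurableT i1 i2).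
Qed.

Lemma cos_transformBl (f g : vec3 R -> R) xi (c d : R) :
  dominated3 f -> dominated3 g ->
  \int[lebesgue3]_v (cos (dot v xi + c) * f v - cos (dot v xi + d) * g v) =
  cos_transform f xi c - cos_transform g xi d.
Proof.
move=> df dg; have i1 := dominated3_integrable (dominated3_cosM xi c df).
have i2 := dominated3_integrable (dominated3_cosM xi d dg).
exact: (RintegralB measurableT i1 i2).
Qed.

Lemma fourierE (phi : vec3 R -> R[i]) xi : schwartz phi ->
  fourier phi xi =
  (cos_transform (fun v => complex.Re (phi v)) xi 0 +
   cos_transform (fun v => complex.Im (phi v)) xi (0 - pi / 2)) +i*
  (cos_transform (fun v => complex.Im (phi v)) xi 0 -
   cos_transform (fun v => complex.Re (phi v)) xi (0 - pi / 2)).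
Proof.
move=> [/schwartz_dominated3 dr /schwartz_dominated3 di].
rewrite /fourier /cintegral -cos_transformDl// -cos_transformBl//.
congr (_ +i* _); apply: eq_Rintegral => v _; rewrite /cis; case: (phi v) => a b /=.
- by rewrite addr0 add0r cosBpihalf cosN sinN; ring.
- by rewrite addr0 add0r cosBpihalf cosN sinN; ring.
Qed.

Theorem inv_fourier_fourier (phi : vec3 R -> R[i]) x : schwartz phi ->
  inv_fourier (fourier phi) x = phi x.
Proof.
move=> hphi; have [hr hi] := hphi.
have dr := schwartz_dominated3 hr; have di := schwartz_dominated3 hi.
have [i1 e1] := integral_cos_transform x 0 hr.
have [i2 e2] := integral_cos_transform x 0 hi.
have [i3 e3] := integral_cos_transform x (0 - pi / 2) hr.
have [i4 e4] := integral_cos_transform x (0 - pi / 2) hi.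
have c0 : cos (0 - pi / 2) = 0 :> R by rewrite sub0r cosN cos_pihalf.
rewrite cos0 mul1r in e1; rewrite cos0 mul1r in e2.
rewrite c0 mul0r in e3; rewrite c0 mul0r in e4.
have p0 : (2 * pi : R) ^+ 3 != 0 by rewrite expf_neq0// mulf_neq0// gt_eqF ?pi_gt0.
have pihalf2 xi (f : vec3 R -> R) : dominated3 f ->
    cos_transform f xi (0 - pi / 2 - pi / 2) = - cos_transform f xi 0.
  by move=> df; rewrite -cos_transformBpi//; congr (cos_transform f xi _); field.
have re : \int[lebesgue3]_xi complex.Re (cis (dot x xi) * fourier phi xi) =
    (2 * pi) ^+ 3 * complex.Re (phi x).
  rewrite -[RHS]addr0 -e4 -e1.
  transitivity (\int[mu3]_xi (cos_transform (fun v => complex.Re (phi v)) xi (0 - dot x xi) +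
    cos_transform (fun v => complex.Im (phi v)) xi (0 - pi / 2 - dot x xi))).
    apply: eq_Rintegral => xi _.
    rewrite fourierE// /cis /=.
    by rewrite (cos_transformB xi 0 (dot x xi) dr)
      (cos_transformB xi (0 - pi / 2) (dot x xi) di) pihalf2//; ring.
  exact: (RintegralD measurableT i1 i4).
have im : \int[lebesgue3]_xi complex.Im (cis (dot x xi) * fourier phi xi) =
    (2 * pi) ^+ 3 * complex.Im (phi x).
  rewrite -[RHS]subr0 -e3 -e2.
  transitivity (\int[mu3]_xi (cos_transform (fun v => complex.Im (phi v)) xi (0 - dot x xi) -
    cos_transform (fun v => complex.Re (phi v)) xi (0 - pi / 2 - dot x xi))).
    apply: eq_Rintegral => xi _.
    rewrite fourierE// /cis /=.
    by rewrite (cos_transformB xi 0 (dot x xi) di)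
      (cos_transformB xi (0 - pi / 2) (dot x xi) dr) pihalf2//; ring.
  exact: (RintegralB measurableT i2 i3).
rewrite /inv_fourier /cintegral re im.
case: (phi x) => a b /=; congr (_ +i* _).
- by rewrite mul0r subr0 mulrA mulVf ?mul1r.
- by rewrite mul0r addr0 mulrA mulVf ?mul1r.
Qed.

End complex_inversion.

(** * Rotation invariance of the surface measure *)

Section real_derivatives.
Context {R : realType}.
Implicit Types F G : R -> R.

(** The next four lemmas restate derivation rules for functions written as
abstractions, the form in which they are met below. *)
Lemma is_deriveZR F (k x dF : R) : is_derive x (1 : R) F dF ->
  is_derive x (1 : R) (fun t => k * F t) (k * dF).
Proof. exact: is_deriveZ. Qed.

Lemma is_deriveDR F G (x dF dG : R) : is_derive x (1 : R) F dF ->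
  is_derive x (1 : R) G dG -> is_derive x (1 : R) (fun t => F t + G t) (dF + dG).
Proof. exact: is_deriveD. Qed.

Lemma is_deriveMR F G (x dF dG : R) : is_derive x (1 : R) F dF ->
  is_derive x (1 : R) G dG ->
  is_derive x (1 : R) (fun t => F t * G t) (F x * dG + G x * dF).
Proof. exact: is_deriveM. Qed.

Lemma is_derive_compR F G (x dF dG : R) : is_derive (G x) (1 : R) F dF ->
  is_derive x (1 : R) G dG -> is_derive x (1 : R) (fun t => F (G t)) (dF * dG).
Proof. exact: is_derive1_comp. Qed.

End real_derivatives.

Section gumbel.
Context {R : realType}.

(** Smooth functions of u, with bounded derivative, from which the indicator of
a half-line is recovered as a pointwise limit ([gumbel_cvg_indic]).  They are the
test functions for which rotation invariance is proved by differentiation. *)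
Definition gumbel (k a u : R) : R := expR (- expR (a - k * u)).

Lemma gumbel_ge0 k a u : 0 <= gumbel k a u. Proof. exact: expR_ge0. Qed.

Lemma gumbel_le1 k a u : gumbel k a u <= 1.
Proof. by rewrite expR_le1 oppr_le0 expR_ge0. Qed.

Lemma is_derive_gumbel (k a u : R) :
  is_derive u (1 : R) (gumbel k a) (k * expR (a - k * u) * gumbel k a u).
Proof.
have h1 : is_derive u (1 : R) (fun t => a - k * t) (- k).
  have := is_derive_affine (- k) a u.
  by under eq_fun do rewrite mulNr addrC.
have h2 := @is_derive1_comp R expR (fun t => a - k * t) u _ _ (is_derive_expR _) h1.
have h3 := is_deriveN h2.
have := @is_derive1_comp R expR _ u _ _ (is_derive_expR _) h3.
by move/is_derive_eq; apply; rewrite /gumbel /=; ring.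
Qed.

Lemma continuous_gumbel k a : continuous (gumbel k a).
Proof.
by move=> u; apply/differentiable_continuous/derivable1_diffP; case: (is_derive_gumbel k a u).
Qed.

Lemma continuous_dgumbel (k a : R) :
  continuous (fun u : R => k * expR (a - k * u) * gumbel k a u).
Proof.
move=> u; apply: cvgM; last exact: continuous_gumbel.
apply: cvgM; first exact: cvg_cst.
apply: (@continuous_comp _ _ _ (fun u : R => a - k * u) expR); last exact: continuous_expR.
by apply: cvgB; [exact: cvg_cst|apply: cvgM; [exact: cvg_cst|exact: cvg_id]].
Qed.

Lemma dgumbel_bounded (k a u : R) : `|k * expR (a - k * u) * gumbel k a u| <= `|k|.
Proof.
rewrite !normrM -mulrA ler_piMr// !ger0_norm ?expR_ge0 ?gumbel_ge0// /gumbel.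
rewrite expRN ler_pdivrMr ?expR_gt0// mul1r.
by apply: le_trans (expR_ge1Dx _); rewrite lerDr.
Qed.

(** The inner exponent n + n^2 (x - u) is at least n when u <= x, and tends to minus
infinity when u > x. *)
Lemma gumbel_cvg_indic (x u : R) :
  gumbel (n%:R ^+ 2) (n%:R + n%:R ^+ 2 * x) u @[n --> \oo] --> (\1_(`]x, +oo[) u : R).
Proof.
have cn : expR (- n%:R) @[n --> \oo] --> (0 : R) by exact: cvgn_expR.
rewrite indicE; have [ux|xu] := leP u x.
  rewrite memNset /=; last by rewrite in_itv /= andbT; apply/negP; rewrite -leNgt.
  apply: (squeeze_cvgr _ (cvg_cst 0) cn); apply: nearW => n.
  rewrite gumbel_ge0 /= ler_expR lerN2.
  apply: le_trans (expR_ge1Dx _).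
  have : 0 <= n%:R ^+ 2 * (x - u) by rewrite mulr_ge0 ?sqr_ge0// subr_ge0.
  lra.
rewrite mem_set /=; last by rewrite in_itv /= andbT.
have c1 : 1 - expR (- n%:R) @[n --> \oo] --> (1 : R).
  by rewrite -[X in _ --> X]subr0; apply: cvgB; [exact: cvg_cst|].
rewrite -[X in _ --> X]/(1 : R).
apply: (squeeze_cvgr _ c1 (cvg_cst (1 : R))).
have d0 : 0 < u - x by rewrite subr_gt0.
near=> n.
rewrite gumbel_le1 andbT (le_trans _ (expR_ge1Dx _))// lerD2l lerN2 ler_expR.
have n2 : 2 / (u - x) <= n%:R by near: n; exact: nbhs_infty_ger.
have n0 : 0 <= n%:R :> R by rewrite ler0n.
move: n2; rewrite ler_pdivrMr// => n2.
have := ler_wpM2l n0 n2; rewrite expr2; nra.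
Unshelve. all: by end_near. Qed.

End gumbel.

Section density_measure.
Context d (T : measurableType d) (R : realType).
Variables (m : {measure set T -> \bar R}) (D : set T) (w : T -> R).
Hypotheses (mD : measurable D) (mw : measurable_fun D w)
  (w0 : forall x, D x -> 0 <= w x).

(** The measure with density w with respect to m restricted to D; equality of
weighted integrals becomes equality of two image measures on the line. *)
Definition density_measure (A : set T) : \bar R :=
  (\int[m]_(x in A) ((w \_ D) x)%:E)%E.

Local Notation wD := (w \_ D).

Let wD0 x : 0 <= wD x.
Proof. by rewrite patchE; case: ifPn => // /set_mem; exact: w0. Qed.

Let mwD : measurable_fun setT wD.
Proof. by apply/(measurable_restrictT w mD). Qed.

Let density0 : density_measure set0 = 0%E.
Proof. exact: integral_set0. Qed.

Let density_ge0 A : (0 <= density_measure A)%E.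
Proof. by apply: integral_ge0 => x _; rewrite lee_fin. Qed.

Let density_sigma_additive : semi_sigma_additive density_measure.
Proof.
move=> F mF tF mUF; rewrite /density_measure; apply: cvg_toP.
  apply: ereal_nondecreasing_is_cvgn => a b ab.
  apply: lee_sum_nneg_natr => // k _ _; apply: integral_ge0 => /= x Fkx.
  by rewrite lee_fin.
rewrite ge0_integral_bigcup//=.
- exact/measurable_EFinP/measurable_funTS.
- by move=> x _; rewrite lee_fin.
Qed.

HB.instance Definition _ := isMeasure.Build _ _ _ density_measure
  density0 density_ge0 density_sigma_additive.

Import HBNNSimple.

Lemma ge0_integral_density (g : T -> R) : measurable_fun setT g ->
  (forall x, 0 <= g x) ->
  (\int[density_measure]_x (g x)%:E = \int[m]_(x in D) (g x * w x)%:E)%E.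
Proof.
move=> mg g0.
have -> : (\int[m]_(x in D) (g x * w x)%:E = \int[m]_x (g x * wD x)%:E)%E.
  rewrite integral_mkcond; apply: eq_integral => x _.
  by rewrite !patchE; case: ifP => _; rewrite ?mulr0.
have meg : measurable_fun setT (EFin \o g) by exact/measurable_EFinP.
pose h := nnsfun_approx measurableT meg.
have hg x : (h n x)%:E @[n --> \oo] --> (g x)%:E.
  by apply: cvg_nnsfun_approx => //= y _; rewrite lee_fin.
have nd x : {homo (fun n => h n x) : a b / (a <= b)%N >-> a <= b}.
  by move=> a b ab; exact/lefP/nd_nnsfun_approx.
have -> : (\int[density_measure]_x (g x)%:E =
    limn (fun n => \int[density_measure]_x (h n x)%:E))%E.
  rewrite -monotone_convergence//.
  - by apply: eq_integral => x _; apply/esym/cvg_lim => //; exact: hg.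
  - by move=> n; exact/measurable_EFinP/measurable_funP.
  - by move=> n x _; rewrite lee_fin.
  - by move=> x _ a b ab; rewrite lee_fin; exact: nd.
have -> : (\int[m]_x (g x * wD x)%:E =
    limn (fun n => \int[m]_x (h n x * wD x)%:E))%E.
  rewrite -monotone_convergence//.
  - apply: eq_integral => x _; apply/esym/cvg_lim => //.
    under eq_fun do rewrite EFinM.
    by rewrite EFinM; apply: cvgeZr => //; exact: hg.
  - by move=> n; apply/measurable_EFinP/measurable_funM.
  - by move=> n x _; rewrite lee_fin mulr_ge0.
  - by move=> x _ a b ab; rewrite lee_fin ler_wpM2r//; exact: nd.
congr (limn _); apply/funext => n.
transitivity (\int[density_measure]_x
   (\sum_(y \in range (h n)) (y * \1_(h n @^-1` [set y]) x)%:E))%E.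
  by apply: eq_integral => t _; rewrite /= fimfunE -fsumEFin.
rewrite ge0_integral_fsum//; last 2 first.
- by move=> y; apply/measurable_EFinP/measurable_funM.
- by move=> y x _; exact: nnfun_muleindic_ge0.
transitivity (\int[m]_x
   (\sum_(y \in range (h n)) (y * \1_(h n @^-1` [set y]) x)%:E * (wD x)%:E))%E; last first.
  apply: eq_integral => x _.
  rewrite -ge0_mule_fsuml => [|y]; last exact: nnfun_muleindic_ge0.
  by rewrite fsumEFin // -(fimfunE _ x) -EFinM.
rewrite ge0_integral_fsum//; last 2 first.
- by move=> y; apply: emeasurable_funM; apply/measurable_EFinP => //; exact: measurable_funM.
- by move=> y x _; apply: mule_ge0; [exact: nnfun_muleindic_ge0|rewrite lee_fin].
apply: eq_fsbigr => r rhn.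
under eq_integral do rewrite EFinM.
rewrite integralZl_indic_nnsfun//.
under [RHS]eq_integral do rewrite EFinM -muleA.
rewrite ge0_integralZl//.
- rewrite integral_indic// setIT; congr mule.
  rewrite -[LHS]/(density_measure (h n @^-1` [set r])) /density_measure [LHS]integral_mkcond.
  apply: eq_integral => x _; rewrite patchE indicE; case: ifP => _.
    by rewrite mul1e.
  by rewrite mul0e.
- by apply: emeasurable_funM; exact/measurable_EFinP.
- by move=> x _; rewrite mule_ge0// lee_fin.
- by move: rhn => /set_mem [x _ <-]; rewrite lee_fin.
Qed.

Hypothesis iw : m.-integrable D (EFin \o w).

Let density_fin A : measurable A -> (density_measure A < +oo)%E.
Proof.
move=> mA; apply: (@le_lt_trans _ _ (\int[m]_x (wD x)%:E)%E).
  apply: ge0_subset_integral => //; first exact/measurable_EFinP.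
  by move=> x _; rewrite lee_fin.
rewrite (_ : (\int[m]_x _)%E = (\int[m]_(x in D) (w x)%:E)%E).
  exact: integrable_lty iw.
rewrite [RHS]integral_mkcond; apply: eq_integral => x _.
by rewrite !patchE; case: ifP.
Qed.

Variables f1 f2 : T -> R.
Hypotheses (mf1 : measurable_fun setT f1) (mf2 : measurable_fun setT f2).
Hypothesis f12 : forall k a,
  (\int[m]_(x in D) (gumbel k a (f1 x) * w x)%:E =
   \int[m]_(x in D) (gumbel k a (f2 x) * w x)%:E)%E.

Let density_preimage (f : T -> R) (x : R) : measurable_fun setT f ->
  (density_measure (f @^-1` `]x, +oo[) =
   \int[m]_(t in D) (\1_(`]x, +oo[) (f t) * w t)%:E)%E.
Proof.
move=> mf; rewrite /density_measure integral_mkcond [RHS]integral_mkcond.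
apply: eq_integral => t _; rewrite !patchE indicE.
rewrite -[f t \in _]/(t \in f @^-1` `]x, +oo[).
by case: (t \in D); case: (t \in _); rewrite ?mul1r ?mul0r.
Qed.

Let indic_eq (x : R) : (\int[m]_(t in D) (\1_(`]x, +oo[) (f1 t) * w t)%:E =
   \int[m]_(t in D) (\1_(`]x, +oo[) (f2 t) * w t)%:E)%E.
Proof.
have lim f : measurable_fun setT f ->
  (\int[m]_(t in D) (gumbel (n%:R ^+ 2) (n%:R + n%:R ^+ 2 * x) (f t) * w t)%:E @[n --> \oo] -->
   \int[m]_(t in D) (\1_(`]x, +oo[) (f t) * w t)%:E)%E.
  move=> mf.
  apply: (@dominated_cvg_EFin _ _ _ m D
    (fun n t => gumbel (n%:R ^+ 2) (n%:R + n%:R ^+ 2 * x) (f t) * w t) _ w) => //.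
  - move=> n; apply: measurable_funM => //; apply: measurable_funTS.
    apply: measurableT_comp mf.
    by apply: continuous_measurable_fun; exact: continuous_gumbel.
  - move=> t _; apply: cvgM; last exact: cvg_cst.
    exact: gumbel_cvg_indic.
  - move=> n t Dt; rewrite ger0_norm ?mulr_ge0 ?gumbel_ge0 ?w0//.
    by rewrite ler_piMl ?w0 ?gumbel_le1.
have l1 := lim f1 mf1; have l2 := lim f2 mf2.
move: l1; under eq_cvg do rewrite f12.
by move=> l1; exact: (cvg_unique (@ereal_hausdorff R) l1 l2).
Qed.

(** Half-lines form a pi-system generating the Borel sets, so two weighted laws
that agree on all [gumbel] functions, hence on indicators of half-lines, are
equal. *)
Lemma ge0_integral_law_eq (h : R -> R) : measurable_fun setT h ->
  (forall u, 0 <= h u) ->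
  (\int[m]_(x in D) (h (f1 x) * w x)%:E = \int[m]_(x in D) (h (f2 x) * w x)%:E)%E.
Proof.
move=> mh h0.
rewrite -(@ge0_integral_density (h \o f1)); [|exact: measurableT_comp|by move=> x; exact: h0].
rewrite -(@ge0_integral_density (h \o f2)); [|exact: measurableT_comp|by move=> x; exact: h0].
have P f : measurable_fun setT (f : T -> measurableTypeR R) ->
  (\int[density_measure]_x ((h \o f) x)%:E = \int[pushforward density_measure f]_y (h y)%:E)%E.
  move=> mf; rewrite (ge0_integral_pushforward mf)//.
  - exact/measurable_EFinP.
  - by move=> y _; rewrite lee_fin.
rewrite (P f1)// (P f2)//.
apply: eq_measure_integral => A mA _.
apply: (@measure_unique _ _ (measurableTypeR R) (@RGenOInfty.G R)
  (fun n : nat => `](- n%:R), +oo[%classic)) => //.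
- exact: RGenOInfty.measurableE.
- move=> _ _ [a ->] [b ->]; exists (Num.max a b).
  apply/seteqP; split => t /=; rewrite !in_itv /= !andbT gt_max.
    by move=> [-> ->].
  by move=> /andP[].
- by move=> i; exists (- i%:R).
- apply/seteqP; split => // t _; exists (`|Num.ceil `|t| |.+1)%N => //=.
  rewrite in_itv /= andbT ltrNl (le_lt_trans (ler_norm _))// normrN.
  rewrite (le_lt_trans (ceil_ge _))// (le_lt_trans (ler_norm _))// -intr_norm -natr_absz ltr_nat//.
- move=> _ [a ->].
  rewrite -[LHS]/(density_measure (f1 @^-1` `]a, +oo[)).
  rewrite -[RHS]/(density_measure (f2 @^-1` `]a, +oo[)).
  by rewrite (density_preimage a mf1) (density_preimage a mf2) indic_eq.
- move=> k; apply: density_fin; by rewrite -[_ @^-1` _]setTI; apply: mf1.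
Qed.

End density_measure.

Section sphere_law.
Context {R : realType}.
Local Notation mu := (@lebesgue_measure R).
Local Notation mu2 := (prodm mu mu).

Section rectangle.
Variables (a b c d : R).
Local Notation D := (`[a, b]%classic `*` `[c, d]%classic).

Lemma measurable_rect :
  measurable (D : set (measurableTypeR R * measurableTypeR R)).
Proof. by apply: measurableX; exact: measurable_itv. Qed.

Lemma bounded_integrable_rect (g : R * R -> R) (M : R) :
  measurable_fun setT (g : measurableTypeR R * measurableTypeR R -> R) ->
  (forall p, `|g p| <= M) -> mu2.-integrable D (EFin \o g).
Proof.
move=> mg gM; apply: measurable_bounded_integrable.
- exact: measurable_rect.
- rewrite [X in (X < _)%E](product_measure1E mu mu); [|exact: measurable_itv|exact: measurable_itv].
  rewrite /= !lebesgue_measure_itv /=; do 2 case: ifP => _; rewrite ?mul0e ?mule0 ?ltry//.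
- exact: measurable_funTS.
- exists M; split; first exact: num_real.
  by move=> x Mx y _; exact: le_trans (gM y) (ltW Mx).
Qed.

Lemma integral_rect_eq0 (g : R * R -> R) (M : R) :
  measurable_fun setT (g : measurableTypeR R * measurableTypeR R -> R) ->
  (forall p, `|g p| <= M) ->
  (forall y, \int[mu]_(x in `[a, b]) (g (x, y))%:E = 0)%E \/
  (forall x, \int[mu]_(y in `[c, d]) (g (x, y))%:E = 0)%E ->
  (\int[mu2]_(p in D) (g p)%:E = 0)%E.
Proof.
move=> mg gM h; have ig := bounded_integrable_rect mg gM.
have {}ig : mu2.-integrable setT ((EFin \o g) \_ D).
  exact/(integrable_mkcond _ measurable_rect).
rewrite integral_mkcond; case: h => h.
- have := integral21_prod_meas1 ig; rewrite /fubini_G => <-.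
  apply: integral0_eq => y _.
  have [yD|yD] := pselect (`[c, d]%classic y).
    rewrite -[RHS](h y) [RHS]integral_mkcond; apply: eq_integral => x _.
    rewrite !patchE; congr (if _ then _ else _).
    by apply/idP/idP => /set_mem h'; apply/mem_set; [case: h'|split].
  apply: integral0_eq => x _; rewrite patchE memNset//.
  by case.
- have := integral12_prod_meas1 ig; rewrite /fubini_F => <-.
  apply: integral0_eq => x _.
  have [xD|xD] := pselect (`[a, b]%classic x).
    rewrite -[RHS](h x) [RHS]integral_mkcond; apply: eq_integral => y _.
    rewrite !patchE; congr (if _ then _ else _).
    by apply/idP/idP => /set_mem h'; apply/mem_set; [case: h'|split].
  apply: integral0_eq => y _; rewrite patchE memNset//.
  by case.
Qed.

End rectangle.

Variable g : R.

(** The scalar product of the unit vectors of spherical coordinates (be, g) and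
(th, ph): the function whose law under the surface measure should depend neither on
be nor on g. *)
Definition pole_dot (be : R) (p : R * R) : R :=
  sin be * sin p.1 * cos (p.2 - g) + cos be * cos p.1.

Let f (be : R) (p : R * R) := pole_dot be p.

Let csin1 : continuous (fun p : R * R => sin p.1).
Proof. by move=> p; apply: continuous_comp; [exact: cvg_fst|exact: continuous_sin]. Qed.

Let ccos1 : continuous (fun p : R * R => cos p.1).
Proof. by move=> p; apply: continuous_comp; [exact: cvg_fst|exact: continuous_cos]. Qed.

Let cp2 : continuous (fun p : R * R => p.2 - g).
Proof. by move=> p; apply: cvgB; [exact: cvg_snd|exact: cvg_cst]. Qed.

Let csin2 : continuous (fun p : R * R => sin (p.2 - g)).
Proof. by move=> p; apply: continuous_comp; [exact: cp2|exact: continuous_sin]. Qed.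

Let ccos2 : continuous (fun p : R * R => cos (p.2 - g)).
Proof. by move=> p; apply: continuous_comp; [exact: cp2|exact: continuous_cos]. Qed.

Let cf be : continuous (f be).
Proof.
move=> p; apply: cvgD; apply: cvgM; [apply: cvgM| | |].
- exact: cvg_cst.
- exact: csin1.
- exact: ccos2.
- exact: cvg_cst.
- exact: ccos1.
Qed.

Section fixed_gumbel.
Variables k a : R.

Let H := gumbel k a.
Let H' (u : R) := k * expR (a - k * u) * gumbel k a u.

Let dH u : is_derive u (1 : R) H (H' u). Proof. exact: is_derive_gumbel. Qed.

Let cH be : continuous (fun p => H (f be p)).
Proof. by move=> p; apply: continuous_comp; [exact: cf|exact: continuous_gumbel]. Qed.

Let cH' be : continuous (fun p => H' (f be p)).
Proof. by move=> p; apply: continuous_comp; [exact: cf|exact: continuous_dgumbel]. Qed.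

Let fth be (p : R * R) := sin be * cos p.1 * cos (p.2 - g) - cos be * sin p.1.
Let fph be (p : R * R) := - (sin be * sin p.1 * sin (p.2 - g)).
Let fbe be (p : R * R) := cos be * sin p.1 * cos (p.2 - g) - sin be * cos p.1.

Let P be p := - (cos (p.2 - g) * cos p.1 * H (f be p))
  - cos (p.2 - g) * sin p.1 * (H' (f be p) * fth be p).
Let Q be p := cos p.1 * cos (p.2 - g) * H (f be p)
  + cos p.1 * sin (p.2 - g) * (H' (f be p) * fph be p).

Let PQ be p : H' (f be p) * fbe be p * sin p.1 = P be p + Q be p.
Proof.
rewrite /P /Q /fbe /fth /fph.
have := cos2Dsin2 (p.2 - g).
move: (H' _) (H _) (cos (p.2 - g)) (sin (p.2 - g)) => h' h c s cs.
apply/eqP; rewrite -subr_eq0.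
rewrite [X in X == _](_ : _ = h' * sin be * sin p.1 * cos p.1 * (c ^+ 2 + s ^+ 2 - 1)); last by ring.
by rewrite cs subrr mulr0.
Qed.

Let is_derive_be be p :
  is_derive be (1 : R) (fun t => H (f t p) * sin p.1) (H' (f be p) * fbe be p * sin p.1).
Proof.
have h1 : is_derive be (1 : R) (fun t => f t p) (fbe be p).
  have := is_deriveDR (is_deriveZR (sin p.1 * cos (p.2 - g)) (is_derive_sin be))
    (is_deriveZR (cos p.1) (is_derive_cos be)).
  rewrite [X in is_derive _ _ X _](_ : _ = (fun t => f t p)); last first.
    by apply/funext => t; rewrite /f /pole_dot; ring.
  by move/is_derive_eq; apply; rewrite /fbe; ring.
have := is_deriveZR (sin p.1) (is_derive_compR (dH _) h1).
rewrite [X in is_derive _ _ X _](_ : _ = (fun t => H (f t p) * sin p.1)); last first.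
  by apply/funext => t; rewrite mulrC.
by move/is_derive_eq; apply; ring.
Qed.

Let is_derive_th be ph (th : R) :
  is_derive th (1 : R) (fun t => - (cos (ph - g)) * (sin t * H (f be (t, ph)))) (P be (th, ph)).
Proof.
have h1 : is_derive th (1 : R) (fun t => f be (t, ph)) (fth be (th, ph)).
  have := is_deriveDR (is_deriveZR (sin be * cos (ph - g)) (is_derive_sin th))
    (is_deriveZR (cos be) (is_derive_cos th)).
  rewrite [X in is_derive _ _ X _](_ : _ = (fun t => f be (t, ph))); last first.
    by apply/funext => t; rewrite /f /pole_dot /=; ring.
  by move/is_derive_eq; apply; rewrite /fth /=; ring.
have := is_deriveZR (- cos (ph - g)) (is_deriveMR (is_derive_sin th) (is_derive_compR (dH _) h1)).
by move/is_derive_eq; apply; rewrite /P /=; ring.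
Qed.

Let is_derive_ph be th (ph : R) :
  is_derive ph (1 : R) (fun t => cos th * (sin (t - g) * H (f be (th, t)))) (Q be (th, ph)).
Proof.
have hs : is_derive ph (1 : R) (fun t => sin (t - g)) (cos (ph - g)).
  have := is_derive_sin_affine 1 (- g) ph; rewrite !mul1r.
  by under eq_fun do rewrite mul1r.
have hc : is_derive ph (1 : R) (fun t => cos (t - g)) (- sin (ph - g)).
  have := is_derive_cos_affine 1 (- g) ph; rewrite !mul1r.
  by under eq_fun do rewrite mul1r.
have h1 : is_derive ph (1 : R) (fun t => f be (th, t)) (fph be (th, ph)).
  have := is_deriveDR (is_deriveZR (sin be * sin th) hc) (is_derive_cst (cos be * cos th) ph (1 : R)).
  by move/is_derive_eq; apply; rewrite /fph /=; ring.
have := is_deriveZR (cos th) (is_deriveMR hs (is_derive_compR (dH _) h1)).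
by move/is_derive_eq; apply; rewrite /Q /=; ring.
Qed.

Let cP be : continuous (P be).
Proof.
move=> p; apply: cvgB.
  apply: cvgN; apply: cvgM; last exact: cH.
  by apply: cvgM; [exact: ccos2|exact: ccos1].
apply: cvgM; first by apply: cvgM; [exact: ccos2|exact: csin1].
apply: cvgM; first exact: cH'.
apply: cvgB; last by apply: cvgM; [exact: cvg_cst|exact: csin1].
apply: cvgM; last exact: ccos2.
by apply: cvgM; [exact: cvg_cst|exact: ccos1].
Qed.

Let cQ be : continuous (Q be).
Proof.
move=> p; apply: cvgD.
  apply: cvgM; last exact: cH.
  by apply: cvgM; [exact: ccos1|exact: ccos2].
apply: cvgM; first by apply: cvgM; [exact: ccos1|exact: csin2].
apply: cvgM; first exact: cH'.
apply: cvgN; apply: cvgM; last exact: csin2.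
by apply: cvgM; [exact: cvg_cst|exact: csin1].
Qed.

Let cb (x y : R) M : 0 <= M -> `|x| <= 1 -> `|y| <= M -> `|x * y| <= M.
Proof. by move=> M0 h1 h2; rewrite normrM -[leRHS]mul1r ler_pM. Qed.

Let H1 u : `|H u| <= 1. Proof. by rewrite ger0_norm ?gumbel_ge0 ?gumbel_le1. Qed.

Let trig2 (x1 x2 x3 x4 x5 : R) : `|x1| <= 1 -> `|x2| <= 1 -> `|x3| <= 1 ->
  `|x4| <= 1 -> `|x5| <= 1 -> `|x1 * x2 * x3 - x4 * x5| <= 2.
Proof.
move=> h1 h2 h3 h4 h5; apply: le_trans (ler_normB _ _) _.
rewrite (_ : 2 = 1 + 1) // lerD//; last exact: cb.
by rewrite -mulrA cb// cb.
Qed.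

Let cb2 (x y z : R) M : 0 <= M -> `|x| <= 1 -> `|y| <= 1 -> `|z| <= M -> `|x * y * z| <= M.
Proof. by move=> M0 h1 h2 h3; rewrite -mulrA; apply: cb => //; exact: cb. Qed.

Let dgumbelM u q : `|q| <= 2 -> `|H' u * q| <= `|k| * 2.
Proof. by move=> hq; rewrite normrM ler_pM ?dgumbel_bounded. Qed.

Let P_bounded be p : `|P be p| <= 1 + `|k| * 2.
Proof.
rewrite /P; apply: le_trans (ler_normB _ _) _; rewrite normrN; apply: lerD.
  by apply: cb2; rewrite ?cos_max ?H1.
apply: cb2; rewrite ?cos_max ?sin_max ?mulr_ge0//.
by apply: dgumbelM; apply: trig2; rewrite ?sin_max ?cos_max.
Qed.

Let Q_bounded be p : `|Q be p| <= 1 + `|k| * 2.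
Proof.
rewrite /Q; apply: le_trans (ler_normD _ _) _; apply: lerD.
  by apply: cb2; rewrite ?cos_max ?H1.
apply: cb2; rewrite ?cos_max ?sin_max ?mulr_ge0//.
apply: dgumbelM; rewrite normrN (@le_trans _ _ 1) ?ler1n//.
by apply: cb2; rewrite ?sin_max.
Qed.

Local Notation D := (`[0, pi]%classic `*` `[0, 2 * pi]%classic).

Let mP be : measurable_fun setT (P be : measurableTypeR R * measurableTypeR R -> R).
Proof. exact: continuous2_measurable (@cP be). Qed.

Let mQ be : measurable_fun setT (Q be : measurableTypeR R * measurableTypeR R -> R).
Proof. exact: continuous2_measurable (@cQ be). Qed.

Let twopi : 2 * pi = pi *+ 2 :> R. Proof. by rewrite mulr_natl. Qed.

Let integral_P be : (\int[mu2]_(p in D) (P be p)%:E = 0)%E.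
Proof.
apply: (integral_rect_eq0 (@mP be) (@P_bounded be)); left => ph.
rewrite (FTC_segment (pi_gt0 R) (fun x _ => is_derive_th be ph x)).
  by rewrite sinpi sin0 !mul0r !mulr0 subr0.
move=> th _; apply: continuous_comp; last exact: cP.
exact: cvg_pair cvg_id (cvg_cst _).
Qed.

Let integral_Q be : (\int[mu2]_(p in D) (Q be p)%:E = 0)%E.
Proof.
apply: (integral_rect_eq0 (@mQ be) (@Q_bounded be)); right => th.
have pp : 0 < 2 * pi :> R by rewrite mulr_gt0// pi_gt0.
rewrite (FTC_segment pp (fun x _ => is_derive_ph be th x)).
  rewrite /f /pole_dot /= twopi [pi *+ 2 - g]addrC sinD2pi cosD2pi sub0r subrr//.
move=> ph _; apply: continuous_comp; last exact: cQ.
exact: cvg_pair (cvg_cst _) cvg_id.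
Qed.

Let integral_dbe be : \int[mu2]_(p in D) (H' (f be p) * fbe be p * sin p.1) = 0.
Proof.
under eq_Rintegral do rewrite PQ.
have iP := bounded_integrable_rect 0 pi 0 (2 * pi) (@mP be) (@P_bounded be).
have iQ := bounded_integrable_rect 0 pi 0 (2 * pi) (@mQ be) (@Q_bounded be).
rewrite RintegralD//; last exact: measurable_rect.
by rewrite /Rintegral integral_P integral_Q addr0.
Qed.

(** The derivative in be of H(w . sigma) sin th is a divergence on the rectangle:
with f = w . sigma, it equals d/dth of - cos (ph - g) sin th H(f) plus d/dph of
cos th sin (ph - g) H(f).  The first boundary term vanishes since sin is zero at 0
and pi, the second by periodicity in ph.  So the integral does not depend on be. *)
Lemma integral_gumbel_pole_dot be :
  (\int[mu2]_(p in D) (gumbel k a (pole_dot be p) * sin p.1)%:E =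
   \int[mu2]_(p in D) (gumbel k a (pole_dot 0 p) * sin p.1)%:E)%E.
Proof.
have mH b : measurable_fun setT ((fun p => H (f b p) * sin p.1) :
    measurableTypeR R * measurableTypeR R -> R).
  by apply: continuous2_measurable => p; apply: cvgM; [exact: cH|exact: csin1].
have bH b p : `|H (f b p) * sin p.1| <= 1 by rewrite cb ?sin_max.
have iH b := bounded_integrable_rect 0 pi 0 (2 * pi) (mH b) (bH b).
have bd b p : `|H' (f b p) * fbe b p * sin p.1| <= `|k| * 2.
  rewrite mulrC; apply: cb; rewrite ?sin_max ?mulr_ge0//.
  by apply: dgumbelM; apply: trig2; rewrite ?sin_max ?cos_max.
have d1 b p : (fun t => H (f t p) * sin p.1)^`()%classic b = H' (f b p) * fbe b p * sin p.1.
  by rewrite derive1E; case: (is_derive_be b p).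
pose J b := \int[mu2]_(p in D) (H (f b p) * sin p.1).
suff dJ (b : R) : is_derive b (1 : R) J 0.
  have := is_derive_0_is_cst be 0 dJ; rewrite /J /Rintegral.
  have fn c : (\int[mu2]_(p in D) (H (f c p) * sin p.1)%:E)%E \is a fin_num.
    by apply: integrable_fin_num; [exact: measurable_rect|exact: iH].
  by move: (fn be) (fn 0); rewrite /H /f; case: integral => // x; case: integral => // y _ _ /= ->.
have Ib : `](b - 1), (b + 1)[%classic b.
  by rewrite /= in_itv /= ltrBlDr !ltrDl ltr01.
have der x y : `](b - 1), (b + 1)[%classic x -> D y ->
    derivable (fun t => H (f t y) * sin y.1) x 1.
  by move=> _ _; case: (is_derive_be x y).
have ub x y : `](b - 1), (b + 1)[%classic x -> D y ->
    `|(fun t => H (f t y) * sin y.1)^`()%classic x| <= `|k| * 2.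
  by move=> _ _; rewrite d1.
have icst : mu2.-integrable D (EFin \o (fun=> `|k| * 2)).
  by apply: (@bounded_integrable_rect _ _ _ _ _ (`|k| * 2)) => // p; rewrite ger0_norm ?mulr_ge0.
have kge0 (p : R * R) : 0 <= `|k| * 2 by rewrite mulr_ge0.
have dJ := @derivable_under_integral R _ _ mu2 (fun b p => H (f b p) * sin p.1) D
  (measurable_rect _ _ _ _) b _ _ Ib (fun x _ => iH x) der (fun=> `|k| * 2) kge0 icst ub.
have eJ := @differentiation_under_integral R _ _ mu2 (fun b p => H (f b p) * sin p.1) D
  (measurable_rect _ _ _ _) b _ _ Ib (fun x _ => iH x) der (fun=> `|k| * 2) kge0 icst ub.
apply: DeriveDef; first exact: dJ.
rewrite -derive1E eJ -[RHS](integral_dbe b).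
by apply: eq_Rintegral => p _; exact: (d1 b p).
Qed.

End fixed_gumbel.

Local Notation D := (`[0, pi]%classic `*` `[0, 2 * pi]%classic).

Lemma ge0_integral_pole_dot be (h : R -> R) : measurable_fun setT h ->
  (forall u, 0 <= h u) ->
  (\int[mu2]_(p in D) (h (pole_dot be p) * sin p.1)%:E =
   \int[mu2]_(p in D) (h (cos p.1) * sin p.1)%:E)%E.
Proof.
move=> mh h0.
transitivity (\int[mu2]_(p in D) (h (pole_dot 0 p) * sin p.1)%:E)%E; last first.
  by apply: eq_integral => p _; rewrite /pole_dot sin0 cos0 !mul0r mul1r add0r.
have ms : measurable_fun setT ((fun p => sin p.1) : measurableTypeR R * measurableTypeR R -> R).
  exact: continuous2_measurable csin1.
have ws : measurable_fun D ((fun p => sin p.1) : measurableTypeR R * measurableTypeR R -> R).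
  exact: measurable_funTS.
have s0 (p : measurableTypeR R * measurableTypeR R) : D p -> 0 <= sin p.1.
  by move=> [/= h1 _]; apply: sin_ge0_pi; move: h1; rewrite in_itv /= => ->.
have is_ : mu2.-integrable D (EFin \o (fun p => sin p.1)).
  by apply: (@bounded_integrable_rect _ _ _ _ _ 1) => // p; exact: sin_max.
have mf (c : R) : measurable_fun setT (pole_dot c : measurableTypeR R * measurableTypeR R -> R).
  exact: continuous2_measurable (@cf c).
exact: (ge0_integral_law_eq (measurable_rect _ _ _ _) ws s0 is_ (mf be) (mf 0)
  (fun k a => integral_gumbel_pole_dot k a be) mh h0).
Qed.

End sphere_law.

Section sphere_law_unit.
Context {R : realType}.
Local Notation mu := (@lebesgue_measure R).
Local Notation mu2 := (prodm mu mu).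
Local Notation D := (`[0, pi]%classic `*` `[0, 2 * pi]%classic).

Lemma unit_circle_angle (a b : R) : a ^+ 2 + b ^+ 2 = 1 ->
  exists g, a = cos g /\ b = sin g.
Proof.
move=> ab; have b0 := sqr_ge0 b.
have a1 : -1 <= a <= 1 by apply/andP; split; nra.
have [h|h] := leP 0 b; [exists (acos a)|exists (- acos a)].
  rewrite acosK ?in_itv//= sin_acos// (_ : 1 - a ^+ 2 = b ^+ 2); last by rewrite -ab; ring.
  by rewrite sqrtr_sqr ger0_norm.
rewrite cosN sinN acosK ?in_itv//= sin_acos// (_ : 1 - a ^+ 2 = b ^+ 2); last by rewrite -ab; ring.
by rewrite sqrtr_sqr ltr0_norm// opprK.
Qed.

Lemma unit_spherical (w : vec3 R) : dot w w = 1 -> exists be g, w = spherical (be, g).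
Proof.
case: w => [[x y] z]; rewrite /dot /= => h.
have z1 : -1 <= z <= 1 by apply/andP; split; nra.
set s := Num.sqrt (1 - z ^+ 2).
have s2 : s ^+ 2 = x ^+ 2 + y ^+ 2.
  rewrite sqr_sqrtr; first by rewrite -h; ring.
  by case/andP: z1 => *; nra.
have [s0|s0] := eqVneq s 0.
  exists (acos z), 0; rewrite /spherical /= acosK ?in_itv//= sin_acos// -/s s0 !mul0r.
  move: s2; rewrite s0 expr0n /= => /esym/eqP.
  by rewrite paddr_eq0 ?sqr_ge0// !sqrf_eq0 => /andP[/eqP -> /eqP ->].
have [g [hc hs]] : exists g, x / s = cos g /\ y / s = sin g.
  by apply: unit_circle_angle; rewrite !expr_div_n -mulrDl -s2 divff// expf_neq0.
exists (acos z), g; rewrite /spherical /= acosK ?in_itv//= sin_acos// -/s -hc -hs.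
by rewrite !(mulrC s) !divfK.
Qed.

Lemma integral_rect_fst (k : R -> R) : measurable_fun setT k ->
  (forall t, t \in `[0, pi : R] -> 0 <= k t) ->
  (\int[mu2]_(p in D) (k p.1)%:E = (2 * pi)%:E * \int[mu]_(t in `[0%R, pi]%classic) (k t)%:E)%E.
Proof.
move=> mk k0.
pose k' := k \_ `[0, pi]%classic.
pose u := (\1_(`[0, 2 * pi]%classic) : R -> R).
have mk' : measurable_fun setT k' by apply/(measurable_restrictT k) => //; exact: measurable_funTS.
have mu_ : measurable_fun setT u by exact: measurable_indic.
have k'0 t : 0 <= k' t.
  by rewrite /k' patchE; case: ifPn => // /set_mem /= h; exact: k0.
rewrite integral_mkcond.
transitivity (\int[mu2]_p (k' p.1 * u p.2)%:E)%E.
  apply: eq_integral => -[x y] _; rewrite /k' /u indicE !patchE /=.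
  rewrite (_ : ((x, y) \in D) = (x \in `[0, pi]%classic) && (y \in `[0, 2 * pi]%classic)).
    by case: (x \in _); case: (y \in _); rewrite /= ?mulr1 ?mulr0 ?mul0r.
  by rewrite in_setX.
rewrite [LHS]integral_tensor// muleC; congr mule.
- rewrite /u integral_indic// setIT [LHS]lebesgue_measure_itv /= lte_fin mulr_gt0 ?pi_gt0//.
  by rewrite sube0.
- rewrite [RHS]integral_mkcond; apply: eq_integral => t _.
  by rewrite /k' !patchE; case: ifP.
Qed.

(** The law of w . sigma is the one obtained for w at the pole, where
w . sigma = cos th. *)
Theorem ge0_sphere_law (w : vec3 R) (h : R -> R) : dot w w = 1 ->
  measurable_fun setT h -> (forall u, 0 <= h u) ->
  (\int[mu2]_(p in D) (h (dot w (spherical p)) * sin p.1)%:E =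
   (2 * pi)%:E * \int[mu]_(t in `[0%R, pi]%classic) (h (cos t) * sin t)%:E)%E.
Proof.
move=> /unit_spherical [be [g ->]] mh h0.
transitivity (\int[mu2]_(p in D) (h (pole_dot g be p) * sin p.1)%:E)%E.
  apply: eq_integral => p _; congr (_ * _)%:E; congr h.
  by rewrite /dot /spherical /pole_dot /= cosB; ring.
rewrite ge0_integral_pole_dot//.
apply: (@integral_rect_fst (fun t => h (cos t) * sin t)).
- apply: measurable_funM.
    apply: (measurableT_comp mh).
    by apply: continuous_measurable_fun; exact: continuous_cos.
  by apply: continuous_measurable_fun; exact: continuous_sin.
- by move=> t; rewrite in_itv /= => ht; rewrite mulr_ge0// sin_ge0_pi.
Qed.

End sphere_law_unit.

(** * Characteristic functions *)

Section modulus.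
Context {R : realType}.
Implicit Types z w : R[i].

Lemma cabs_ge0 z : 0 <= cabs z.
Proof. by case: z => a b; exact: sqrtr_ge0. Qed.

Lemma sqr_cabs z : cabs z ^+ 2 = complex.Re z ^+ 2 + complex.Im z ^+ 2.
Proof. by case: z => a b /=; rewrite /cabs /= sqr_sqrtr// addr_ge0// sqr_ge0. Qed.

Lemma cabsM z w : cabs (z * w) = cabs z * cabs w.
Proof. exact: ComplexField.Normc.normcM. Qed.

Lemma le_cabsD z w : cabs (z + w) <= cabs z + cabs w.
Proof. exact: le_normcD. Qed.

Lemma normr_Re_le z : `|complex.Re z| <= cabs z.
Proof.
rewrite -ler_sqr ?nnegrE ?cabs_ge0// sqr_cabs real_normK ?num_real//.
by rewrite lerDl sqr_ge0.
Qed.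

Lemma normr_Im_le z : `|complex.Im z| <= cabs z.
Proof.
rewrite -ler_sqr ?nnegrE ?cabs_ge0// sqr_cabs real_normK ?num_real//.
by rewrite lerDr sqr_ge0.
Qed.

Lemma re_conjM_le z w :
  complex.Re z * complex.Re w + complex.Im z * complex.Im w <= cabs z * cabs w.
Proof.
apply: le_trans (ler_norm _) _.
rewrite -ler_sqr ?nnegrE ?mulr_ge0 ?cabs_ge0// real_normK ?num_real//.
rewrite exprMn !sqr_cabs.
set a := complex.Re z; set b := complex.Im z; set c := complex.Re w; set d := complex.Im w.
rewrite -subr_ge0 (_ : _ - _ = (a * d - b * c) ^+ 2); last by ring.
exact: sqr_ge0.
Qed.

End modulus.

Section dot_theory.
Context {R : realType}.
Implicit Types x y z : vec3 R.

Lemma dotC x y : dot x y = dot y x.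
Proof. by rewrite /dot; ring. Qed.

Lemma dotNl x y : dot (- x) y = - dot x y.
Proof. by rewrite /dot /=; ring. Qed.

Lemma dotZl (k : R) x y : dot (k *: x) y = k * dot x y.
Proof. by rewrite /dot /= /GRing.scale /=; ring. Qed.

Lemma enorm0 : enorm (0 : vec3 R) = 0.
Proof. by rewrite /enorm /dot /= !mulr0 !addr0 sqrtr0. Qed.

Lemma enormN x : enorm (- x) = enorm x.
Proof. by rewrite /enorm dotNl dotC dotNl opprK. Qed.

Lemma enorm_gt0 x : x != 0 -> 0 < enorm x.
Proof.
move=> x0; rewrite lt_neqAle enorm_ge0 andbT eq_sym; apply: contra x0 => /eqP e.
have := sqr_enorm x; rewrite e expr0n /= /dot -!expr2 => /esym/eqP.
rewrite paddr_eq0 ?addr_ge0 ?sqr_ge0// paddr_eq0 ?sqr_ge0// !sqrf_eq0.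
by case: x {e} => [[a b] c] /= /andP[/andP[/eqP -> /eqP ->] /eqP ->].
Qed.

Lemma continuous_dot (f g : vec3 R -> vec3 R) : continuous f -> continuous g ->
  continuous (fun x => dot (f x) (g x)).
Proof.
move=> cf cg x.
have c1 (h : vec3 R -> vec3 R) : continuous h -> continuous (fun x => (h x).1.1).
  by move=> ch y; apply: (cvg_comp (fun x => (h x).1) fst); [apply: (cvg_comp h fst); [exact: ch|exact: cvg_fst]|exact: cvg_fst].
have c2 (h : vec3 R -> vec3 R) : continuous h -> continuous (fun x => (h x).1.2).
  by move=> ch y; apply: (cvg_comp (fun x => (h x).1) snd); [apply: (cvg_comp h fst); [exact: ch|exact: cvg_fst]|exact: cvg_snd].
have c3 (h : vec3 R -> vec3 R) : continuous h -> continuous (fun x => (h x).2).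
  by move=> ch y; apply: (cvg_comp h snd); [exact: ch|exact: cvg_snd].
by apply: cvgD; [apply: cvgD|]; apply: cvgM; (exact: c1 || exact: c2 || exact: c3).
Qed.

Lemma continuous_enorm : continuous (@enorm R).
Proof.
move=> x; apply: continuous_comp; last exact: sqrt_continuous.
by apply: (@continuous_dot id id) => y; exact: cvg_id.
Qed.

End dot_theory.

Section characteristic_function.
Context {R : realType}.
Variable P : probability (mvec3 R) R.

Let bounded_integrable (g : mvec3 R -> R) (M : R) : measurable_fun setT g ->
  (forall v, `|g v| <= M) -> P.-integrable setT (EFin \o g).
Proof.
move=> mg gM.
have h : P.-integrable setT (EFin \o cst M) by apply: finite_measure_integrable_cst.
apply: (le_integrable measurableT _ _ h) => //; first exact/measurable_EFinP.
by move=> v _ /=; rewrite lee_fin (le_trans (gM v))// ler_norm.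
Qed.

Let Rintegral_cstP (c : R) : Rintegral P setT (fun=> c) = c.
Proof. by rewrite Rintegral_cst// [X in fine X]probability_setT mulr1. Qed.

(** The variance of a bounded variable is nonnegative. *)
Lemma sqr_mean_le (g : mvec3 R -> R) (M : R) : measurable_fun setT g ->
  (forall v, `|g v| <= M) ->
  Rintegral P setT g ^+ 2 <= Rintegral P setT (fun v => g v ^+ 2).
Proof.
move=> mg gM; set m := Rintegral P setT g.
have M0 : 0 <= M by exact: le_trans (normr_ge0 _) (gM 0).
have ig := bounded_integrable mg gM.
have mg2 : measurable_fun setT (fun v => g v ^+ 2) by exact: measurable_funX.
have ig2 : P.-integrable setT (EFin \o (fun v => g v ^+ 2)).
  by apply: (bounded_integrable mg2 (M := M ^+ 2)) => v; rewrite normrX lerXn2r ?nnegrE.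
have ilin : P.-integrable setT (EFin \o (fun v => 2 * m * g v)).
  by apply: (bounded_integrable (M := `|2 * m| * M)) => [|v]; [exact: measurable_funM|
    rewrite normrM ler_wpM2l].
have icst : P.-integrable setT (EFin \o (fun=> m ^+ 2)).
  exact: finite_measure_integrable_cst.
have i1 : P.-integrable setT (EFin \o (fun v => g v ^+ 2 - 2 * m * g v)).
  have := integrableB measurableT ig2 ilin; apply: eq_integrable => // v _.
have e : Rintegral P setT (fun v => (g v - m) ^+ 2) =
    Rintegral P setT (fun v => g v ^+ 2) - 2 * m * m + m ^+ 2.
  under eq_Rintegral => v _ do rewrite sqrrB -mulr_natl (mulrC (g v) m) mulrA.
  rewrite (RintegralD measurableT i1 icst) (RintegralB measurableT ig2 ilin) RintegralZl//.
  by rewrite Rintegral_cstP.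
have : 0 <= Rintegral P setT (fun v => (g v - m) ^+ 2).
  by apply: Rintegral_ge0 => v _; exact: sqr_ge0.
by rewrite e; nra.
Qed.

Lemma sqr_mean2_le (g h k : mvec3 R -> R) (M : R) :
  measurable_fun setT g -> measurable_fun setT h ->
  (forall v, `|g v| <= M) -> (forall v, `|h v| <= M) ->
  (forall v, g v ^+ 2 + h v ^+ 2 = k v) ->
  Rintegral P setT g ^+ 2 + Rintegral P setT h ^+ 2 <= Rintegral P setT k.
Proof.
move=> mg mh gM hM ghk.
have M0 : 0 <= M by exact: le_trans (normr_ge0 _) (gM 0).
have i2 (f : mvec3 R -> R) : measurable_fun setT f -> (forall v, `|f v| <= M) ->
    P.-integrable setT (EFin \o (fun v => f v ^+ 2)).
  move=> mf fM; apply: (bounded_integrable (M := M ^+ 2)); first exact: measurable_funX.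
  by move=> v; rewrite normrX lerXn2r ?nnegrE.
under [leRHS]eq_Rintegral => v _ do rewrite -ghk.
rewrite (RintegralD measurableT (i2 g mg gM) (i2 h mh hM)).
exact: lerD (sqr_mean_le mg gM) (sqr_mean_le mh hM).
Qed.

Let A (c : R) (xi : vec3 R) := Rintegral P setT (fun v => cos (dot v xi + c)).

Let Re_charfun xi : complex.Re (charfun P xi) = A 0 xi.
Proof. by apply: eq_Rintegral => v _; rewrite /= cosN addr0. Qed.

Let Im_charfun xi : complex.Im (charfun P xi) = A (pi / 2) xi.
Proof. by apply: eq_Rintegral => v _; rewrite /= cosDpihalf sinN. Qed.

Let sin_shift (x : R) : cos (x + pi / 2) = - sin x.
Proof. exact: cosDpihalf. Qed.

Lemma charfun0 : charfun P 0 = 1.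
Proof.
have d0 v : dot v (0 : vec3 R) = 0 by rewrite /dot /= !mulr0 !addr0.
apply/eqP; rewrite eq_complex Re_charfun Im_charfun /A.
under eq_Rintegral => v _ do rewrite d0 addr0 cos0.
under [X in _ && (X == _)]eq_Rintegral => v _ do rewrite d0 sin_shift sin0 oppr0.
by rewrite !Rintegral_cstP !eqxx.
Qed.

Lemma cabs_charfun_le1 xi : cabs (charfun P xi) <= 1.
Proof.
rewrite -(@ler_sqr _ _ 1) ?nnegrE ?cabs_ge0// sqr_cabs Re_charfun Im_charfun expr1n.
rewrite -[leRHS]Rintegral_cstP.
apply: (@sqr_mean2_le _ _ _ 1); try exact: measurable_cos_dot.
- by move=> v; exact: cos_max.
- by move=> v; exact: cos_max.
- by move=> v; rewrite addr0 sin_shift sqrrN cos2Dsin2.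
Qed.

(** Cauchy-Schwarz for the difference of the two exponentials, whose squared
modulus is 2 - 2 cos (v . (a - b)). *)
Lemma sqr_cabs_charfunB_le a b :
  cabs (charfun P a - charfun P b) ^+ 2 <= 2 * (1 - complex.Re (charfun P (a - b))).
Proof.
have ic c xi : P.-integrable setT (EFin \o (fun v : mvec3 R => cos (dot v xi + c))).
  by apply: (bounded_integrable (measurable_cos_dot _ _) (M := 1)) => v; exact: cos_max.
have i1 : P.-integrable setT (EFin \o (fun=> 1 : R)).
  exact: finite_measure_integrable_cst.
have AB c : A c a - A c b = Rintegral P setT (fun v => cos (dot v a + c) - cos (dot v b + c)).
  by rewrite (RintegralB measurableT (ic c a) (ic c b)).
rewrite sqr_cabs.
have -> : complex.Re (charfun P a - charfun P b) = A 0 a - A 0 b.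
  by rewrite -!Re_charfun; case: (charfun P a) => ? ?; case: (charfun P b).
have -> : complex.Im (charfun P a - charfun P b) = A (pi / 2) a - A (pi / 2) b.
  by rewrite -!Im_charfun; case: (charfun P a) => ? ?; case: (charfun P b).
rewrite !AB Re_charfun.
have -> : 2 * (1 - A 0 (a - b)) =
    Rintegral P setT (fun v => 2 * (1 - cos (dot v (a - b) + 0))).
  rewrite RintegralZl//; last first.
    have := integrableB measurableT i1 (ic 0 (a - b)); exact: eq_integrable.
  by rewrite (RintegralB measurableT i1 (ic 0 (a - b))) Rintegral_cstP.
have cm c : measurable_fun setT
    ((fun v => cos (dot v a + c) - cos (dot v b + c)) : mvec3 R -> R).
  by apply: measurable_funB; exact: measurable_cos_dot.
have cb c v : `|cos (dot v a + c) - cos (dot v b + c)| <= 2.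
  by rewrite (le_trans (ler_normB _ _))// (_ : 2 = 1 + 1)// lerD ?cos_max.
apply: (@sqr_mean2_le _ _ _ 2) => // v.
rewrite !addr0 !sin_shift (_ : dot v (a - b) = dot v a - dot v b); last first.
  by rewrite /dot /=; ring.
rewrite cosB.
have := cos2Dsin2 (dot v a); have := cos2Dsin2 (dot v b).
by nra.
Qed.

End characteristic_function.

Section charKalpha_theory.
Context {R : realType}.
Implicit Types (alpha : R) (phi chi : vec3 R -> R[i]).

Lemma charK0 phi : charK phi -> phi 0 = 1.
Proof. by case=> P ->; exact: charfun0. Qed.

Lemma charK_le1 phi xi : charK phi -> cabs (phi xi) <= 1.
Proof. by case=> P ->; exact: cabs_charfun_le1. Qed.

(** Regularity at the origin controls the modulus of continuity everywhere: this
is the source of continuity in xi. *)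
Lemma charK_sub_le phi a b : charK phi ->
  cabs (phi a - phi b) ^+ 2 <= 2 * cabs (phi (a - b) - 1).
Proof.
case=> P e; rewrite !e; apply: le_trans (sqr_cabs_charfunB_le _ _ _) _.
rewrite ler_pM2l//; apply: le_trans (normr_Re_le _); rewrite -normrN.
apply: le_trans (ler_norm _); rewrite le_eqVlt; apply/orP; left; apply/eqP.
by case: (charfun P (a - b)) => x y /=; ring.
Qed.

(** The equality at 0 covers the point that the supremum leaves out. *)
Lemma dist_alpha_le alpha phi chi (C : R) xi : 0 < alpha -> phi 0 = chi 0 ->
  (dist_alpha alpha phi chi <= C%:E)%E ->
  cabs (phi xi - chi xi) <= C * enorm xi `^ alpha.
Proof.
move=> a0 e0 hC; have [->|x0] := eqVneq xi 0.
  by rewrite e0 subrr /cabs /= expr0n /= addr0 sqrtr0 enorm0 powR0 ?mulr0// gt_eqF.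
have p0 : 0 < enorm xi `^ alpha by apply: powR_gt0; exact: enorm_gt0.
rewrite -ler_pdivrMr// -lee_fin; apply: le_trans hC.
by apply: ereal_sup_ubound; exists xi.
Qed.

Lemma charKalpha_bound alpha phi : 0 < alpha -> charKalpha alpha phi ->
  exists2 C : R, 0 <= C & forall xi, cabs (phi xi - 1) <= C * enorm xi `^ alpha.
Proof.
move=> a0 [K fin]; set d := dist_alpha _ _ _ in fin.
pose C := Num.max 0 (fine d).
have dC : (d <= C%:E)%E.
  rewrite /C; move: fin; case: (d) => [x| |] //=; last by rewrite leNye.
  by rewrite lee_fin le_max lexx orbT.
exists C; first by rewrite le_max lexx.
by move=> xi; apply: (@dist_alpha_le _ _ (fun=> 1)) => //; exact: charK0.
Qed.

(** phi(a) phi(b) - phi(a + b) = phi(a) (phi(b) - 1) + (phi(a) - phi(a + b)), and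
both terms are small when b is small. *)
Lemma charK_product_le phi a b (C alpha : R) : charK phi -> 0 <= C ->
  (forall xi, cabs (phi xi - 1) <= C * enorm xi `^ alpha) ->
  cabs (phi a * phi b - phi (a + b)) <=
    C * enorm b `^ alpha + Num.sqrt (2 * C * enorm b `^ alpha).
Proof.
move=> K C0 hC.
rewrite (_ : _ - _ = phi a * (phi b - 1) + (phi a - phi (a + b))); last by ring.
apply: le_trans (le_cabsD _ _) _; apply: lerD.
  rewrite cabsM -[leRHS]mul1r; apply: ler_pM; rewrite ?cabs_ge0//.
  exact: charK_le1.
rewrite -ler_sqr ?nnegrE ?cabs_ge0 ?sqrtr_ge0// sqr_sqrtr ?mulr_ge0 ?powR_ge0//.
apply: le_trans (charK_sub_le _ _ K) _.
rewrite -mulrA ler_pM2l// (_ : a - (a + b) = - b); last by rewrite opprD addrA subrr sub0r.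
by rewrite -(enormN b).
Qed.

End charKalpha_theory.

(** * Angular integrals of a Debye-Yukawa kernel *)

Section trigonometric_bounds.
Context {R : realType}.
Implicit Types x t : R.

Lemma le_of_derive (F f : R -> R) (a b : R) : a <= b ->
  (forall x : R, is_derive x (1 : R) F (f x)) ->
  (forall x, a <= x <= b -> 0 <= f x) -> F a <= F b.
Proof.
move=> ab dF f0.
have cF : {within `[a, b], continuous F}.
  apply/continuous_subspaceT => x; apply/differentiable_continuous/derivable1_diffP.
  by case: (dF x).
have [c cab e] := @MVT_segment R F f a b ab (fun x _ => dF x) cF.
by rewrite -subr_ge0 e mulr_ge0// ?subr_ge0// f0.
Qed.

Lemma sin_le_id x : 0 <= x -> sin x <= x.
Proof.
move=> x0; rewrite -subr_ge0.
have dF y : is_derive y (1 : R) (fun x => x - sin x) (1 - cos y) by exact: is_deriveB.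
have f0 y : 0 <= y <= x -> 0 <= 1 - cos y by move=> _; rewrite subr_ge0 cos_le1.
by have := le_of_derive x0 dF f0; rewrite sin0 subrr.
Qed.

Lemma one_sub_cos_le_sqr x : 0 <= x -> 1 - cos x <= x ^+ 2.
Proof.
move=> x0; rewrite -subr_ge0.
have dF y : is_derive y (1 : R) (fun x => x * x - (1 - cos x))
    (y * 1 + y * 1 - (0 - - sin y)).
  by apply: is_deriveB; exact: (@is_deriveMR R id id).
have f0 y : 0 <= y <= x -> 0 <= y * 1 + y * 1 - (0 - - sin y).
  by move=> /andP[y0 _]; have := sin_le_id y0; rewrite mulr1; lra.
by have := le_of_derive x0 dF f0; rewrite cos0 mulr0 !subrr expr2.
Qed.

(** Both follow from cos >= 1 / 2 near 0, by integration. *)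
Lemma trig_lower_bounds : exists d : R, 0 < d /\ forall x, 0 <= x <= d ->
  x / 2 <= sin x /\ x ^+ 2 / 4 <= 1 - cos x.
Proof.
have [d d0 hd] : exists2 d : R, 0 < d & forall x, 0 <= x <= d -> 2^-1 <= cos x.
  have /cvgrPdist_le/(_ 2^-1) := @continuous_cos R 0.
  rewrite invr_gt0 ltr0n cos0 => /(_ isT) /nbhs_ballP[e /= e0 he].
  exists (e / 2); first by rewrite divr_gt0.
  move=> x /andP[x0 xe]; have : ball (0 : R) e x.
    by rewrite /ball /= sub0r normrN ger0_norm// (le_lt_trans xe)// ltr_pdivrMr// ltr_pMr// ltr1n.
  by move=> /he /=; have := cos_le1 x; move=> h; rewrite ger0_norm ?subr_ge0//; lra.
exists d; split => // x /andP[x0 xd].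
have S y : 0 <= y <= d -> y / 2 <= sin y.
  move=> /andP[y0 yd]; rewrite -subr_ge0.
  have dF z : is_derive z (1 : R) (fun x => sin x - 2^-1 * x) (cos z - 2^-1 * 1).
    by apply: is_deriveB; exact: (@is_deriveZR _ id).
  have f0 z : 0 <= z <= y -> 0 <= cos z - 2^-1 * 1.
    by move=> /andP[z0 zy]; rewrite mulr1 subr_ge0 hd// z0 (le_trans zy).
  by have := le_of_derive y0 dF f0; rewrite sin0 mulr0 subrr (mulrC y).
split; first by apply: S; rewrite x0.
rewrite -subr_ge0.
have dF z : is_derive z (1 : R) (fun x => (1 - cos x) - 4^-1 * (x * x))
    ((0 - - sin z) - 4^-1 * (z * 1 + z * 1)).
  apply: is_deriveB; apply: is_deriveZR; exact: (@is_deriveMR R id id).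
have f0 z : 0 <= z <= x -> 0 <= (0 - - sin z) - 4^-1 * (z * 1 + z * 1).
  move=> /andP[z0 zx]; have : z / 2 <= sin z by apply: S; rewrite z0 (le_trans zx).
  by rewrite mulr1; lra.
by have := le_of_derive x0 dF f0; rewrite cos0 !mulr0 !subrr expr2 (mulrC (x * x)).
Qed.

End trigonometric_bounds.

Section integrals_of_powers.
Context {R : realType}.
Local Notation mu := (@lebesgue_measure R).

Lemma FTC_gt0 (F f : R -> R) (a b : R) : 0 < a -> a < b ->
  (forall x : R, 0 < x -> is_derive x (1 : R) F (f x)) ->
  (forall x : R, 0 < x -> {for x, continuous f}) ->
  (\int[mu]_(x in `[a, b]) (f x)%:E = (F b - F a)%:E)%E.
Proof.
move=> a0 ab dF cf; have pos x : a <= x <= b -> 0 < x.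
  by move=> /andP[h _]; exact: lt_le_trans h.
by rewrite (FTC_segment ab (fun x h => dF x (pos x h)) (fun x h => cf x (pos x h))).
Qed.

Lemma is_derive_expR_ln (k x : R) : 0 < x ->
  is_derive x (1 : R) (fun t => expR (k * ln t)) (k * expR (k * ln x) / x).
Proof.
move=> x0; rewrite [X in is_derive _ _ _ X](_ : _ = expR (k * ln x) * (k * x^-1)); last by ring.
apply: (@is_derive_compR R expR (fun t => k * ln t)).
by apply: is_deriveZR; exact: is_derive1_ln.
Qed.

Lemma continuous_expR_ln (k x : R) : 0 < x ->
  {for x, continuous (fun t => k * expR (k * ln t) / t)}.
Proof.
move=> x0; apply: cvgM; last by apply: cvgV; [exact: lt0r_neq0|exact: cvg_id].
apply: cvgM; first exact: cvg_cst.
apply: continuous_comp; last exact: continuous_expR.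
by apply: cvgM; [exact: cvg_cst|exact: continuous_ln].
Qed.

(** The integrand is k x^(k - 1), written with exp and ln; its primitive x^k is
bounded near 0. *)
Lemma integral_expR_ln_lty (k a : R) : 0 < k -> 0 < a ->
  (\int[mu]_(x in `]0%R, a]%classic) (k * expR (k * ln x) / x)%:E < +oo)%E.
Proof.
move=> k0 a0; pose f x := k * expR (k * ln x) / x.
pose F (n : nat) := `[a / n.+2%:R, a]%classic.
have aN (n : nat) : 0 < a / n.+2%:R by rewrite divr_gt0.
have <- : \bigcup_n F n = `]0, a]%classic.
  apply/seteqP; split => [x [n _]|x]; rewrite /F /= !in_itv /= => /andP[h1 h2].
    by rewrite h2 (lt_le_trans _ h1).
  have [n nx] : exists n : nat, a / n.+2%:R <= x.
    exists (Num.bound (a / x)); rewrite ler_pdivrMr// mulrC -ler_pdivrMr//.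
    apply: ltW; apply: lt_trans (archi_boundP _) _; first by rewrite divr_ge0 ?ltW.
    by rewrite ltr_nat.
  by exists n => //=; rewrite in_itv /= nx.
have mf (i : nat) : measurable_fun (F i) (f : R -> R).
  apply: subspace_continuous_measurable_fun; first exact: measurable_itv.
  apply: continuous_in_subspaceT => x; rewrite inE /F /= in_itv /= => /andP[h _].
  by apply: continuous_expR_ln; exact: lt_le_trans h.
have f0 (i : nat) x : F i x -> (0 <= (f x)%:E)%E.
  rewrite /F /= in_itv /= => /andP[h _]; rewrite lee_fin /f.
  by rewrite divr_ge0 ?mulr_ge0 ?expR_ge0 ?(ltW k0)// (le_trans _ h)// ltW.
have nF : nondecreasing_seq F.
  apply/nondecreasing_seqP => n; rewrite subsetEset => x; rewrite /F /= !in_itv /= => /andP[h ->].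
  by rewrite andbT (le_trans _ h)// ler_pM2l// lef_pV2 ?posrE// ler_nat.
have C := @ge0_nondecreasing_set_cvg_integral _ (measurableTypeR R) R F (fun x => (f x)%:E) mu nF
  (fun i => measurable_itv _) (fun i => proj2 (measurable_EFinP _ _) (mf i)) f0.
apply: (@le_lt_trans _ _ (expR (k * ln a))%:E); last exact: ltry.
rewrite -(cvg_lim _ C)//; apply: lime_le; first by apply/cvg_ex; eexists; exact: C.
have aNa n : a / n.+2%:R < a by rewrite ltr_pdivrMr// ltr_pMr// ltr1n.
apply: nearW => n; rewrite (FTC_gt0 (aN n) (aNa n) (fun x => @is_derive_expR_ln k x)
  (fun x => @continuous_expR_ln k x)).
by rewrite lee_fin gerBl expR_ge0.
Qed.

End integrals_of_powers.

Section debye_yukawa_kernel.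
Context {R : realType}.
Variables (s : R) (b : R -> R).
Hypotheses (hs : 0 < s < 2) (hb : collision_kernel b) (hbs : debye_yukawa s b).
Local Notation mu := (@lebesgue_measure R).

(** The kernel, set to 0 off [-1, 1), so that it is measurable and nonnegative on
the whole line. *)
Definition kernel_ext : R -> R := b \_ `[-1, 1[%classic.
Local Notation b' := kernel_ext.

Lemma kernel_extE (u : R) : -1 <= u < 1 -> b' u = b u.
Proof. by move=> h; rewrite /kernel_ext patchE mem_set//= in_itv. Qed.

Lemma measurable_kernel_ext : measurable_fun setT b'.
Proof.
by case: hb => mb _ _; apply/(measurable_restrictT b).
Qed.

Lemma kernel_ext_ge0 (u : R) : 0 <= b' u.
Proof.
case: hb => _ b0 _; rewrite /kernel_ext patchE; case: ifPn => // /set_mem h.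
exact: b0.
Qed.

Lemma kernel_ext_lt0 (u : R) : u < 0 -> b' u = 0.
Proof.
case: hb => _ _ bN u0; rewrite /kernel_ext patchE; case: ifPn => // /set_mem /=.
by rewrite in_itv /= => /andP[h _]; rewrite bN// in_itv /= h.
Qed.

Lemma kernel_ext_cos (t : R) : 0 < t <= pi / 2 -> b' (cos t) = b (cos t).
Proof.
move=> /andP[t0 tpi]; rewrite kernel_extE// cos_geN1/= -(cos0 R) ltr_cos ?in_itv/= ?lexx ?pi_ge0//.
by rewrite (ltW t0) (le_trans tpi)// ler_pdivrMr// ler_peMr ?pi_ge0// ler1n.
Qed.

Let m := 2 / s - 1.

Let m_gt0 : 0 < m.
Proof. by case/andP: hs => s0 s2; rewrite /m subr_gt0 ltr_pdivlMr// mul1r. Qed.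

Let ln_half_gt0 (t : R) : 0 < t <= pi / 2 -> 0 < ln ((t / 2)^-1).
Proof.
move=> /andP[t0 tpi]; rewrite ln_gt0// invf_gt1 ?divr_gt0// ltr_pdivrMr// mul1r.
exact: le_lt_trans tpi (pihalf_lt2 R).
Qed.

Let lnE (t : R) : 0 < t -> ln ((t / 2)^-1) = ln 2 - ln t.
Proof. by move=> t0; rewrite invf_div ln_div ?posrE. Qed.

Let sqrlnE (t : R) : 0 < t -> t ^+ 2 = expR (2 * ln t).
Proof. by move=> t0; rewrite mulr_natl -lnXn// lnK// posrE exprn_gt0. Qed.

(** With m = 2/s - 1, the power m of the logarithm is dominated by a multiple of
t^-k, since ln x <= x^e / e for e = k / m, while y^k = O(t^(2 k)).  So the
singularity t^-2 of b, multiplied by y^k sin t, is at most of order t^(k - 1). *)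
Lemma kernel_upper_bound (k : R) : 0 < k -> exists2 t0 : R, 0 < t0 < pi / 2 /\
    mu.-integrable `[t0, pi / 2] (fun t => (b (cos t) * sin t)%:E) &
  exists2 C : R, 0 <= C & forall t, 0 < t <= t0 ->
    b' (cos t) * ((1 - cos t) / 2) `^ k * sin t <= C * (k * expR (k * ln t) / t).
Proof.
move=> k0; case: hbs => t0 [ht0 [c1 [c2 [c10 [c20 hc]]]] int0]; exists t0 => //.
pose e := k / m.
have e0 : 0 < e by rewrite divr_gt0.
exists (c2 * (e^-1 `^ m * expR (k * ln 2)) / k).
  by rewrite divr_ge0 ?mulr_ge0 ?powR_ge0 ?expR_ge0// ltW.
move=> t htt; have /andP[tp tt0] := htt.
have tpi : t <= pi / 2 by case/andP: ht0 => _ /ltW; exact: le_trans.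
have ht : 0 < t <= pi / 2 by rewrite tp.
have /andP[_ hb2] := hc t htt.
have L0 := ln_half_gt0 ht; set L := ln _ in hb2 L0.
rewrite kernel_ext_cos//.
have b1 : b (cos t) <= c2 * (t ^- 2 * L `^ m).
  by move: hb2; rewrite ler_pdivrMr// mulr_gt0 ?powR_gt0// invr_gt0 exprn_gt0.
have Lm : L `^ m <= e^-1 `^ m * (expR (k * ln 2) * expR (- (k * ln t))).
  rewrite -expRD -mulrBr -lnE// -/L.
  have -> : expR (k * L) = expR (e * L) `^ m.
    by rewrite /powR expR_eq0 expRK mulrA /e (mulrC m) divfK ?gt_eqF.
  rewrite -powRM ?expR_ge0 ?invr_ge0 ?(ltW e0)//.
  apply: ge0_ler_powR; rewrite ?nnegrE ?(ltW m_gt0) ?(ltW L0)//.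
    by rewrite mulr_ge0 ?invr_ge0 ?expR_ge0 ?(ltW e0).
  rewrite mulrC ler_pdivlMr// mulrC.
  by apply: le_trans (expR_ge1Dx _); rewrite lerDr.
have yk : ((1 - cos t) / 2) `^ k <= expR (2 * (k * ln t)).
  apply: (@le_trans _ _ ((t ^+ 2) `^ k)).
    have y0 : 0 <= (1 - cos t) / 2 by rewrite divr_ge0 ?subr_ge0 ?cos_le1.
    apply: ge0_ler_powR; rewrite ?nnegrE ?(ltW k0) ?sqr_ge0//.
    rewrite ler_pdivrMr//; apply: le_trans (one_sub_cos_le_sqr (ltW tp)) _.
    by rewrite ler_peMr ?sqr_ge0 ?ler1n.
  by rewrite /powR gt_eqF ?exprn_gt0// sqrlnE// expRK mulrCA.
have st := sin_le_id (ltW tp).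
have s0 : 0 <= sin t.
  by apply: sin_ge0_pi; rewrite (ltW tp) (le_trans tpi)// ler_pdivrMr// ler_peMr ?pi_ge0// ler1n.
have bp : 0 <= b (cos t) by rewrite -kernel_ext_cos// kernel_ext_ge0.
apply: (@le_trans _ _ (c2 * (t ^- 2 * (e^-1 `^ m * (expR (k * ln 2) * expR (- (k * ln t))))) *
    expR (2 * (k * ln t)) * t)).
  apply: ler_pM => //; rewrite ?mulr_ge0 ?powR_ge0//.
  apply: ler_pM => //; rewrite ?powR_ge0//.
  apply: le_trans b1 _; rewrite ler_pM2l// ler_pM2l// invr_gt0 exprn_gt0//.
rewrite le_eqVlt; apply/orP; left; apply/eqP.
rewrite mulr_natl mulr2n expRD expRN.
set E := expR (k * ln t); have E0 : E != 0 by rewrite expR_eq0.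
by field; rewrite E0 !gt_eqF.
Qed.

Lemma measurable_kernel_angle (h : R -> R) : measurable_fun setT h ->
  measurable_fun setT (fun t : R => b' (cos t) * h ((1 - cos t) / 2) * sin t).
Proof.
move=> mh; have mc : measurable_fun setT (@cos R).
  by apply: continuous_measurable_fun; exact: continuous_cos.
apply: measurable_funM; last by apply: continuous_measurable_fun; exact: continuous_sin.
apply: measurable_funM; first exact: measurableT_comp measurable_kernel_ext mc.
apply: (measurableT_comp mh); apply: measurable_funM => //.
exact: measurable_funB.
Qed.

(** Every positive power of y compensates the singularity of b. *)
Lemma kernel_angle_lty (k : R) : 0 < k ->
  (\int[mu]_(t in `[0%R, pi]%classic)
     (b' (cos t) * ((1 - cos t) / 2) `^ k * sin t)%:E < +oo)%E.
Proof.
move=> k0; have [t0 [/andP[t0p t0pi] int0] [C C0 hC]] := kernel_upper_bound k0.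
pose A1 := `]0%R, t0]%classic; pose A2 := `[t0, pi / 2]%classic.
pose g1 (t : R) := (C * (k * expR (k * ln t) / t))%:E.
pose g2 (t : R) := (b' (cos t) * sin t)%:E.
have pipi : pi / 2 <= pi :> R by rewrite ler_pdivrMr// ler_peMr ?pi_ge0// ler1n.
have pos1 t : A1 t -> (0 <= g1 t)%E.
  rewrite /A1 /= in_itv /= => /andP[h _]; rewrite lee_fin.
  by rewrite mulr_ge0 ?divr_ge0 ?mulr_ge0 ?expR_ge0// ltW.
have pos2 t : A2 t -> (0 <= g2 t)%E.
  rewrite /A2 /= in_itv /= => /andP[h h2]; rewrite lee_fin mulr_ge0 ?kernel_ext_ge0//.
  by rewrite sin_ge0_pi// (le_trans (ltW t0p) h) (le_trans h2).
have mA1 : measurable A1 by exact: measurable_itv.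
have mA2 : measurable A2 by exact: measurable_itv.
have m1 : measurable_fun setT (g1 \_ A1).
  apply/(measurable_restrictT g1 mA1); apply/measurable_EFinP; apply: measurable_funM => //.
  apply: subspace_continuous_measurable_fun => //.
  apply: continuous_in_subspaceT => x; rewrite inE /A1 /= in_itv /= => /andP[h _].
  exact: continuous_expR_ln.
have m2 : measurable_fun setT (g2 \_ A2).
  apply/(measurable_restrictT g2 mA2); apply/measurable_EFinP; apply: measurable_funTS.
  have := measurable_kernel_angle (@measurable_cst _ _ _ _ setT (1 : R)).
  by under eq_fun do rewrite mulr1.
rewrite integral_mkcond.
apply: (@le_lt_trans _ _ (\int[mu]_t ((g1 \_ A1) t + (g2 \_ A2) t))%E).
  apply: ge0_le_integral => //.
  - move=> t _; apply: erestrict_ge0 => x; rewrite /= in_itv /= => hx.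
    by rewrite lee_fin mulr_ge0 ?sin_ge0_pi ?mulr_ge0 ?kernel_ext_ge0 ?powR_ge0.
  - apply/(measurable_restrictT _ (measurable_itv _)); apply/measurable_EFinP; apply: measurable_funTS.
    exact: measurable_kernel_angle (@measurable_powR R k).
  - exact: emeasurable_funD.
  - move=> t _; have n1 : (0 <= (g1 \_ A1) t)%E by exact: erestrict_ge0.
    have n2 : (0 <= (g2 \_ A2) t)%E by exact: erestrict_ge0.
    rewrite [leLHS]patchE; case: ifPn => [/set_mem|_]; last exact: adde_ge0.
    rewrite /= in_itv /= => /andP[]; rewrite le_eqVlt => /predU1P[tE _|tp tpi].
      by rewrite (_ : sin t = 0) ?mulr0; [exact: adde_ge0|rewrite -tE sin0].
    have [tt0|t0t] := leP t t0.
      rewrite -[leLHS]adde0; apply: leeD => //.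
      rewrite patchE mem_set; last by rewrite /A1 /= in_itv /= tp.
      by rewrite lee_fin hC// tp.
    have [tpi2|tpi2] := leP t (pi / 2).
      rewrite -[leLHS]add0e; apply: leeD => //.
      rewrite patchE mem_set; last by rewrite /A2 /= in_itv /= (ltW t0t).
      rewrite lee_fin ler_wpM2r//; first by rewrite sin_ge0_pi// (ltW tp).
      rewrite ler_piMr ?kernel_ext_ge0//.
      apply: (@le_trans _ _ (1 `^ k)); last by rewrite powR1.
      have y0 : 0 <= (1 - cos t) / 2 by rewrite divr_ge0 ?subr_ge0 ?cos_le1.
      rewrite ge0_ler_powR ?nnegrE ?(ltW k0)//.
      by have := cos_geN1 t; lra.
    rewrite kernel_ext_lt0 ?mul0r; first exact: adde_ge0.
    rewrite -(cos_pihalf R) ltr_cos ?in_itv/= ?(ltW tp)//.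
    by rewrite pipi divr_ge0 ?pi_ge0.
rewrite ge0_integralD//; [|by move=> t _; exact: erestrict_ge0|by move=> t _; exact: erestrict_ge0].
rewrite -!integral_mkcond; apply: lte_add_pinfty.
  rewrite /g1; under eq_integral => t _ do rewrite EFinM.
  rewrite ge0_integralZl//; first by rewrite lte_mul_pinfty// integral_expR_ln_lty.
  - apply/measurable_EFinP; apply: subspace_continuous_measurable_fun => //.
    apply: continuous_in_subspaceT => x; rewrite inE /A1 /= in_itv /= => /andP[h _].
    exact: continuous_expR_ln.
  - move=> t; rewrite /A1 /= in_itv /= => /andP[h _]; rewrite lee_fin.
    by rewrite divr_ge0 ?mulr_ge0 ?expR_ge0// ltW.
rewrite (_ : (\int[mu]_(x in A2) g2 x)%E = (\int[mu]_(x in A2) (b (cos x) * sin x)%:E)%E).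
  exact: integrable_lty.
apply: eq_integral => t; rewrite /A2 inE /= in_itv /= => /andP[h1 h2].
by rewrite /g2 kernel_ext_cos// h2 (lt_le_trans t0p).
Qed.

(** On [4 / r, t1] one has r^2 y >= 1, so the minimum is 1, and
b (cos t) sin t >= 2 L / t once t1 is so small that the power of the logarithm in b
exceeds a given multiple of L; the integral of 2 L / t is 2 L (ln r - ln (4 / t1)),
at least L ln r for r large. *)
Lemma kernel_angle_growth (L : R) : 0 < L -> exists2 r0 : R, 2 <= r0 &
  forall r, r0 <= r ->
    ((L * ln r)%:E <= \int[mu]_(t in `[0%R, pi]%classic)
      (b' (cos t) * Num.min 1 (r ^+ 2 * ((1 - cos t) / 2)) * sin t)%:E)%E.
Proof.
move=> L0; case: hbs => t0 [/andP[t0p t0pi] [c1 [c2 [c10 [c20 hc]]]] _].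
have [d [d0 hd]] := @trig_lower_bounds R.
pose X := (4 * L / c1) `^ m^-1.
pose t1 := Num.min t0 (Num.min d (2 * expR (- X))).
have t1p : 0 < t1 by rewrite !lt_min t0p d0 mulr_gt0 ?expR_gt0.
have [t1t0 t1d t1X] : [/\ t1 <= t0, t1 <= d & t1 <= 2 * expR (- X)].
  by split; rewrite !ge_min lexx ?orbT.
pose r0 := Num.max 2 (Num.max (expR (2 * (ln 4 - ln t1))) (8 / t1)).
exists r0; first by rewrite le_max lexx.
move=> r; rewrite !ge_max => /and3P[r2 rE rt].
have rp : 0 < r by exact: lt_le_trans r2.
have r4 : 0 < 4 / r by rewrite divr_gt0.
have r4t : 4 / r < t1.
  rewrite ltr_pdivrMr// mulrC -ltr_pdivrMr//; apply: lt_le_trans rt.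
  by rewrite ltr_pM2r ?invr_gt0// ltr_nat.
have lnr : 2 * (ln 4 - ln t1) <= ln r by rewrite -[leLHS]expRK ler_ln ?posrE ?expR_gt0.
have pipi : pi / 2 <= pi :> R by rewrite ler_pdivrMr// ler_peMr ?pi_ge0// ler1n.
pose I := `[4 / r, t1]%classic.
have mI : measurable I by exact: measurable_itv.
have sub : I `<=` `[0%R, pi]%classic.
  move=> t; rewrite /I; rewrite /= !in_itv /= => /andP[h1 h2]; apply/andP; split.
    by rewrite (le_trans _ h1)// ltW.
  by rewrite (le_trans h2)// (le_trans t1t0)// (le_trans (ltW t0pi)).
have mmin (e : R) : measurable_fun setT (fun y : R => Num.min 1 (e * y)).
  by apply: measurable_minr => //; exact: measurable_funM.
have pos t : `[0%R, pi]%classic t -> 0 <= b' (cos t) * Num.min 1 (r ^+ 2 * ((1 - cos t) / 2)) * sin t.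
  rewrite /= in_itv /= => ht; rewrite mulr_ge0 ?sin_ge0_pi// mulr_ge0 ?kernel_ext_ge0//.
  by rewrite le_min ler01 mulr_ge0 ?sqr_ge0// divr_ge0 ?subr_ge0 ?cos_le1.
have meas : measurable_fun setT
    (fun t : R => b' (cos t) * Num.min 1 (r ^+ 2 * ((1 - cos t) / 2)) * sin t).
  exact: measurable_kernel_angle (mmin (r ^+ 2)).
apply: (@le_trans _ _ (\int[mu]_(t in I)
    (b' (cos t) * Num.min 1 (r ^+ 2 * ((1 - cos t) / 2)) * sin t)%:E)%E); last first.
  apply: ge0_subset_integral => //.
  by apply/measurable_EFinP; exact: measurable_funTS.
apply: (@le_trans _ _ (\int[mu]_(t in I) (2 * L * t^-1)%:E)%E).
  have dl (x : R) : 0 < x -> is_derive x (1 : R) (fun t => 2 * L * ln t) (2 * L * x^-1).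
    by move=> x0; apply: is_deriveZR; exact: is_derive1_ln.
  have cl (x : R) : 0 < x -> {for x, continuous ((fun t => 2 * L * t^-1) : R -> R)}.
    move=> x0; apply: cvgM; first exact: cvg_cst.
    by apply: cvgV; [exact: lt0r_neq0|exact: cvg_id].
  rewrite (FTC_gt0 r4 r4t dl cl) lee_fin -mulrBr ln_div ?posrE//.
  by nra.
apply: ge0_le_integral => //.
- move=> t; rewrite /I /= in_itv /= => /andP[h _]; rewrite lee_fin.
  by rewrite mulr_ge0 ?invr_ge0 ?mulr_ge0 ?(ltW L0)// (le_trans _ h)// ltW.
- apply/measurable_EFinP; apply: subspace_continuous_measurable_fun => //.
  apply: continuous_in_subspaceT => x; rewrite inE /I /= in_itv /= => /andP[h _].
  apply: cvgM; first exact: cvg_cst.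
  by apply: cvgV; [apply: lt0r_neq0; exact: lt_le_trans h|exact: cvg_id].
- by apply/measurable_EFinP; exact: measurable_funTS.
move=> t; rewrite /I /= in_itv /= => /andP[h1 h2]; rewrite lee_fin.
have tp : 0 < t by exact: lt_le_trans h1.
have tt0 : 0 < t <= t0 by rewrite tp (le_trans h2).
have tpi : 0 < t <= pi / 2 by rewrite tp (le_trans h2)// (le_trans t1t0)// ltW.
have [s1 s2] : t / 2 <= sin t /\ t ^+ 2 / 4 <= 1 - cos t.
  by apply: hd; rewrite (ltW tp) (le_trans h2).
have rt4 : 4 <= r * t by rewrite mulrC -ler_pdivrMr.
have m1 : 1 <= r ^+ 2 * ((1 - cos t) / 2).
  have : (r * t) ^+ 2 <= r ^+ 2 * (4 * (1 - cos t)).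
    by rewrite exprMn ler_pM2l ?exprn_gt0//; lra.
  by have : 16 <= (r * t) ^+ 2 by [rewrite expr2; nra]; lra.
rewrite min_l// mulr1 kernel_ext_cos//.
have /andP[hb1 _] := hc t tt0.
have Lt := ln_half_gt0 tpi; set l := ln _ in hb1 Lt.
have Lm : 4 * L / c1 <= l `^ m.
  have -> : 4 * L / c1 = X `^ m.
    by rewrite /X -powRrM mulVf ?gt_eqF// powRr1// divr_ge0 ?mulr_ge0 ?ltW.
  apply: ge0_ler_powR; rewrite ?nnegrE ?powR_ge0 ?(ltW m_gt0) ?(ltW Lt)//.
  rewrite /l lnE// lerBrDl -lerBrDr -[X in _ <= _ - X]expRK -ln_div ?posrE ?expR_gt0//.
  by rewrite ler_ln ?posrE ?divr_gt0 ?expR_gt0// -expRN (le_trans h2).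
have b1 : 4 * L * t ^- 2 <= b (cos t).
  move: hb1; rewrite ler_pdivlMr ?mulr_gt0 ?powR_gt0 ?invr_gt0 ?exprn_gt0//; apply: le_trans.
  rewrite mulrCA mulrC ler_pM2l ?invr_gt0 ?exprn_gt0//.
  by rewrite -ler_pdivrMl// mulrC.
apply: (@le_trans _ _ (4 * L * t ^- 2 * (t / 2))).
  by rewrite le_eqVlt; apply/orP; left; apply/eqP; field; rewrite gt_eqF.
apply: ler_pM => //.
  by rewrite mulr_ge0 ?invr_ge0 ?sqr_ge0 ?mulr_ge0 ?(ltW L0).
by rewrite divr_ge0 ?(ltW tp).
Qed.

End debye_yukawa_kernel.

(** * The collision integral at a fixed frequency *)

Section charKalpha_continuity.
Context {R : realType}.

Lemma enorm_le_of_ball (e : R) (x y : vec3 R) : 0 < e -> ball x e y ->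
  enorm (x - y) <= 2 * e.
Proof.
move=> e0 [[/= h1 h2] h3].
rewrite -ler_sqr ?nnegrE ?enorm_ge0 ?mulr_ge0 ?(ltW e0)// sqr_enorm /dot /= -!expr2.
have sq (a b : R) : ball a e b -> (a - b) ^+ 2 <= e ^+ 2.
  rewrite /ball /= => h; rewrite -(real_normK (num_real (a - b))).
  by rewrite lerXn2r ?nnegrE ?normr_ge0 ?(ltW e0)// ltW.
have := sq _ _ h1; have := sq _ _ h2; have := sq _ _ h3.
have := sqr_ge0 e; rewrite exprMn.
by nra.
Qed.

(** The distance d depends only on alpha, C and e: the same modulus of continuity
serves all characteristic functions with the same constant C. *)
Lemma charK_close (alpha C e : R) : 0 < alpha -> 0 <= C -> 0 < e ->
  exists2 d : R, 0 < d & forall phi (a b : vec3 R), charK phi ->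
    (forall xi, cabs (phi xi - 1) <= C * enorm xi `^ alpha) ->
    enorm (a - b) <= d -> cabs (phi a - phi b) <= e.
Proof.
move=> a0 C0 e0; pose d := (e ^+ 2 / (2 * C + 1)) `^ alpha^-1.
have C1 : 0 < 2 * C + 1 by rewrite ltr_wpDl ?mulr_ge0.
have q0 : 0 < e ^+ 2 / (2 * C + 1) by rewrite divr_gt0 ?exprn_gt0.
exists d; first exact: powR_gt0.
move=> phi a b K hC hab.
rewrite -ler_sqr ?nnegrE ?cabs_ge0 ?(ltW e0)//.
apply: le_trans (charK_sub_le _ _ K) _.
apply: (@le_trans _ _ (2 * (C * (e ^+ 2 / (2 * C + 1))))).
  rewrite ler_pM2l//; apply: le_trans (hC _) _; rewrite ler_wpM2l//.
  have -> : e ^+ 2 / (2 * C + 1) = d `^ alpha.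
    by rewrite /d -powRrM mulVf ?gt_eqF// powRr1// ltW.
  by apply: ge0_ler_powR; rewrite ?nnegrE ?enorm_ge0 ?powR_ge0 ?(ltW a0).
rewrite [leLHS](_ : _ = e ^+ 2 * (2 * C / (2 * C + 1))); last by ring.
rewrite ler_piMr ?sqr_ge0// ler_pdivrMr// mul1r lerDl//.
Qed.

Lemma charKalpha_continuous (alpha : R) phi : 0 < alpha -> charKalpha alpha phi ->
  continuous (fun xi : vec3 R => complex.Re (phi xi)) /\
  continuous (fun xi : vec3 R => complex.Im (phi xi)).
Proof.
move=> a0 K; have [C C0 hC] := charKalpha_bound a0 K.
have near_ x e : 0 < e -> \forall y \near nbhs (x : vec3 R), cabs (phi x - phi y) <= e.
  move=> e0; have [d d0 hd] := charK_close a0 C0 e0.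
  apply/nbhs_ballP; exists (d / 2); first by rewrite /= divr_gt0.
  move=> y /= hy; apply: hd (proj1 K) hC _.
  have d2 : 0 < d / 2 by rewrite divr_gt0.
  by have := enorm_le_of_ball d2 hy; rewrite mulrC divfK.
split=> x; apply/cvgrPdist_le => e e0; near=> y.
- apply: (@le_trans _ _ (cabs (phi x - phi y))); last by near: y; exact: near_.
  by rewrite (le_trans _ (normr_Re_le _))//; case: (phi x) (phi y) => ? ? [].
- apply: (@le_trans _ _ (cabs (phi x - phi y))); last by near: y; exact: near_.
  by rewrite (le_trans _ (normr_Im_le _))//; case: (phi x) (phi y) => ? ? [].
Unshelve. all: by end_near. Qed.

End charKalpha_continuity.

Section collision_geometry.
Context {R : realType}.
Implicit Types (xi sg : vec3 R) (p : R * R).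

Lemma dot_spherical p : dot (spherical p) (spherical p) = 1 :> R.
Proof.
rewrite /dot /spherical /=; have := cos2Dsin2 p.1; have := cos2Dsin2 p.2.
set c := cos _; set s := sin _; set C := cos _; set S := sin _ => h1 h2.
have -> : S * c * (S * c) + S * s * (S * s) + C * C = S ^+ 2 * (c ^+ 2 + s ^+ 2) + C ^+ 2.
  by ring.
by rewrite h1 mulr1 addrC.
Qed.

Lemma xi_plusDminus xi sg : xi_plus xi sg + xi_minus xi sg = xi.
Proof.
rewrite /xi_plus /xi_minus addrACA subrr addr0 -scalerDl.
by rewrite (_ : 2^-1 + 2^-1 = 1) ?scale1r//; field.
Qed.

Lemma sqr_enorm_minus xi sg : xi != 0 -> dot sg sg = 1 ->
  enorm (xi_minus xi sg) ^+ 2 = enorm xi ^+ 2 * ((1 - dot xi sg / enorm xi) / 2).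
Proof.
move=> x0 s1; have r0 := enorm_gt0 x0.
have e := sqr_enorm xi; set r := enorm xi in r0 e *.
rewrite sqr_enorm /xi_minus -/r.
have -> : dot (2^-1 *: xi - (r / 2) *: sg) (2^-1 *: xi - (r / 2) *: sg) =
    4^-1 * dot xi xi - r / 2 * dot xi sg + (r / 2) ^+ 2 * dot sg sg.
  by rewrite /dot /= /GRing.scale /=; field.
by rewrite s1 -e; field; rewrite gt_eqF.
Qed.

Lemma sqr_enorm_plus xi sg : xi != 0 -> dot sg sg = 1 ->
  enorm (xi_plus xi sg) ^+ 2 = enorm xi ^+ 2 * (1 - (1 - dot xi sg / enorm xi) / 2).
Proof.
move=> x0 s1; have r0 := enorm_gt0 x0.
have e := sqr_enorm xi; set r := enorm xi in r0 e *.
rewrite sqr_enorm /xi_plus -/r.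
have -> : dot (2^-1 *: xi + (r / 2) *: sg) (2^-1 *: xi + (r / 2) *: sg) =
    4^-1 * dot xi xi + r / 2 * dot xi sg + (r / 2) ^+ 2 * dot sg sg.
  by rewrite /dot /= /GRing.scale /=; field.
by rewrite s1 -e; field; rewrite gt_eqF.
Qed.

Lemma normr_direction xi sg : xi != 0 -> dot sg sg = 1 ->
  -1 <= dot xi sg / enorm xi <= 1.
Proof.
move=> x0 s1; have r0 := enorm_gt0 x0.
have := sqr_enorm_minus x0 s1; have := sqr_enorm_plus x0 s1.
set u := dot xi sg / _ => h1 h2.
have := sqr_ge0 (enorm (xi_minus xi sg)); have := sqr_ge0 (enorm (xi_plus xi sg)).
rewrite h1 h2 (pmulr_rge0 _ (exprn_gt0 2 r0)) (pmulr_rge0 _ (exprn_gt0 2 r0)).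
by move=> ? ?; lra.
Qed.

Lemma continuous_spherical : continuous (@spherical R).
Proof.
have c1 : continuous (fun p : R * R => p.1) by move=> p; exact: cvg_fst.
have c2 : continuous (fun p : R * R => p.2) by move=> p; exact: cvg_snd.
have cc (f : R * R -> R) : continuous f -> continuous (fun p => cos (f p)).
  by move=> cf p; apply: continuous_comp; [exact: cf|exact: continuous_cos].
have cs (f : R * R -> R) : continuous f -> continuous (fun p => sin (f p)).
  by move=> cf p; apply: continuous_comp; [exact: cf|exact: continuous_sin].
have h1 : continuous (fun p : R * R => sin p.1 * cos p.2).
  by move=> p; apply: cvgM; [exact: (cs _ c1)|exact: (cc _ c2)].
have h2 : continuous (fun p : R * R => sin p.1 * sin p.2).
  by move=> p; apply: cvgM; [exact: (cs _ c1)|exact: (cs _ c2)].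
by move=> p; exact: (cvg_pair (cvg_pair (h1 p) (h2 p)) (cc _ c1 p)).
Qed.

End collision_geometry.

Section collision_estimate.
Context {R : realType}.
Variables (s : R) (b : R -> R).
Hypotheses (hs : 0 < s < 2) (hb : collision_kernel b) (hbs : debye_yukawa s b).
Local Notation mu := (@lebesgue_measure R).
Local Notation mu2 := (prodm mu mu).
Local Notation D := (`[0%R, pi]%classic `*` `[0%R, 2 * pi]%classic).
Local Notation b' := (kernel_ext b).

Section direction.
Variable xi : vec3 R.
Hypothesis xi0 : xi != 0.

Let u (p : R * R) : R := dot xi (spherical p) / enorm xi.

Let r0 : 0 < enorm xi. Proof. exact: enorm_gt0. Qed.

Let w := (enorm xi)^-1 *: xi.

Let w1 : dot w w = 1.
Proof.
rewrite /w dotZl dotC dotZl -sqr_enorm; field.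
by rewrite gt_eqF.
Qed.

Let uE p : u p = dot w (spherical p).
Proof. by rewrite /w dotZl mulrC. Qed.

Let u_bounds p : -1 <= u p <= 1.
Proof. exact: normr_direction xi0 (dot_spherical p). Qed.

(** The variable y = (1 - cos theta) / 2 = |xi^-|^2 / |xi|^2 = 1 - |xi^+|^2 / |xi|^2
in terms of which all estimates are written. *)
Definition deviation (p : R * R) : R := (1 - dot xi (spherical p) / enorm xi) / 2.

Lemma deviation_bounds p : 0 <= deviation p <= 1.
Proof. by rewrite /deviation -/(u p); have := u_bounds p; lra. Qed.

Lemma continuous_direction : continuous u.
Proof.
move=> p; apply: cvgM; last exact: cvg_cst.
have c : continuous (fun x : vec3 R => dot xi x).
  by apply: (@continuous_dot R (fun=> xi) id) => x; [exact: cvg_cst|exact: cvg_id].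
by apply: continuous_comp; [exact: continuous_spherical|exact: c].
Qed.

Let mu_ : measurable_fun setT (u : measurableTypeR R * measurableTypeR R -> R).
Proof. exact: continuous2_measurable continuous_direction. Qed.

Lemma measurable_kernel_sphere (h : R -> R) : measurable_fun setT h ->
  measurable_fun setT ((fun p => b' (u p) * h (deviation p) * sin p.1) :
    measurableTypeR R * measurableTypeR R -> R).
Proof.
move=> mh; apply: measurable_funM.
  apply: measurable_funM; first exact: measurableT_comp (measurable_kernel_ext hb) mu_.
  apply: (measurableT_comp mh); rewrite /deviation; apply: measurable_funM => //.
  exact: measurable_funB.
apply: continuous2_measurable => p; apply: continuous_comp; first exact: cvg_fst.
exact: continuous_sin.
Qed.

(** [ge0_sphere_law] in terms of y; h enters through its positive part because y
stays in [0, 1] whereas the law is stated for functions nonnegative everywhere. *)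
Lemma integral_kernel_sphere (h : R -> R) : measurable_fun setT h ->
  (forall y, 0 <= y <= 1 -> 0 <= h y) ->
  (\int[mu2]_(p in D) (b' (u p) * h (deviation p) * sin p.1)%:E =
   (2 * pi)%:E * \int[mu]_(t in `[0%R, pi]%classic)
      (b' (cos t) * h ((1 - cos t) / 2) * sin t)%:E)%E.
Proof.
move=> mh h0; pose k v := b' v * Num.max 0 (h ((1 - v) / 2)).
have mk : measurable_fun setT k.
  apply: measurable_funM; first exact: measurable_kernel_ext.
  apply: measurable_maxr => //; apply: (measurableT_comp mh); apply: measurable_funM => //.
  exact: measurable_funB.
have k0 v : 0 <= k v by rewrite mulr_ge0 ?kernel_ext_ge0 ?le_max ?lexx.
have kE v : -1 <= v <= 1 -> k v = b' v * h ((1 - v) / 2).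
  by move=> hv; rewrite /k max_r// h0//; lra.
transitivity (\int[mu2]_(p in D) (k (dot w (spherical p)) * sin p.1)%:E)%E.
  by apply: eq_integral => p _; rewrite -uE kE.
rewrite (ge0_sphere_law w1 mk k0); congr mule.
by apply: eq_integral => t _; rewrite kE// cos_geN1 cos_le1.
Qed.

Lemma kernel_sphere_integrable (h : R -> R) (C k : R) : measurable_fun setT h ->
  0 < k -> (forall y, 0 <= y <= 1 -> 0 <= h y <= C * y `^ k) ->
  mu2.-integrable D (EFin \o (fun p => b' (u p) * h (deviation p) * sin p.1)).
Proof.
move=> mh k0 hC.
have sin0D p : D p -> 0 <= sin p.1.
  by move=> [/= + _]; rewrite in_itv /= => ?; exact: sin_ge0_pi.
have ik : mu2.-integrable D
    (EFin \o (fun p => b' (u p) * (deviation p) `^ k * sin p.1)).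
  apply/integrableP; split.
    apply/measurable_EFinP; apply: measurable_funTS.
    exact: (measurable_kernel_sphere (@measurable_powR R k)).
  under eq_integral => p /set_mem hp.
    rewrite /= ger0_norm; last by rewrite mulr_ge0 ?sin0D// mulr_ge0 ?kernel_ext_ge0 ?powR_ge0.
    over.
  rewrite [X in (X < _)%E](integral_kernel_sphere (@measurable_powR R k)).
  - rewrite lte_mul_pinfty ?lee_fin ?mulr_ge0 ?pi_ge0//.
    exact: kernel_angle_lty hs hb hbs _ k0.
  - by move=> y _; exact: powR_ge0.
have mD := @measurable_rect R 0 pi 0 (2 * pi).
have iC := integrableZl mD C ik.
apply: (le_integrable mD _ _ iC).
  by apply/measurable_EFinP; apply: measurable_funTS; exact: measurable_kernel_sphere.
move=> p hp; have /andP[h1 h2] := hC _ (deviation_bounds p).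
rewrite /= lee_fin !normrM.
rewrite [`|h _|]ger0_norm// (ger0_norm (kernel_ext_ge0 hb _)) [X in _ <= _ * (_ * X * _)]ger0_norm ?powR_ge0//.
rewrite [leRHS]mulrA ler_wpM2r// [leRHS]mulrCA ler_wpM2l ?kernel_ext_ge0//.
by apply: le_trans h2 _; rewrite ler_wpM2r ?powR_ge0// ler_norm.
Qed.

Lemma Rintegral_kernel_sphere (h : R -> R) : measurable_fun setT h ->
  (forall y, 0 <= y <= 1 -> 0 <= h y) ->
  Rintegral mu2 D (fun p => b' (u p) * h (deviation p) * sin p.1) =
  2 * pi * Rintegral mu `[0%R, pi]%classic
      (fun t => b' (cos t) * h ((1 - cos t) / 2) * sin t).
Proof.
move=> mh h0; rewrite /Rintegral integral_kernel_sphere//; set I := (\int[mu]_(t in _) _)%E.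
have : (0 <= I)%E.
  apply: integral_ge0 => t; rewrite /= in_itv /= => ht; rewrite lee_fin.
  rewrite mulr_ge0 ?sin_ge0_pi ?mulr_ge0 ?kernel_ext_ge0 ?h0//.
  by have := cos_geN1 t; have := cos_le1 t; lra.
case: I => //= _.
have pp : 0 < 2 * pi :> R by rewrite mulr_gt0// pi_gt0.
by rewrite mulr_infty gtr0_sg// mul1e /= mulr0.
Qed.

Section integrand.
Variables (alpha : R) (phi : vec3 R -> R[i]).
Hypotheses (al0 : 0 < alpha) (K : charKalpha alpha phi).

(** The bracket of the collision integrand, using phi(0) = 1. *)
Definition gain_loss (p : R * R) : R[i] :=
  phi (xi_plus xi (spherical p)) * phi (xi_minus xi (spherical p)) - phi xi.

Let xi_minus_continuous : continuous (fun p => xi_minus xi (spherical p)).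
Proof.
move=> p; apply: cvgB; first exact: cvg_cst.
exact: (cvgZl_tmp (k := enorm xi / 2) (@continuous_spherical R p)).
Qed.

Let xi_plus_continuous : continuous (fun p => xi_plus xi (spherical p)).
Proof.
move=> p; apply: cvgD; first exact: cvg_cst.
exact: (cvgZl_tmp (k := enorm xi / 2) (@continuous_spherical R p)).
Qed.

Let re_gain_loss p : complex.Re (gain_loss p) =
  complex.Re (phi (xi_plus xi (spherical p))) * complex.Re (phi (xi_minus xi (spherical p))) -
  complex.Im (phi (xi_plus xi (spherical p))) * complex.Im (phi (xi_minus xi (spherical p))) -
  complex.Re (phi xi).
Proof.
rewrite /gain_loss; case: (phi (xi_plus _ _)) => a1 a2; case: (phi (xi_minus _ _)) => b1 b2.
by case: (phi xi).
Qed.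

Let im_gain_loss p : complex.Im (gain_loss p) =
  complex.Re (phi (xi_plus xi (spherical p))) * complex.Im (phi (xi_minus xi (spherical p))) +
  complex.Im (phi (xi_plus xi (spherical p))) * complex.Re (phi (xi_minus xi (spherical p))) -
  complex.Im (phi xi).
Proof.
rewrite /gain_loss; case: (phi (xi_plus _ _)) => a1 a2; case: (phi (xi_minus _ _)) => b1 b2.
by case: (phi xi).
Qed.

Lemma gain_loss_measurable :
  measurable_fun setT ((fun p => complex.Re (gain_loss p)) :
    measurableTypeR R * measurableTypeR R -> R) /\
  measurable_fun setT ((fun p => complex.Im (gain_loss p)) :
    measurableTypeR R * measurableTypeR R -> R).
Proof.
have [cr ci] := charKalpha_continuous al0 K.
have cc (f : R * R -> vec3 R) (g : vec3 R -> R) : continuous f -> continuous g ->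
    continuous (fun p => g (f p)).
  by move=> cf cg p; exact: (cvg_comp f g (cf p) (cg (f p))).
have rp : continuous (fun p => complex.Re (phi (xi_plus xi (spherical p)))).
  exact: cc xi_plus_continuous cr.
have rm : continuous (fun p => complex.Re (phi (xi_minus xi (spherical p)))).
  exact: cc xi_minus_continuous cr.
have ip : continuous (fun p => complex.Im (phi (xi_plus xi (spherical p)))).
  exact: cc xi_plus_continuous ci.
have im : continuous (fun p => complex.Im (phi (xi_minus xi (spherical p)))).
  exact: cc xi_minus_continuous ci.
split; apply: continuous2_measurable.
- under eq_fun do rewrite re_gain_loss.
  move=> p; apply: cvgB; last exact: cvg_cst.
  exact: cvgB (cvgM (rp p) (rm p)) (cvgM (ip p) (im p)).
- under eq_fun do rewrite im_gain_loss.
  move=> p; apply: cvgB; last exact: cvg_cst.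
  exact: cvgD (cvgM (rp p) (im p)) (cvgM (ip p) (rm p)).
Qed.

(** This is [charK_product_le] for a = xi^+ and b = xi^-, since
|xi^-| = |xi| y^(1/2).  The square root there halves the exponent alpha / 2 of y. *)
Lemma gain_loss_le : exists2 C : R, 0 <= C &
  forall p, cabs (gain_loss p) <= C * deviation p `^ (alpha / 4).
Proof.
have [C C0 hC] := charKalpha_bound al0 K.
pose q := (enorm xi ^+ 2) `^ (alpha / 2).
have q0 : 0 <= q by exact: powR_ge0.
exists (C * q + Num.sqrt (2 * C * q)); first by rewrite addr_ge0 ?mulr_ge0 ?sqrtr_ge0.
move=> p; have /andP[y0 y1] := deviation_bounds p; set y := deviation p in y0 y1 *.
have e : enorm (xi_minus xi (spherical p)) `^ alpha = q * y `^ (alpha / 2).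
  have -> : alpha = 2 * (alpha / 2) by field.
  rewrite powRrM -[2]/(2%:R) powR_mulrn ?enorm_ge0// sqr_enorm_minus ?dot_spherical//.
  by rewrite powRM ?sqr_ge0// /q; congr (_ `^ _ * _ `^ _); field.
have := charK_product_le (xi_plus xi (spherical p)) (xi_minus xi (spherical p)) (proj1 K) C0 hC.
rewrite xi_plusDminus => /le_trans; apply; rewrite e [leRHS]mulrDl.
have yk : y `^ (alpha / 2) = y `^ (alpha / 4) * y `^ (alpha / 4).
  by rewrite -powRD; [congr (_ `^ _); field|rewrite implybE gt_eqF// addr_gt0 ?divr_gt0].
have yk1 : y `^ (alpha / 4) <= 1.
  apply: (@le_trans _ _ (1 `^ (alpha / 4))); last by rewrite powR1.
  by rewrite ge0_ler_powR ?nnegrE// divr_ge0 ?ltW.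
apply: lerD.
  rewrite mulrA ler_wpM2l ?mulr_ge0// yk ler_piMl ?powR_ge0//.
rewrite [2 * C * (q * _)]mulrA sqrtrM ?mulr_ge0// yk -expr2 sqrtr_sqr ger0_norm ?powR_ge0//.
Qed.

Let gain_loss_integrable (g : R[i] -> R) :
  measurable_fun setT ((fun p => g (gain_loss p)) : measurableTypeR R * measurableTypeR R -> R) ->
  (forall z, `|g z| <= cabs z) ->
  mu2.-integrable D (EFin \o (fun p => b' (u p) * g (gain_loss p) * sin p.1)).
Proof.
move=> mg gle; have [C C0 hC] := gain_loss_le.
have al4 : 0 < alpha / 4 by rewrite divr_gt0.
have hk y : 0 <= y <= 1 -> 0 <= C * y `^ (alpha / 4) <= C * y `^ (alpha / 4).
  by rewrite lexx mulr_ge0 ?powR_ge0.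
have mk : measurable_fun setT (fun y : R => C * y `^ (alpha / 4)).
  by apply: measurable_funM => //; exact: measurable_powR.
have ik := kernel_sphere_integrable mk al4 hk.
have mD := @measurable_rect R 0 pi 0 (2 * pi).
apply: (le_integrable mD _ _ ik).
  apply/measurable_EFinP; apply: measurable_funTS.
  apply: measurable_funM; last first.
    apply: continuous2_measurable => p; apply: continuous_comp; first exact: cvg_fst.
    exact: continuous_sin.
  by apply: measurable_funM => //; exact: measurableT_comp (measurable_kernel_ext hb) mu_.
move=> p hp; rewrite /= lee_fin !normrM ler_wpM2r// ler_wpM2l//.
by rewrite -normrM (le_trans (gle _))// (le_trans (hC p))// ler_norm.
Qed.

Let collision_integrandE p :
  (b (dot xi (spherical p) / enorm xi))%:C%C *
    (phi (xi_plus xi (spherical p)) * phi (xi_minus xi (spherical p)) - phi xi * phi 0) *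
    (sin p.1)%:C%C =
  (b' (u p) * sin p.1)%:C%C * gain_loss p.
Proof.
rewrite (charK0 (proj1 K)) mulr1 -/(gain_loss p) mulrAC -rmorphM -/(u p).
have /andP[h1] := u_bounds p; rewrite le_eqVlt => /predU1P[u1|u1]; last first.
  by rewrite kernel_extE// h1.
(* at u = 1 the kernel and its extension may differ, but xi^- = 0 there *)
suff -> : gain_loss p = 0 by rewrite !mulr0.
have m0 : xi_minus xi (spherical p) = 0.
  apply/eqP; apply/negPn/negP => /enorm_gt0.
  move=> /(exprn_gt0 2); rewrite (sqr_enorm_minus xi0 (dot_spherical p)) -/(u p) u1.
  by rewrite subrr mul0r mulr0 ltxx.
have := xi_plusDminus xi (spherical p); rewrite m0 addr0 => pl.
by rewrite /gain_loss m0 pl (charK0 (proj1 K)) mulr1 subrr.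
Qed.

(** A pointwise bound on the integrand over the support theta <= pi / 2 of the kernel
integrates to a bound on Re (conj phi(xi) Q), half the time derivative
of |phi|^2 when Q is the collision integral. *)
Lemma collision_inner_le (A c : R) : 0 <= A ->
  (forall p, 0 <= dot xi (spherical p) ->
    complex.Re (phi xi) * complex.Re (gain_loss p) +
    complex.Im (phi xi) * complex.Im (gain_loss p) <=
    cabs (phi xi) ^+ 2 *
      (A * deviation p - c * Num.min 1 (enorm xi ^+ 2 * deviation p))) ->
  complex.Re (phi xi) * complex.Re (collision b phi xi) +
  complex.Im (phi xi) * complex.Im (collision b phi xi) <=
  cabs (phi xi) ^+ 2 * (2 * pi *
    (A * Rintegral mu `[0%R, pi]%classic (fun t => b' (cos t) * ((1 - cos t) / 2) * sin t) -
     c * Rintegral mu `[0%R, pi]%classic (fun t =>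
       b' (cos t) * Num.min 1 (enorm xi ^+ 2 * ((1 - cos t) / 2)) * sin t))).
Proof.
move=> A0 hG; set N := cabs _ ^+ 2; have N0 : 0 <= N by exact: sqr_ge0.
have [mr mi] := gain_loss_measurable.
have iR := gain_loss_integrable mr (@normr_Re_le R).
have iI := gain_loss_integrable mi (@normr_Im_le R).
have mD := @measurable_rect R 0 pi 0 (2 * pi).
have ReE : complex.Re (collision b phi xi) =
    Rintegral mu2 D (fun p => b' (u p) * complex.Re (gain_loss p) * sin p.1).
  rewrite /collision (negbTE xi0); apply: eq_Rintegral => p _.
  rewrite collision_integrandE; case: (gain_loss p) => g1 g2 /=.
  by rewrite mul0r subr0 mulrAC.
have ImE : complex.Im (collision b phi xi) =
    Rintegral mu2 D (fun p => b' (u p) * complex.Im (gain_loss p) * sin p.1).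
  rewrite /collision (negbTE xi0); apply: eq_Rintegral => p _.
  rewrite collision_integrandE; case: (gain_loss p) => g1 g2 /=.
  by rewrite mul0r addr0 mulrAC.
have sin0D p : D p -> 0 <= sin p.1.
  by move=> [/= + _]; rewrite in_itv /= => ?; exact: sin_ge0_pi.
have m1 : measurable_fun setT (id : R -> R) by exact: measurable_id.
have m2 : measurable_fun setT (fun y : R => Num.min 1 (enorm xi ^+ 2 * y)).
  by apply: measurable_minr => //; exact: measurable_funM.
have p1 (y : R) : 0 <= y <= 1 -> 0 <= id y <= 1 * y `^ 1.
  by move=> /andP[y0 _]; rewrite powRr1// mul1r lexx y0.
have p2 (y : R) : 0 <= y <= 1 ->
    0 <= Num.min 1 (enorm xi ^+ 2 * y) <= enorm xi ^+ 2 * y `^ 1.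
  move=> /andP[y0 _]; rewrite powRr1// le_min ler01 mulr_ge0 ?sqr_ge0//=.
  by rewrite ge_min lexx orbT.
have i1 := kernel_sphere_integrable m1 ltr01 p1.
have i2 := kernel_sphere_integrable m2 ltr01 p2.
have e1 := Rintegral_kernel_sphere m1 (fun y hy => proj1 (andP (p1 y hy))).
have e2 := Rintegral_kernel_sphere m2 (fun y hy => proj1 (andP (p2 y hy))).
have Z k (f : R * R -> R) : mu2.-integrable D (EFin \o f) ->
    mu2.-integrable D (EFin \o (fun p => k * f p)) := fun h => integrableZl mD k h.
have RZ k (f : R * R -> R) : mu2.-integrable D (EFin \o f) ->
    k * Rintegral mu2 D f = Rintegral mu2 D (fun p => k * f p).
  by move=> h; rewrite RintegralZl.
have i12 : mu2.-integrable D (EFin \o (fun p => A * (b' (u p) * id (deviation p) * sin p.1) -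
    c * (b' (u p) * Num.min 1 (enorm xi ^+ 2 * deviation p) * sin p.1))).
  exact: (integrableB mD (Z A _ i1) (Z c _ i2)).
have iRI : mu2.-integrable D (EFin \o (fun p =>
    complex.Re (phi xi) * (b' (u p) * complex.Re (gain_loss p) * sin p.1) +
    complex.Im (phi xi) * (b' (u p) * complex.Im (gain_loss p) * sin p.1))).
  exact: (integrableD mD (Z _ _ iR) (Z _ _ iI)).
have -> : N * (2 * pi *
    (A * Rintegral mu `[0%R, pi]%classic (fun t => b' (cos t) * ((1 - cos t) / 2) * sin t) -
     c * Rintegral mu `[0%R, pi]%classic (fun t =>
       b' (cos t) * Num.min 1 (enorm xi ^+ 2 * ((1 - cos t) / 2)) * sin t))) =
    Rintegral mu2 D (fun p => N * (A * (b' (u p) * id (deviation p) * sin p.1) -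
    c * (b' (u p) * Num.min 1 (enorm xi ^+ 2 * deviation p) * sin p.1))).
  rewrite -(RZ N _ i12) (RintegralB mD (Z A _ i1) (Z c _ i2)) -(RZ A _ i1) -(RZ c _ i2).
  by rewrite e1 e2; ring.
rewrite ReE ImE (RZ _ _ iR) (RZ _ _ iI) -(RintegralD mD (Z _ _ iR) (Z _ _ iI)).
apply: (le_Rintegral mD iRI (Z N _ i12)) => p hp_; have hp : D p by [].
have [u0|u0] := ltP (u p) 0.
  by rewrite kernel_ext_lt0// !(mul0r, mulr0) subrr mulr0 addr0.
have dp : 0 <= dot xi (spherical p) by move: u0; rewrite /u pmulr_lge0 ?invr_gt0.
have s0 : 0 <= sin p.1 by exact: sin0D.
have k0 : 0 <= b' (u p) by exact: kernel_ext_ge0.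
have := hG p dp.
move=> h; have := ler_wpM2l (mulr_ge0 k0 s0) h; congr (_ <= _); rewrite /N /=; ring.
Qed.

End integrand.

End direction.

End collision_estimate.

(** * The maximum principle *)

Section one_sided_derivatives.
Context {R : realType}.
Implicit Types (f : R -> R) (t l : R).

Lemma derivative_within_gt0 f t l : 0 < t ->
  derivative_within `[0, +oo[ f t l -> is_derive t (1 : R) f l.
Proof.
move=> t0 hf.
have C : (fun h => h^-1 *: ((f \o shift t) (h *: 1) - f t)) @ 0^' --> l.
  apply/cvgrPdist_le => e e0.
  have /cvgrPdist_le/(_ e e0)/nbhs_ballP[d /= d0 hd] := hf.
  have m0 : 0 < Num.min d t by rewrite lt_min d0.
  apply/nbhs_ballP; exists (Num.min d t) => //= h.
  rewrite /ball /= sub0r normrN lt_min => /andP[hd1 ht] h0.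
  have := hd (h + t); rewrite /ball /= opprD addrCA subrr addr0 normrN.
  move=> /(_ hd1) H; rewrite scaler1 /= /GRing.scale /= mulrC.
  have := H; rewrite addrK; apply.
    by rewrite -subr_eq0 addrK.
  by rewrite in_itv /= andbT -lerBlDr sub0r; move: ht; rewrite ltr_norml => /andP[/ltW].
apply: DeriveDef; first by apply/cvg_ex; exists l.
exact/cvg_lim.
Qed.

(** Only the values to the left of t enter, so t may be the final time. *)
Lemma left_max_derive_ge0 f t l : 0 < t -> is_derive t (1 : R) f l ->
  (forall u, 0 <= u <= t -> f u <= f t) -> 0 <= l.
Proof.
move=> t0 df hm; rewrite leNgt; apply/negP => l0.
have [/cvg_ex[l' hl'] dl] := df.
have ll : l' = l by rewrite -dl; apply/esym/cvg_lim.
rewrite ll in hl'; move/cvgrPdist_lt : hl' => /(_ (- l)); rewrite oppr_gt0 => /(_ l0).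
move=> /nbhs_ballP[d /= d0 hd].
pose h := - (Num.min d t / 2).
have m0 : 0 < Num.min d t by rewrite lt_min d0.
have hm0 : h < 0 by rewrite oppr_lt0 divr_gt0.
have [md mt] : Num.min d t <= d /\ Num.min d t <= t by rewrite !ge_min !lexx orbT.
have := hd h; rewrite /ball /= sub0r normrN (ltr0_norm hm0) /h opprK.
rewrite (_ : Num.min d t / 2 < d); last by lra.
move=> /(_ isT); rewrite -/h lt_eqF// => /(_ isT).
rewrite scaler1 /GRing.scale /= ltr_norml => /andP[h1 _].
have : 0 <= h^-1 * (f (h + t) - f t).
  rewrite nmulr_rge0 ?invr_lt0// subr_le0 hm//.
  by apply/andP; split; rewrite /h; lra.
by move=> h2; lra.
Qed.

End one_sided_derivatives.

Section kernel_growth.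
Context {R : realType}.
Variables (s : R) (b : R -> R).
Hypotheses (hs : 0 < s < 2) (hb : collision_kernel b) (hbs : debye_yukawa s b).
Local Notation mu := (@lebesgue_measure R).

(** Up to the factor 2 pi, the integral over the sphere of b h(y). *)
Definition angular_moment (h : R -> R) : R := Rintegral mu `[0%R, pi]%classic
  (fun t => kernel_ext b (cos t) * h ((1 - cos t) / 2) * sin t).

Lemma angular_moment_growth (L : R) : 0 < L -> exists2 r0 : R, 2 <= r0 &
  forall r, r0 <= r -> L * ln r <= angular_moment (fun y => Num.min 1 (r ^+ 2 * y)).
Proof.
move=> L0; have [r0 r2 hr0] := kernel_angle_growth hs hb hbs L0.
exists r0 => // r hr; rewrite -lee_fin; apply: le_trans (hr0 r hr) _.
have mint h : measurable_fun setT h -> measurable_fun `[0%R, pi]%classic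
    (fun t : R => (kernel_ext b (cos t) * h ((1 - cos t) / 2) * sin t)%:E).
  move=> mh; apply/measurable_EFinP; apply: measurable_funTS.
  exact: measurable_kernel_angle.
have y01 (t : R) : 0 <= (1 - cos t) / 2 by rewrite divr_ge0 ?subr_ge0 ?cos_le1.
have f0 (t : R) h : `[0%R, pi]%classic t -> 0 <= h -> 0 <= kernel_ext b (cos t) * h * sin t.
  rewrite /= in_itv /= => ht h0; rewrite mulr_ge0 ?sin_ge0_pi// mulr_ge0// kernel_ext_ge0//.
have m1 : measurable_fun setT (fun y : R => r ^+ 2 * y `^ 1).
  by apply: measurable_funM => //; exact: measurable_powR.
rewrite fineK// ge0_fin_numE; last first.
  apply: integral_ge0 => t ht; rewrite lee_fin f0// le_min ler01 mulr_ge0 ?sqr_ge0//.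
apply: (@le_lt_trans _ _ (\int[mu]_(t in `[0%R, pi]%classic)
   ((r ^+ 2)%:E * (kernel_ext b (cos t) * ((1 - cos t) / 2) `^ 1 * sin t)%:E))%E).
  apply: ge0_le_integral => //.
  - move=> t ht; rewrite lee_fin f0// le_min ler01 mulr_ge0 ?sqr_ge0//.
  - by apply: (mint (fun y => Num.min 1 (r ^+ 2 * y))); apply: measurable_minr => //; exact: measurable_funM.
  - apply: measurable_funeM; exact: mint (@measurable_powR R 1).
  - move=> t ht; rewrite -EFinM lee_fin powRr1// [leRHS]mulrA ler_wpM2r//.
      by move: ht; rewrite /= in_itv /= => ht; exact: sin_ge0_pi.
    by rewrite [leRHS]mulrCA ler_wpM2l ?kernel_ext_ge0// ge_min lexx orbT.
rewrite ge0_integralZl//.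
- rewrite lte_mul_pinfty ?lee_fin ?sqr_ge0//.
  exact: (kernel_angle_lty hs hb hbs ltr01).
- exact: mint (@measurable_powR R 1).
- by move=> t ht; rewrite lee_fin f0// powR_ge0.
- by rewrite lee_fin sqr_ge0.
Qed.

End kernel_growth.

Section evolution.
Context {R : realType}.
Variables (alpha : R) (psi : R -> vec3 R -> R[i]).
Hypotheses (al0 : 0 < alpha) (hpsi : continuous_in_Kalpha alpha psi).

Lemma continuous_max0 : continuous (fun u : R => Num.max 0 u).
Proof.
by move=> u; apply: (@continuous_max R R^o (fun=> 0) id); [exact: cvg_cst|exact: cvg_id].
Qed.

Lemma evolution_time_near (t e : R) : 0 < e ->
  \forall u \near t, forall xi,
    cabs (psi (Num.max 0 u) xi - psi (Num.max 0 t) xi) <= e * enorm xi `^ alpha.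
Proof.
move=> e0; case: hpsi => hK hC.
have m0 u : 0 <= Num.max 0 u :> R by rewrite le_max lexx.
have W := hC _ (m0 t).
have N : within `[0, +oo[%classic (nbhs (Num.max 0 t))
    (fun u : R => (dist_alpha alpha (psi u) (psi (Num.max 0%R t)) < e%:E)%E).
  have e0E : (0%E < e%:E :> \bar R)%E by rewrite lte_fin.
  exact: (W _ (open_ereal_lt' e0E)).
have := continuous_max0 (x := t) N; rewrite /nbhs /=.
apply: (@filterS _ (nbhs t)) => u /= hu xi.
apply: dist_alpha_le => //.
  by rewrite !charK0//; [exact: (proj1 (hK _ (m0 t)))|exact: (proj1 (hK _ (m0 u)))].
by apply/ltW/hu; rewrite /= in_itv /= andbT.
Qed.

(** Joint continuity.  Times are replaced by their positive part to work on the
whole line; continuity in t is uniform on bounded sets of xi since the distance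
weighs the difference by |xi|^-alpha, and continuity in xi comes from
[charK_close]. *)
Lemma evolution_near (t e : R) (xi : vec3 R) : 0 < e ->
  \forall x \near (t, xi),
    cabs (psi (Num.max 0 t) xi - psi (Num.max 0 x.1) x.2) <= e.
Proof.
move=> e0; have m0 u : 0 <= Num.max 0 u :> R by rewrite le_max lexx.
have [hK _] := hpsi.
have e2 : 0 < e / 2 by rewrite divr_gt0.
have [C C0 hC] := charKalpha_bound al0 (hK _ (m0 t)).
have [d d0 hd] := charK_close al0 C0 e2.
have d2 : 0 < d / 2 by rewrite divr_gt0.
pose M := (enorm xi + 1) `^ alpha.
have M0 : 0 < M by rewrite powR_gt0// ltr_wpDl ?enorm_ge0.
have eM : 0 < e / 2 / M by rewrite divr_gt0.
have N1 := evolution_time_near t eM.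
have N2 : \forall y \near xi, ball xi (d / 2) y by exact: nbhsx_ballx.
have N3 : \forall y \near xi, enorm y < enorm xi + 1.
  have /cvgrPdist_lt/(_ 1 ltr01) := @continuous_enorm R xi.
  by apply: filterS => y; rewrite ltr_norml => /andP[h _]; lra.
near=> x.
have h1 : forall xi, cabs (psi (Num.max 0 x.1) xi - psi (Num.max 0 t) xi) <=
    e / 2 / M * enorm xi `^ alpha by near: x; exact: (cvg_fst N1).
have h2 : ball xi (d / 2) x.2 by near: x; exact: (cvg_snd N2).
have h3 : enorm x.2 < enorm xi + 1 by near: x; exact: (cvg_snd N3).
rewrite (_ : _ - _ = (psi (Num.max 0 t) xi - psi (Num.max 0 t) x.2) -
  (psi (Num.max 0 x.1) x.2 - psi (Num.max 0 t) x.2)); last by ring.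
apply: le_trans (le_cabsD _ _) _; rewrite [leRHS](splitr e); apply: lerD.
  apply: hd (proj1 (hK _ (m0 t))) hC _.
  by have := enorm_le_of_ball d2 h2; rewrite mulrC divfK.
have -> z : cabs (- z) = cabs z :> R by exact: normcN.
apply: le_trans (h1 _) _; rewrite -mulrA ler_piMr ?(ltW e2)//.
rewrite mulrC ler_pdivrMr// mul1r; apply: ge0_ler_powR; rewrite ?nnegrE ?enorm_ge0 ?(ltW al0)//.
  by rewrite addr_ge0 ?enorm_ge0.
exact: ltW.
Unshelve. all: by end_near. Qed.

Lemma evolution_continuous :
  continuous (fun x : R * vec3 R => complex.Re (psi (Num.max 0 x.1) x.2)) /\
  continuous (fun x : R * vec3 R => complex.Im (psi (Num.max 0 x.1) x.2)).
Proof.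
have parts (z w : R[i]) (e : R) : cabs (z - w) <= e ->
    `|complex.Re z - complex.Re w| <= e /\ `|complex.Im z - complex.Im w| <= e.
  move=> h; have := le_trans (normr_Re_le (z - w)) h; have := le_trans (normr_Im_le (z - w)) h.
  by case: z w {h} => ? ? [].
split=> -[t xi]; apply/cvgrPdist_le => e e0; have := evolution_near t xi e0;
  by apply: filterS => x /= /parts[].
Qed.

End evolution.

Section maximum_principle.
Context {R : realType}.
Variables (s : R) (b : R -> R).
Hypotheses (hs : 0 < s < 2) (hb : collision_kernel b) (hbs : debye_yukawa s b).

(** - ln (1 - y) = ln (1 + y / (1 - y)) <= y / (1 - y) <= 2 y. *)
Lemma neg_ln_le (y : R) : 0 <= y <= 2^-1 -> - ln (1 - y) <= 2 * y.
Proof.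
move=> /andP[y0 y1]; have y2 : 0 < 1 - y by lra.
rewrite -lnV ?posrE//.
have -> : (1 - y)^-1 = 1 + y / (1 - y) by field; rewrite gt_eqF.
apply: le_trans (le_ln1Dx _) _; first by apply: lt_le_trans (ltrN10 _) _; rewrite divr_ge0// ltW.
by rewrite ler_pdivrMr//; nra.
Qed.

(** The factor expR a comes from 1 - x <= expR (- x) multiplied by expR x. *)
Lemma expR_le_affine (a x : R) : 0 <= x <= a -> expR x <= 1 + x * expR a.
Proof.
move=> /andP[x0 xa].
have h1 : expR x <= 1 + x * expR x.
  have := expR_ge1Dx (- x); rewrite expRN => h.
  have := ler_wpM2r (expR_ge0 x) h; rewrite mulVf ?expR_eq0// mulrDl mul1r mulNr.
  by lra.
by apply: le_trans h1 _; rewrite lerD2l ler_wpM2l// ler_expR.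
Qed.

Lemma compact_annulus (rho : R) :
  compact [set xi : vec3 R | 1 <= dot xi xi <= rho ^+ 2].
Proof.
have c : continuous (fun xi : vec3 R => dot xi xi).
  by apply: (@continuous_dot R id id) => x; exact: cvg_id.
pose I := `[- `|rho|, `|rho|]%classic.
have cI : compact I by exact: segment_compact.
apply: (@subclosed_compact _ _ (I `*` I `*` I)).
- have -> : [set xi : vec3 R | 1 <= dot xi xi <= rho ^+ 2] =
      (fun xi : vec3 R => dot xi xi) @^-1` `[1, rho ^+ 2]%classic.
    by apply/seteqP; split => xi /=; rewrite in_itv.
  have /continuous_closedP := c; apply; exact: interval_closed.
- by apply: compact_setX => //; exact: compact_setX.
- move=> [[x y] z] /=; rewrite /dot /= -!expr2 => /andP[_ h].
  have sq (a : R) : a ^+ 2 <= rho ^+ 2 -> I a.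
    move=> ha; rewrite /I /= in_itv /= -ler_norml -ler_sqr ?nnegrE//.
    by rewrite !real_normK ?num_real.
  have := sqr_ge0 x; have := sqr_ge0 y; have := sqr_ge0 z.
  by move=> ? ? ?; split; [split|]; apply: sq; rewrite /=; lra.
Qed.

Section decay.
Variables (alpha : R) (psi : R -> vec3 R -> R[i]) (T Dc lam : R).
Hypotheses (al0 : 0 < alpha) (hpsi : continuous_in_Kalpha alpha psi).
Hypothesis heq : forall (t : R) (xi : vec3 R), 0 <= t ->
  cderivative_within `[0, +oo[ (fun u => psi u xi) t (collision b (psi t) xi).
Hypotheses (T0 : 0 < T) (Dc0 : 0 < Dc) (lam0 : 0 < lam).
Hypothesis coercive : forall t xi, 0 <= t <= T ->
  Dc * Num.min 1 (enorm xi ^+ 2) <= 1 - cabs (psi t xi).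

Let K t (t0 : 0 <= t) : charKalpha alpha (psi t) := (proj1 hpsi) t t0.

Let A := lam * T * expR (lam * T).

Let A0 : 0 <= A.
Proof. by rewrite /A mulr_ge0 ?expR_ge0 ?mulr_ge0 ?ltW. Qed.

(** |psi|^2 |xi|^(2 lam t). *)
Definition weighted_modulus (t : R) (xi : vec3 R) : R :=
  cabs (psi t xi) ^+ 2 * expR (lam * t * ln (dot xi xi)).

(** Comparing the weighted moduli at xi^+ and xi, and using |xi^+|^2 = |xi|^2 (1 - y),
gives |psi(xi^+)| <= |psi(xi)| (1 - y)^(- lam t / 2) <= |psi(xi)| (1 + A y).  With
|psi(xi^-)| <= 1 - Dc min(1, r^2 y), the product psi(xi^+) psi(xi^-) is at most
|psi(xi)| (1 + A y - Dc min(1, r^2 y)). *)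
Lemma gain_loss_at_maximum (t : R) (xi : vec3 R) p :
  0 <= t <= T -> 2 <= enorm xi -> 0 <= dot xi (spherical p) ->
  weighted_modulus t (xi_plus xi (spherical p)) <= weighted_modulus t xi ->
  complex.Re (psi t xi) * complex.Re (gain_loss xi (psi t) p) +
  complex.Im (psi t xi) * complex.Im (gain_loss xi (psi t) p) <=
  cabs (psi t xi) ^+ 2 *
    (A * deviation xi p - Dc * Num.min 1 (enorm xi ^+ 2 * deviation xi p)).
Proof.
move=> htT r2 u0; have /andP[t0 tT] := htT.
have xi0 : xi != 0.
  by apply/eqP => xi0; move: r2; rewrite xi0 enorm0; lra.
have r0 := enorm_gt0 xi0.
have mE := sqr_enorm_minus xi0 (dot_spherical p); have pE := sqr_enorm_plus xi0 (dot_spherical p).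
rewrite -/(deviation xi p) in mE pE.
have /andP[y0 _] := deviation_bounds xi0 p.
have y1 : deviation xi p <= 2^-1.
  by rewrite /deviation; have : 0 <= dot xi (spherical p) / enorm xi; [rewrite divr_ge0 ?enorm_ge0|lra].
set y := deviation xi p in mE pE y0 y1 *.
rewrite /weighted_modulus -!sqr_enorm pE /gain_loss.
have := coercive (xi_minus xi (spherical p)) htT; rewrite mE.
have := charK_le1 (xi_minus xi (spherical p)) (proj1 (K t0)).
set z := psi t xi; set a := psi t (xi_plus _ _); set c := psi t (xi_minus _ _).
set m := Num.min 1 _ => c1 cD hmax.
have y2 : 0 < 1 - y by lra.
have N0 := cabs_ge0 z.
have a1 : cabs a <= cabs z * (1 + A * y).
  apply: (@le_trans _ _ (cabs z * expR (lam * t * y))); last first.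
    rewrite ler_wpM2l//; apply: (@le_trans _ _ (1 + lam * t * y * expR (lam * T))).
      apply: expR_le_affine; apply/andP; split.
        by apply: mulr_ge0 => //; apply: mulr_ge0 => //; exact: ltW.
      by rewrite -mulrA ler_pM2l// -[leRHS]mulr1 ler_pM//; lra.
    rewrite lerD2l /A [leRHS]mulrAC ler_wpM2r ?expR_ge0// ler_wpM2r// ler_pM2l//.
  rewrite -ler_sqr ?nnegrE ?mulr_ge0 ?expR_ge0 ?cabs_ge0// exprMn.
  move: hmax; rewrite -ler_pdivlMr ?expR_gt0// => /le_trans; apply.
  rewrite -[leLHS]mulrA -expRN -expRD [X in _ <= _ * X]expr2 -expRD ler_wpM2l ?sqr_ge0// ler_expR.
  rewrite lnM ?posrE ?exprn_gt0//.
  have := neg_ln_le; move=> /(_ y); rewrite y0 y1 => /(_ isT) hl.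
  have lt0 : 0 <= lam * t by apply: mulr_ge0 => //; exact: ltW.
  by have := ler_wpM2l lt0 hl; lra.
have acE : complex.Re z * complex.Re (a * c - z) + complex.Im z * complex.Im (a * c - z) =
    complex.Re z * complex.Re (a * c) + complex.Im z * complex.Im (a * c) - cabs z ^+ 2.
  by rewrite sqr_cabs; case: (z) (a * c) => z1 z2 [w1 w2] /=; ring.
rewrite acE; have := re_conjM_le z (a * c); rewrite cabsM => h.
have h2 : cabs z * (cabs a * cabs c) <= cabs z ^+ 2 * (1 + A * y - Dc * m).
  rewrite [X in _ <= X * _]expr2 -[leRHS]mulrA ler_wpM2l//.
  apply: (@le_trans _ _ (cabs z * (1 + A * y) * cabs c)).
    by rewrite ler_wpM2r// cabs_ge0.
  rewrite -[leLHS]mulrA ler_wpM2l//; have : A * y * cabs c <= A * y.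
    by rewrite ler_piMr// mulr_ge0.
  by lra.
by lra.
Qed.

Lemma is_derive_weighted_modulus (t : R) (xi : vec3 R) : 0 < t ->
  is_derive t (1 : R) (fun u => weighted_modulus u xi)
    (expR (lam * t * ln (dot xi xi)) *
     (2 * (complex.Re (psi t xi) * complex.Re (collision b (psi t) xi) +
           complex.Im (psi t xi) * complex.Im (collision b (psi t) xi)) +
      lam * ln (dot xi xi) * cabs (psi t xi) ^+ 2)).
Proof.
move=> t0; have [dR dI] := heq xi (ltW t0).
have {}dR := derivative_within_gt0 t0 dR; have {}dI := derivative_within_gt0 t0 dI.
have dE : is_derive t (1 : R) (fun u => expR (ln (dot xi xi) * (lam * u)))
    (expR (ln (dot xi xi) * (lam * t)) * (ln (dot xi xi) * (lam * 1))).
  have dL : is_derive t (1 : R) (fun u => ln (dot xi xi) * (lam * u)) (ln (dot xi xi) * (lam * 1)).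
    exact: is_deriveZR (@is_deriveZR _ id lam t 1 (is_derive_id _ _)).
  apply: (@is_derive_compR R expR (fun u => ln (dot xi xi) * (lam * u))).
have := is_deriveMR (is_deriveDR (is_deriveMR dR dR) (is_deriveMR dI dI)) dE.
rewrite (_ : (fun u => _) = (fun u => weighted_modulus u xi)); last first.
  by apply/funext => u; rewrite /weighted_modulus sqr_cabs -!expr2; congr (_ * expR _); ring.
congr (is_derive _ _ _ _); rewrite sqr_cabs (_ : ln (dot xi xi) * (lam * t) = lam * t * ln (dot xi xi)); ring.
Qed.

(** The maximum over [0, T] x (1 <= |xi| <= rho) is attained.  If it is attained at
a time t > 0 with |xi| > r1, the time derivative there is negative by
[gain_loss_at_maximum] and [angular_moment_growth], although values at earlier times
are not larger.  Otherwise the weighted modulus is at most M = r1^(2 lam T), a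
bound independent of rho. *)
Lemma weighted_modulus_bound : exists2 M : R, 1 <= M &
  forall t xi, 0 <= t <= T -> 1 <= enorm xi -> weighted_modulus t xi <= M.
Proof.
pose J1 := angular_moment b id.
(* with 4 pi Dc L = 2 lam + 1 the loss exceeds the growth 2 lam ln r of the weight by ln r *)
pose L := (2 * lam + 1) / (4 * pi * Dc).
have pp : 0 < pi :> R := pi_gt0 R.
have L0 : 0 < L by rewrite divr_gt0 ?mulr_gt0// addr_gt0 ?mulr_gt0.
have [r0 r02 hr0] := angular_moment_growth hs hb hbs L0.
(* beyond r1 this surplus ln r exceeds the contribution 4 pi A J1 of the gain *)
pose r1 := Num.max r0 (expR (4 * pi * A * J1)).
have r1p : 2 <= r1 by rewrite le_max r02.
have ln1_ : 0 <= ln r1 by rewrite ln_ge0// (le_trans _ r1p)// ler1n.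
pose M := expR (lam * T * (2 * ln r1)).
have M1 : 1 <= M by rewrite -expR0 ler_expR mulr_ge0 ?mulr_ge0// ltW.
exists M => // t xi htT xi1.
pose rho := enorm xi.
pose S := [set x : R * vec3 R | 0 <= x.1 <= T /\ 1 <= dot x.2 x.2 <= rho ^+ 2].
(* truncated so as to be continuous everywhere; on S it is the weighted modulus *)
pose q (x : R * vec3 R) := (complex.Re (psi (Num.max 0 x.1) x.2) ^+ 2 +
  complex.Im (psi (Num.max 0 x.1) x.2) ^+ 2) *
  expR (lam * x.1 * ln (Num.max 1 (dot x.2 x.2))).
have qE x : S x -> q x = weighted_modulus x.1 x.2.
  by move=> [/andP[x0 _] /andP[h1 _]]; rewrite /q /weighted_modulus sqr_cabs !max_r.
have cS : compact S.
  have -> : S = `[0, T]%classic `*` [set xi : vec3 R | 1 <= dot xi xi <= rho ^+ 2].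
    by apply/seteqP; split => x /=; rewrite in_itv /=.
  by apply: compact_setX; [exact: segment_compact|exact: compact_annulus].
have Sx : S (t, xi).
  split => //=; rewrite -sqr_enorm lexx andbT -[1](expr1n _ 2) lerXn2r ?nnegrE ?enorm_ge0//.
have cq : continuous q.
  have [cr ci] := evolution_continuous al0 hpsi.
  have cd : continuous (fun x : R * vec3 R => dot x.2 x.2).
    have c : continuous (fun xi : vec3 R => dot xi xi).
      by apply: (@continuous_dot R id id) => y; exact: cvg_id.
    by move=> x; apply: (cvg_comp snd (fun xi : vec3 R => dot xi xi)); [exact: cvg_snd|exact: c].
  have cm : continuous (fun x : R * vec3 R => Num.max 1 (dot x.2 x.2)).
    move=> x; apply: (@continuous_max R _ (fun=> 1) (fun x : R * vec3 R => dot x.2 x.2)).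
      exact: cvg_cst.
    exact: cd.
  have cl : continuous (fun x : R * vec3 R => ln (Num.max 1 (dot x.2 x.2))).
    move=> x; apply: (cvg_comp (fun x : R * vec3 R => Num.max 1 (dot x.2 x.2)) (@ln R)).
      exact: cm.
    by apply: continuous_ln; rewrite lt_max ltr01.
  move=> x; apply: cvgM.
    exact: cvgD (cvgM (cr x) (cr x)) (cvgM (ci x) (ci x)).
  apply: (cvg_comp (fun x : R * vec3 R => lam * x.1 * ln (Num.max 1 (dot x.2 x.2))) expR).
    by apply: cvgM; [apply: cvgM; [exact: cvg_cst|exact: cvg_fst]|exact: cl].
  exact: continuous_expR.
have [[t' xi'] /set_mem Sx' hmax] := @compact_EVT_max _ R q S (ex_intro _ _ Sx) cS
  (continuous_subspaceT cq).
apply: (@le_trans _ _ (q (t', xi'))).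
  by rewrite -[leLHS](qE (t, xi) Sx); apply: hmax; exact: mem_set.
rewrite (qE _ Sx') /=; have [/= ht' hd'] := Sx'; have /andP[t0' tT'] := ht'.
have /andP[d1 d2] := hd'.
have e1 : 1 <= enorm xi'.
  by rewrite -(@ler_sqr _ 1) ?nnegrE ?enorm_ge0// expr1n sqr_enorm.
have ld : ln (dot xi' xi') = 2 * ln (enorm xi').
  by rewrite -sqr_enorm lnXn ?mulr_natl// (lt_le_trans _ e1).
have c1 : cabs (psi t' xi') ^+ 2 <= 1.
  by rewrite expr_le1 ?cabs_ge0// charK_le1//; exact: (proj1 (K t0')).
have [small|large] := leP (enorm xi') r1.
  rewrite /weighted_modulus -[leRHS]mul1r ler_pM ?expR_ge0 ?sqr_ge0// ler_expR.
  rewrite ld; have l0 := ln_ge0 e1.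
  have ll : ln (enorm xi') <= ln r1.
    by rewrite ler_ln ?posrE// ?(lt_le_trans _ e1)// (lt_le_trans _ r1p).
  apply: ler_pM; rewrite ?mulr_ge0 ?(ltW lam0)//.
    by rewrite ler_pM2l.
  by rewrite ler_pM2l.
move: t0'; rewrite le_eqVlt => /predU1P[t0E|t0'].
  by rewrite /weighted_modulus -t0E mulr0 mul0r expR0 mulr1 t0E (le_trans c1).
have [z0|z0] := eqVneq (cabs (psi t' xi')) 0.
  by rewrite /weighted_modulus z0 expr0n /= mul0r (le_trans ler01).
exfalso.
have N0 : 0 < cabs (psi t' xi') ^+ 2 by rewrite exprn_gt0// lt0r z0 cabs_ge0.
have r2 : 2 <= enorm xi' by rewrite (le_trans r1p)// ltW.
have xi0 : xi' != 0 by apply/eqP => x0; move: r2; rewrite x0 enorm0; lra.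
have gl p : 0 <= dot xi' (spherical p) ->
    complex.Re (psi t' xi') * complex.Re (gain_loss xi' (psi t') p) +
    complex.Im (psi t' xi') * complex.Im (gain_loss xi' (psi t') p) <=
    cabs (psi t' xi') ^+ 2 *
      (A * deviation xi' p - Dc * Num.min 1 (enorm xi' ^+ 2 * deviation xi' p)).
  move=> u0; apply: gain_loss_at_maximum => //.
  have pE := sqr_enorm_plus xi0 (dot_spherical p).
  have /andP[y0 _] := deviation_bounds xi0 p.
  rewrite -/(deviation xi' p) in pE.
  have y1 : deviation xi' p <= 2^-1.
    rewrite /deviation; have : 0 <= dot xi' (spherical p) / enorm xi' by rewrite divr_ge0 ?enorm_ge0.
    by lra.
  have Sp : S (t', xi_plus xi' (spherical p)).
    split => //=; rewrite -sqr_enorm pE; apply/andP; split; first by nra.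
    apply: le_trans d2; rewrite -sqr_enorm ler_piMr ?sqr_ge0//; lra.
  have := hmax _ (mem_set Sp).
  by rewrite (qE _ Sp) (qE _ Sx').
have diss := collision_inner_le hs hb hbs xi0 al0 (K (ltW t0')) A0 gl.
have := left_max_derive_ge0 t0' (is_derive_weighted_modulus xi' t0').
have left u : 0 <= u <= t' -> weighted_modulus u xi' <= weighted_modulus t' xi'.
  move=> /andP[u0 ut].
  have Su : S (u, xi') by split => //=; rewrite u0 (le_trans ut).
  by have := hmax _ (mem_set Su); rewrite (qE _ Su) (qE _ Sx').
move=> /(_ left); rewrite pmulr_rge0 ?expR_gt0// leNgt => /negP; apply.
rewrite ld.
have g : L * ln (enorm xi') <= angular_moment b (fun y => Num.min 1 (enorm xi' ^+ 2 * y)).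
  by apply: hr0; apply: le_trans (ltW large); rewrite le_max lexx.
have lnr : 4 * pi * A * J1 < ln (enorm xi').
  rewrite -[ltLHS]expRK ltr_ln ?posrE ?expR_gt0 ?enorm_gt0//.
  by apply: le_lt_trans large; rewrite le_max lexx orbT.
have LE : 4 * pi * Dc * L = 2 * lam + 1.
  by rewrite /L mulrC divfK// gt_eqF// !mulr_gt0.
set J2 := angular_moment _ _ in g.
have {}diss : complex.Re (psi t' xi') * complex.Re (collision b (psi t') xi') +
  complex.Im (psi t' xi') * complex.Im (collision b (psi t') xi') <=
  cabs (psi t' xi') ^+ 2 * (2 * pi * (A * J1 - Dc * J2)) by exact: diss.
have J2b : (2 * lam + 1) * ln (enorm xi') <= 4 * pi * Dc * J2.
  by rewrite -LE -mulrA ler_pM2l// !mulr_gt0.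
set X := _ + _ in diss; set N := cabs _ ^+ 2 in diss N0 *.
apply: (@le_lt_trans _ _ (N * (4 * pi * A * J1 - 4 * pi * Dc * J2 + 2 * lam * ln (enorm xi')))).
  by rewrite -/X; move: diss; set l := ln _; lra.
by rewrite pmulr_rlt0//; lra.
Qed.

End decay.

End maximum_principle.

(** * Sobolev regularity *)

(** For a given t the exponent is free: lam = (k + 3) / t makes |xi|^(2 lam t) the power
that absorbs both (1 + |xi|^2)^k and the inverse of the weight. *)
Lemma polynomial_decay (R : realType) (s : R) (hs : 0 < s < 2)
  (b : R -> R) (hb : collision_kernel b) (hbs : debye_yukawa s b)
  (alpha : R) (al0 : 0 < alpha) (psi : R -> vec3 R -> R[i])
  (hpsi : continuous_in_Kalpha alpha psi)
  (heq : forall (t : R) (xi : vec3 R), 0 <= t ->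
    cderivative_within `[0, +oo[ (fun u => psi u xi) t (collision b (psi t) xi))
  (T Dc : R) (T0 : 0 < T) (Dc0 : 0 < Dc)
  (coercive : forall t xi, 0 <= t <= T ->
    Dc * Num.min 1 (enorm xi ^+ 2) <= 1 - cabs (psi t xi))
  (t k : R) : 0 < t <= T -> 0 <= k -> exists C : R, forall xi,
    (1 + enorm xi ^+ 2) `^ k * cabs (psi t xi) ^+ 2 <= C * weight xi.
Proof.
move=> /andP[t0 tT] k0.
have lam0 : 0 < (k + 3) / t by rewrite divr_gt0// ltr_wpDl.
have [M M1 hM] := weighted_modulus_bound hs hb hbs al0 hpsi heq T0 Dc0 lam0 coercive.
have k3 : 0 <= k + 3 by rewrite addr_ge0.
exists (2 `^ (k + 3) * M) => xi.
have t01 : 0 <= t <= T by rewrite ltW.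
have p0 : 0 < 1 + enorm xi ^+ 2 by rewrite ltr_pwDl ?sqr_ge0.
have c1 : cabs (psi t xi) ^+ 2 <= 1.
  by rewrite expr_le1 ?cabs_ge0// charK_le1//; exact: (proj1 (proj1 hpsi t (ltW t0))).
rewrite -ler_pdivrMr ?weight_gt0//.
apply: (@le_trans _ _ ((1 + enorm xi ^+ 2) `^ (k + 3) * cabs (psi t xi) ^+ 2)).
  rewrite mulrAC ler_wpM2r ?sqr_ge0// powRD; last by rewrite (gt_eqF p0) implybT.
  rewrite ler_wpM2l ?powR_ge0// -[3]/(3%:R) powR_mulrn ?(ltW p0)//.
  exact: weight_inv_le.
have [x1|x1] := leP 1 (enorm xi); last first.
  rewrite -[leRHS]mulr1 -mulrA; apply: ler_pM; rewrite ?powR_ge0 ?sqr_ge0//.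
    apply: ge0_ler_powR; rewrite ?nnegrE ?(ltW p0)//.
    have : enorm xi ^+ 2 <= 1 by rewrite expr_le1 ?enorm_ge0// ltW.
    by lra.
  by rewrite mulr1 (le_trans c1).
have r0 : 0 < enorm xi by exact: lt_le_trans x1.
apply: (@le_trans _ _ ((2 * enorm xi ^+ 2) `^ (k + 3) * cabs (psi t xi) ^+ 2)).
  rewrite ler_wpM2r ?sqr_ge0//; apply: ge0_ler_powR; rewrite ?nnegrE ?(ltW p0)//.
    by rewrite mulr_ge0 ?sqr_ge0.
  have : 1 <= enorm xi ^+ 2 by rewrite expr_ge1 ?enorm_ge0.
  by lra.
rewrite powRM ?sqr_ge0// -mulrA ler_wpM2l ?powR_ge0// mulrC.
have := hM t xi t01 x1; rewrite /weighted_modulus divfK ?gt_eqF// -sqr_enorm.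
by rewrite /powR gt_eqF ?exprn_gt0.
Qed.

Theorem proposition1p3 (R : realType) (s : R) (hs : 0 < s < 2)
  (b : R -> R) (hb : collision_kernel b) (hbs : debye_yukawa s b)
  (alpha : R) (halpha : 0 < alpha)
  (psi0 : vec3 R -> R[i]) (hpsi0 : charKalpha alpha psi0)
  (psi : R -> vec3 R -> R[i]) (hpsi : solution alpha b psi0 psi)
  (T : R) (hT : 0 < T)
  (hcoercive : exists D_T : R, 0 < D_T /\
     forall xi : vec3 R,
       inf [set 1 - cabs (psi t xi) | t in `[0, T]]
         >= D_T * Num.min 1 (enorm xi ^+ 2)) :
  forall t : R, 0 < t <= T ->
    sobolev_infty (inv_fourier_distr (regular_distr (psi t))).
Proof.
move=> t ht k k0; have /andP[t0 tT] := ht.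
case: hpsi => hC _ heq _; case: hcoercive => Dc [Dc0 hinf].
have K := proj1 hC t (ltW t0).
have coercive u xi : 0 <= u <= T -> Dc * Num.min 1 (enorm xi ^+ 2) <= 1 - cabs (psi u xi).
  move=> hu; apply: le_trans (hinf xi) _; apply: ge_inf.
    exists 0 => _ /= [v + <-]; rewrite in_itv /= => /andP[v0 _].
    by rewrite subr_ge0 charK_le1//; exact: (proj1 (proj1 hC v v0)).
  by exists u => //; rewrite /= in_itv.
have [C hCw] := polynomial_decay hs hb hbs halpha hC heq hT Dc0 coercive ht k0.
have [cr ci] := charKalpha_continuous halpha K.
exists (psi t); split.
- exact: continuous3_measurable cr.
- exact: continuous3_measurable ci.
- apply: integrable_lty => //.
  apply: (@dominated_integrable3 R _ C).
    apply: measurable_funM.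
      apply: (measurableT_comp (@measurable_powR R k)).
      apply: (@continuous3_measurable R (fun xi => 1 + enorm xi ^+ 2)) => x.
      apply: cvgD; first exact: cvg_cst.
      exact: cvgM (@continuous_enorm R x) (@continuous_enorm R x).
    apply: (@continuous3_measurable R (fun xi => cabs (psi t xi) ^+ 2)).
    rewrite (_ : (fun xi => _) = fun xi => complex.Re (psi t xi) * complex.Re (psi t xi) +
      complex.Im (psi t xi) * complex.Im (psi t xi)).
      by move=> x; exact: cvgD (cvgM (cr x) (cr x)) (cvgM (ci x) (ci x)).
    by apply/funext => xi; rewrite sqr_cabs -!expr2.
  move=> xi; rewrite ger0_norm; first exact: hCw.
  by apply: mulr_ge0; [exact: powR_ge0|exact: sqr_ge0].
(* testing against phi transfers both transforms to phi, where they cancel *)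
- move=> phi hphi; rewrite /fourier_distr /inv_fourier_distr; congr regular_distr.
  by apply/funext => x; exact: inv_fourier_fourier.
Qed.
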